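(* Consider a fixed Fourier Neural Operator with $T$ layers satisfying assumptions (A1)–(A5) listed in the context. Let $\mathcal{A}_c\subset\mathcal{A}$ be compact (in $H^s(\mathbb{T}^d;\mathbb{R}^{d_a})$) and let $1\le t\le T$. For $a\in\mathcal{A}_c$ let $v_t(a)=\mathsf{L}_{t-1}\circ\cdots\circ\mathsf{L}_0\circ\mathcal{P}(a)$ be the continuum state and, for an integer $N>1$ with $K<N/2$, let $v_t^N(a)=\mathsf{L}^N_{t-1}\circ\cdots\circ\mathsf{L}^N_0\circ\mathcal{P}(a)$ be the discretized state on the grid $X^{(N)}$. Let $$p_t^N(a)(x)=\sum_{k\in[[N]]^d}\mathsf{DFT}(v_t^N(a))(k)\,e^{2\pi i\langle k,x\rangle},\qquad x\in\mathbb{T}^d,$$ be the interpolating trigonometric polynomial of the grid values $\{v_t^N(a)(x_n)\}_{n\in[N]^d}$. Then there is a constant $C'$, depending on $B,M,d,s,t$ and $\mathcal{A}_c$ (for the fixed FNO) and not on $N$, such that for all such $N$ $$\sup_{a\in\mathcal{A}_c}\|v_t(a)-p_t^N(a)\|_{L^2(\mathbb{T}^d)}\le C'N^{-s}.$$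
   Context: Notation. $\mathbb{T}^d$ is $[0,1]^d$ with periodic boundary conditions; $|\cdot|$ is the Euclidean norm; $\|\cdot\|_2$ is the induced matrix 2-norm; $\|\cdot\|_F$ is the Frobenius norm. For an integer $s\ge 0$, $H^s(\mathbb{T}^d;\mathbb{R}^m)$ is the Sobolev space of $f$ with $\sum_{k\in\mathbb{Z}^d}(1+|k|^{2s})|\widehat f(k)|^2<\infty$, where $\widehat f(k)=\int_{\mathbb{T}^d}f(x)e^{-2\pi i\langle k,x\rangle}dx$. For $s>d/2$ elements are identified with their continuous representatives. $[N]^d=\{n\in\mathbb{Z}_{\ge0}^d: n_i<N\ \forall i\}$, $x_n=n/N$, $X^{(N)}=\{x_n:n\in[N]^d\}$. For a positive integer $J$, $[[J]]=\{-L,\dots,L\}$ if $J=2L+1$ and $[[J]]=\{-L,\dots,L-1\}$ if $J=2L$; $[[J]]^d$ is its $d$-fold product. For $v$ given on the grid, $\mathsf{DFT}(v)(k)=\frac1{N^d}\sum_{n\in[N]^d}v(x_n)e^{-2\pi i\langle k,x_n\rangle}$. The $L^2$ norm is that of vector-valued (possibly complex-valued) functions. A shallow neural network is a map $\phi(u)=\sigma(A_1u+b)$ with matrix $A_1$, vector $b$ and activation $\sigma$; $\|\phi\|_{\mathrm{NN}}^2:=\|A_1\|_F^2+|b|^2$. Fourier Neural Operator (FNO). $\Psi=\mathcal{Q}\circ\mathsf{L}_{T-1}\circ\cdots\circ\mathsf{L}_0\circ\mathcal{P}$, mapping a space $\mathcal{A}$ of $\mathbb{R}^{d_a}$-valued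 functions on $\mathbb{T}^d$ to $\mathbb{R}^{d_u}$-valued functions. Here $\mathcal{P}:\mathbb{R}^{d_a}\to\mathbb{R}^{d_0}$ and $\mathcal{Q}:\mathbb{R}^{d_T}\to\mathbb{R}^{d_u}$ are shallow neural networks with globally Lipschitz $C^\infty$ activations $\sigma_p,\sigma_q$, acting pointwise in $x$. The layers are $\mathsf{L}_tv=\sigma_t(W_tv+\mathcal{K}_tv+b_t)$, $t=0,\dots,T-1$, with $W_t\in\mathbb{R}^{d_{t+1}\times d_t}$, $b_t\in\mathbb{R}^{d_{t+1}}$, and $\sigma_t:\mathbb{R}^{d_{t+1}}\to\mathbb{R}^{d_{t+1}}$ a globally Lipschitz, non-polynomial $C^\infty$ activation applied pointwise in $x$. The kernel operator is $$(\mathcal{K}_tv)(x)=\sum_{k\in[[K]]^d}P_t^{(k)}\,\widehat v(k)\,e^{2\pi i\langle k,x\rangle},$$ with $P_t^{(k)}\in\mathbb{C}^{d_{t+1}\times d_t}$ such that $\mathcal{K}_t$ maps real-valued functions to real-valued functions, and $K$ a fixed positive integer (mode truncation). Write $\|P_t\|_F^2=\sum_{k\in[[K]]^d}\|P_t^{(k)}\|_F^2$. States. $v_0(a)=\mathcal{P}(a)$ and $v_{t+1}(a)=\mathsf{L}_tv_t(a)$. Discretized FNO. With the same parameters, $v_0^N(a)=\mathcal{P}(a)$ on $X^{(N)}$ and $v_{t+1}^N=\mathsf{L}_t^Nv_t^N=\sigma_t(W_tv_t^N+\mathcal{K}_t^Nv_t^N+b_t)$ on $X^{(N)}$, where $$(\mathcal{K}_t^Nv)(x_n)=\sum_{k\in[[K]]^d}P_t^{(k)}\,\mathsf{DFT}(v)(k)\,e^{2\pi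 i\langle k,x_n\rangle}.$$ Assumptions. (A1) There is $B\ge1$ such that $\sigma_t$ ($0\le t\le T-1$), $\sigma_p$, $\sigma_q$ have continuous derivatives of orders $1,\dots,s$ bounded by $B$ (in the norm of multilinear maps between Euclidean spaces). (A2) $\mathcal{A}\subset H^s(\mathbb{T}^d;\mathbb{R}^{d_a})$. (A3) $1\le K<N/2$. (A4) $s>d/2$, $s$ an integer. (A5) There is $M\ge1$ such that $\|P_t\|_F\le M$, $\|W_t\|_2\le M$, $|b_t|\le M$ for all $0\le t\le T-1$; and $\mathcal{P},\mathcal{Q}$ are smooth and bounded in the sense that $\|\mathcal{P}\|_{\mathrm{NN}}\le M$, $\|\mathcal{Q}\|_{\mathrm{NN}}\le M$. *)

(* Defs.v *)
From HB Require Import structures.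
From mathcomp Require Import all_boot all_order all_algebra.
From mathcomp Require Import all_classical all_reals all_analysis.
From mathcomp Require Import complex.
From mathcomp Require mpoly.
Import Order.TTheory GRing.Theory Num.Theory numFieldNormedType.Exports.

Set Implicit Arguments.
Unset Strict Implicit.
Unset Printing Implicit Defensive.

Local Open Scope classical_set_scope.
Local Open Scope ring_scope.
Local Open Scope complex_scope.

(* On column vectors [frob] is the Euclidean norm; the norm that MathComp-Analysis
   puts on matrices is the sup norm. *)
Definition frob (R : realType) (m n : nat) (A : 'M[R]_(m, n)) : R :=
  Num.sqrt (\sum_i \sum_j A i j ^+ 2).

Definition cfrob (R : realType) (m n : nat) (A : 'M[R[i]]_(m, n)) : R :=
  Num.sqrt (\sum_i \sum_j (complex.Re (A i j) ^+ 2 + complex.Im (A i j) ^+ 2)).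

Definition opnorm2 (R : realType) (m n : nat) (A : 'M[R]_(m, n)) : \bar R :=
  ereal_sup [set (frob (A *m v))%:E | v in [set v : 'cV[R]_n | frob v <= 1]].

Definition complex_mx (R : realType) (m n : nat) (A : 'M[R]_(m, n)) :
  'M[R[i]]_(m, n) := map_mx (real_complex R) A.

Section Calculus.
Context (R : realType) (m n : nat).
Implicit Type f : 'cV[R]_m -> 'cV[R]_n.

(* For smooth f this is the value of the Frechet derivative of order [size hs]
   at the vectors hs, as a function of the base point. *)
Definition iter_derive (hs : seq 'cV[R]_m) f : 'cV[R]_m -> 'cV[R]_n :=
  foldr (fun h g x => 'D_h g x) f hs.

Definition smooth f : Prop :=
  forall (hs : seq 'cV[R]_m) (x : 'cV[R]_m), differentiable (iter_derive hs f) x.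

(* Operator norm of the derivative of order j at x, as a j-linear map between
   Euclidean spaces. *)
Definition deriv_norm (j : nat) f (x : 'cV[R]_m) : \bar R :=
  ereal_sup [set (frob (iter_derive hs f x))%:E
            | hs in [set hs : j.-tuple 'cV[R]_m | forall h, h \in hs -> frob h <= 1]].

Definition derivs_bounded (s : nat) (B : R) f : Prop :=
  forall j x, (1 <= j <= s)%N -> (deriv_norm j f x <= B%:E)%E.

Definition globally_lipschitz f : Prop :=
  exists L : R, forall x y, frob (f x - f y) <= L * frob (x - y).

Definition polynomial_map f : Prop :=
  forall i, exists p : mpoly.mpoly m R,
    forall x, f x i 0 = mpoly.meval (fun j => x j 0) p.

End Calculus.

Section Torus.
Context (R : realType).

(* Functions on the torus are the Z^d-periodic functions on R^d. *)
Definition torus_periodic (d : nat) (T : Type) (f : 'cV[R]_d -> T) : Prop :=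
  forall (x : 'cV[R]_d) (z : 'cV[int]_d), f (x + map_mx intr z) = f x.

(* The integral over [0, 1]^d, as an iterated Lebesgue integral (Fubini); it is
   only used on continuous functions. *)
Fixpoint torus_int (d : nat) : ('cV[R]_d -> R) -> R :=
  match d with
  | 0 => fun f => f 0
  | d'.+1 => fun f =>
      \int[lebesgue_measure]_(y in `[0, 1])
        torus_int (fun x : 'cV[R]_d' => f (col_mx (const_mx y : 'cV[R]_1) x))
  end%R.

Definition torus_cint (d : nat) (f : 'cV[R]_d -> R[i]) : R[i] :=
  torus_int (fun x => complex.Re (f x)) +i* torus_int (fun x => complex.Im (f x)).

Definition L2norm (d m : nat) (f : 'cV[R]_d -> 'cV[R[i]]_m) : R :=
  Num.sqrt (torus_int (fun x => cfrob (f x) ^+ 2)).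

Definition pairing (d : nat) (k : 'cV[int]_d) (x : 'cV[R]_d) : R :=
  \sum_i (k i 0)%:~R * x i 0.

(* exp (2 pi i theta) *)
Definition cexp (theta : R) : R[i] :=
  cos (2 * pi * theta) +i* sin (2 * pi * theta).

Definition fourier (d m : nat) (f : 'cV[R]_d -> 'cV[R]_m) (k : 'cV[int]_d) :
  'cV[R[i]]_m :=
  \col_i torus_cint (fun x => (f x i 0)%:C * cexp (- pairing k x)).

(* [[J]]^d: both for J = 2L+1 and for J = 2L, [[J]] is {j - L : 0 <= j < J}. *)
Definition modes (d J : nat) : seq 'cV[int]_d :=
  [seq \col_i ((j i)%:Z - (J./2)%:Z) | j : {ffun 'I_d -> 'I_J}].

Definition grid (d N : nat) : Type := {ffun 'I_d -> 'I_N}.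

Definition gridpoint (d N : nat) (n : grid d N) : 'cV[R]_d :=
  \col_i ((n i)%:R / N%:R).

Definition dft (d N m : nat) (v : grid d N -> 'cV[R]_m) (k : 'cV[int]_d) :
  'cV[R[i]]_m :=
  (N%:R ^- d) *: \sum_(n : {ffun 'I_d -> 'I_N})
    cexp (- pairing k (gridpoint n)) *: complex_mx (v n).

Definition trig_interp (d N m : nat) (v : grid d N -> 'cV[R]_m) (x : 'cV[R]_d) :
  'cV[R[i]]_m :=
  \sum_(k <- modes d N) cexp (pairing k x) *: dft v k.

Definition sobolev_norm (d m s : nat) (f : 'cV[R]_d -> 'cV[R]_m) : \bar R :=
  ((\esum_(k in [set: 'cV[int]_d])
     ((1 + frob (map_mx intr k : 'cV[R]_d) ^+ (2 * s))
        * cfrob (fourier f k) ^+ 2)%:E) `^ 2^-1)%E.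

End Torus.

(* H^s(T^d; R^m) for s > d/2, each class being represented by its continuous
   member. *)
Record Hs (R : realType) (d m s : nat) := MkHs {
  Hs_fun :> 'cV[R]_d -> 'cV[R]_m;
  Hs_continuous : continuous Hs_fun;
  Hs_periodic : torus_periodic Hs_fun;
  Hs_finite : (sobolev_norm s Hs_fun < +oo)%E
}.

Section HsTopology.
Context (R : realType) (d m s : nat).

Definition Hs_ball (a : Hs R d m s) (r : R) : set (Hs R d m s) :=
  [set b : Hs R d m s | (sobolev_norm s (fun x => a x - b x)%R < r%:E)%E].

Definition Hs_open : set_system (Hs R d m s) :=
  [set U | forall a, U a -> exists2 r : R, 0 < r & Hs_ball a r `<=` U].

Lemma Hs_openT : Hs_open setT.
Proof. by move=> a _; exists 1. Qed.

Lemma Hs_openI : setI_closed Hs_open.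
Proof.
move=> U V oU oV a [Ua Va].
have [r r0 rU] := oU a Ua; have [q q0 qV] := oV a Va.
exists (Num.min r q); first by rewrite lt_min r0 q0.
move=> b ab; split.
- by apply: rU; apply: (lt_le_trans ab); rewrite lee_fin ge_min lexx.
- by apply: qV; apply: (lt_le_trans ab); rewrite lee_fin ge_min lexx orbT.
Qed.

Lemma Hs_open_bigU (I : Type) (U : I -> set (Hs R d m s)) :
  (forall i, Hs_open (U i)) -> Hs_open (\bigcup_i U i).
Proof.
move=> oU a [i _ Ua]; have [r r0 rU] := oU i a Ua.
by exists r => // b /rU Ub; exists i.
Qed.

HB.instance Definition _ := gen_eqMixin (Hs R d m s).
HB.instance Definition _ := gen_choiceMixin (Hs R d m s).
HB.instance Definition _ :=
  isOpenTopological.Build (Hs R d m s) Hs_openT Hs_openI Hs_open_bigU.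

End HsTopology.

Record shallow_net (R : realType) (m n : nat) := ShallowNet {
  net_mx : 'M[R]_(n, m);
  net_bias : 'cV[R]_n;
  net_act : 'cV[R]_n -> 'cV[R]_n;
  net_act_smooth : smooth net_act;
  net_act_lipschitz : globally_lipschitz net_act
}.

Definition net_eval (R : realType) (m n : nat) (phi : shallow_net R m n)
    (u : 'cV[R]_m) : 'cV[R]_n :=
  net_act phi (net_mx phi *m u + net_bias phi).

Definition net_norm (R : realType) (m n : nat) (phi : shallow_net R m n) : R :=
  Num.sqrt (frob (net_mx phi) ^+ 2 + frob (net_bias phi) ^+ 2).

(* [vhat] is either the Fourier transform or the DFT of the argument. *)
Definition kernel_op (R : realType) (d K m n : nat)
    (P : 'cV[int]_d -> 'M[R[i]]_(n, m)) (vhat : 'cV[int]_d -> 'cV[R[i]]_m)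
    (x : 'cV[R]_d) : 'cV[R[i]]_n :=
  \sum_(k <- modes d K) cexp (pairing k x) *: (P k *m vhat k).

(* Only the widths of index <= T, the layers of index < T, and the multipliers
   of frequency in [[K]]^d are meaningful. *)
Record fno (R : realType) (d da du K T : nat) := FNO {
  width : nat -> nat;
  lifting : shallow_net R da (width 0);
  projection : shallow_net R (width T) du;
  weight : forall t, 'M[R]_(width t.+1, width t);
  bias : forall t, 'cV[R]_(width t.+1);
  multiplier : forall t, 'cV[int]_d -> 'M[R[i]]_(width t.+1, width t);
  act : forall t, 'cV[R]_(width t.+1) -> 'cV[R]_(width t.+1);
  act_smooth : forall t, (t < T)%N -> smooth (@act t);
  act_lipschitz : forall t, (t < T)%N -> globally_lipschitz (@act t);
  act_nonpolynomial : forall t, (t < T)%N -> ~ polynomial_map (@act t);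
  multiplier_real : forall t, (t < T)%N ->
    forall v : 'cV[R]_d -> 'cV[R]_(width t), continuous v -> torus_periodic v ->
    forall x i, complex.Im (kernel_op K (@multiplier t) (fourier v) x i 0) = 0
}.

Section FNO.
Context (R : realType) (d da du K T : nat) (F : fno R d da du K T).

(* The kernel term is real by [multiplier_real]; taking its real part only moves
   it from C^n to R^n. *)
Definition layer (t : nat) (v : 'cV[R]_d -> 'cV[R]_(width F t)) (x : 'cV[R]_d) :
  'cV[R]_(width F t.+1) :=
  act (weight F t *m v x
       + map_mx (@complex.Re R) (kernel_op K (multiplier F t) (fourier v) x)
       + bias F t).

Fixpoint state (a : 'cV[R]_d -> 'cV[R]_da) (t : nat) :
    'cV[R]_d -> 'cV[R]_(width F t) :=
  match t with
  | 0 => fun x => net_eval (lifting F) (a x)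
  | t'.+1 => layer (state a t')
  end.

Definition fno_eval (a : 'cV[R]_d -> 'cV[R]_da) (x : 'cV[R]_d) : 'cV[R]_du :=
  net_eval (projection F) (state a T x).

Definition discrete_layer (N t : nat) (v : grid d N -> 'cV[R]_(width F t))
    (n : grid d N) : 'cV[R]_(width F t.+1) :=
  act (weight F t *m v n
       + map_mx (@complex.Re R)
           (kernel_op K (multiplier F t) (dft v) (gridpoint R n))
       + bias F t).

Fixpoint discrete_state (N : nat) (a : 'cV[R]_d -> 'cV[R]_da) (t : nat) :
    grid d N -> 'cV[R]_(width F t) :=
  match t with
  | 0 => fun n => net_eval (lifting F) (a (gridpoint R n))
  | t'.+1 => discrete_layer (discrete_state a t')
  end.

Definition activations_bounded (s : nat) (B : R) : Prop :=
  [/\ derivs_bounded s B (net_act (lifting F)),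
      derivs_bounded s B (net_act (projection F)) &
      forall t, (t < T)%N -> derivs_bounded s B (@act R d da du K T F t)].

Definition multiplier_norm (t : nat) : R :=
  Num.sqrt (\sum_(k <- modes d K) cfrob (multiplier F t k) ^+ 2).

Definition weights_bounded (M : R) : Prop :=
  [/\ net_norm (lifting F) <= M, net_norm (projection F) <= M &
      forall t, (t < T)%N ->
        [/\ multiplier_norm t <= M, (opnorm2 (weight F t) <= M%:E)%E
          & frob (bias F t) <= M]].

End FNO.

Arguments discrete_state {R d da du K T} F N a t n.

(* Main.v *)
(** All estimates are for squares of norms. Sobolev functions are described by uniform
    approximation with trigonometric polynomials of bounded weighted energy; for s > d/2
    this class embeds in the bounded functions (the lattice sum of |k|^(-2s) converges) and
    a Fejer mean shows that it contains a compact, hence bounded, subset of H^s.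

    The class is stable under smooth Lipschitz maps: comparing f applied to consecutive
    dyadic truncations of its argument, (s+1)-fold derivatives grow slowly enough for the
    dyadic pieces of the composition to be summed. The nonlocal term of a layer is a
    trigonometric polynomial with boundedly many frequencies, so by induction every state
    stays in the class, with a bound uniform over the input set.

    On the grid, frequencies congruent modulo N coincide; a Cauchy-Schwarz estimate of
    these aliases gives an error of order N^(-2s) for each discrete Fourier coefficient and
    for trigonometric interpolation. Since activations are Lipschitz, the error at the
    grid points is propagated from layer to layer at this order, and Parseval turns it into
    the L^2 estimate for the interpolant. *)

Require Import Defs.
From mathcomp Require Import all_boot all_order all_algebra.
From mathcomp Require Import all_classical all_reals all_analysis.
From mathcomp Require Import complex.
From mathcomp Require Import ring lra zify.
Import Order.TTheory GRing.Theory Num.Theory numFieldNormedType.Exports.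

Set Implicit Arguments.
Unset Strict Implicit.
Unset Printing Implicit Defensive.
Local Open Scope classical_set_scope.
Local Open Scope ring_scope.

(** Differentiating a composition s times directly gives products of intermediate derivatives of a
    function that is only in H^s, and these call for interpolation inequalities. Truncation at
    frequency 2^J avoids them: each derivative of a truncation is bounded in sup norm at the cost of
    a factor 2^J. One derivative more than s is taken, and the surplus factor 2^J turns the sum over
    scales into a convergent geometric series.

    Activations are composed only with real parts of trigonometric polynomials, with bounds that do
    not depend on the degree. Uniform limits then reach the whole class. Only pure derivatives along
    one coordinate axis occur, because the weight of a frequency is dominated by the sum of its
    one-coordinate weights.

    Fejer means, rather than partial sums, lead from bounds on coefficients back to the class: their
    multipliers lie in [0, 1], so no energy is gained, and positivity of the kernel gives uniform
    convergence for every continuous periodic function.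

    Throughout, constants are quantified before the functions and before the grid size; uniformity
    over the input set and in N rests on this order. *)

(** * Integration over the torus *)

Section TorusIntegral.
Context {R : realType}.

(* [torus_int] is an iterated Lebesgue integral, so its linearity and monotonicity
   need every inner integral to be again a continuous function of the remaining
   variable; boundedness and uniform continuity pass from one level to the next. *)
Definition ucb d (f : 'cV[R]_d -> R) : Prop :=
  (exists C : R, forall x, `|f x| <= C) /\
  (forall e : R, 0 < e -> exists2 del, 0 < del &
     forall x y : 'cV[R]_d, (forall i, `|x i 0 - y i 0| <= del) -> `|f x - f y| <= e).

Lemma ucb_cst d (c : R) : ucb (fun _ : 'cV[R]_d => c).
Proof.
split; first by exists `|c|.
by move=> e e0; exists 1 => // x y _; rewrite subrr normr0 ltW.
Qed.

(** The common source of the closure properties: sums, products and, later, compositions with smooth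
    maps are all Lipschitz in finitely many bounded arguments. The Lipschitz bound is asked only on
    a cube because products and smooth maps satisfy no global one. *)
Lemma ucb_lip (n d : nat) (F : 'cV[R]_n -> R) (L : R) (f : 'I_n -> 'cV[R]_d -> R)
    (A : R) : 0 <= L ->
  (forall x y : 'cV[R]_n, (forall i, `|x i 0| <= A) -> (forall i, `|y i 0| <= A) ->
     `|F x - F y| <= L * \sum_i `|x i 0 - y i 0|) ->
  (forall i, ucb (f i)) -> (forall i x, `|f i x| <= A) ->
  ucb (fun x => F (\col_i f i x)).
Proof.
move=> L0 FL uf fA; case: (pselect (exists x : 'cV[R]_d, True)) => [[x0 _]|H]; last first.
  by split; [exists 0 => x | move=> e e0; exists 1 => // x]; case: H; exists x.
split.
  exists (`|F (\col_i f i x0)| + L * \sum_(i < n) (A + A)) => x.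
  rewrite -[F (\col_i f i x)](subrK (F (\col_i f i x0))) addrC.
  apply: (le_trans (ler_normD _ _)); rewrite lerD2l.
  apply: (le_trans (FL _ _ _ _)); [by move=> i; rewrite mxE .. |].
  apply: ler_wpM2l => //; apply: ler_sum => i _; rewrite !mxE.
  by apply: (le_trans (ler_normB _ _)); exact: lerD.
move=> e e0.
have eps0 : 0 < e / (L * n%:R + 1).
  by apply: divr_gt0 => //; rewrite ltr_wpDl // mulr_ge0.
have /fin_all_exists[del Hdel] (i : 'I_n) : exists del : R, 0 < del /\
    forall x y : 'cV[R]_d, (forall j, `|x j 0 - y j 0| <= del) ->
      `|f i x - f i y| <= e / (L * n%:R + 1).
  by case: (uf i) => _ /(_ _ eps0)[del d0 H]; exists del.
exists (\big[Num.min/1]_i del i).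
  elim/big_ind : _ => // [a b a0 b0|i _]; first by rewrite lt_min a0.
  by case: (Hdel i).
move=> x y xy; apply: (le_trans (FL _ _ _ _)); [by move=> i; rewrite mxE .. |].
apply: (@le_trans _ _ (L * \sum_(i < n) (e / (L * n%:R + 1)))).
  apply: ler_wpM2l => //; apply: ler_sum => i _; rewrite !mxE.
  case: (Hdel i) => _; apply => j; apply: (le_trans (xy j)).
  exact: bigmin_le_cond.
rewrite sumr_const card_ord -[X in L * X]mulr_natl.
rewrite [n%:R * _]mulrCA [L * _]mulrCA [L * (n%:R / _)]mulrA -[leRHS]mulr1.
rewrite ler_pM2l // ler_pdivrMr ?mul1r ?lerDl //.
by rewrite ltr_wpDl // mulr_ge0.
Qed.

Lemma ucb_sum_lip d (n : nat) (f : 'I_n -> 'cV[R]_d -> R) :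
  (forall i, ucb (f i)) -> ucb (fun x => \sum_i f i x).
Proof.
move=> uf.
have /fin_all_exists[C HC] i : exists C : R, forall x, `|f i x| <= C by case: (uf i).
have := @ucb_lip n d (fun x => \sum_i x i 0) 1 f (\big[Num.max/0]_i C i) ler01.
under [X in _ -> _ -> _ -> ucb X]eq_fun do under eq_bigr do rewrite mxE.
apply => //.
- move=> x y _ _; rewrite mul1r -sumrB; exact: ler_norm_sum.
- by move=> i x; apply: (le_trans (HC i x)); exact: le_bigmax_cond.
Qed.

Lemma ucbD d (f g : 'cV[R]_d -> R) : ucb f -> ucb g -> ucb (fun x => f x + g x).
Proof.
move=> uf ug; have := @ucb_sum_lip d 2 (fun i => if i == 0 then f else g).
rewrite (_ : (fun x => \sum_(_ < 2) _) = (fun x => f x + g x)).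
  by apply=> i; case: ifP.
by apply/funext => x; rewrite big_ord_recl big_ord1.
Qed.

Lemma ucbM d (f g : 'cV[R]_d -> R) : ucb f -> ucb g -> ucb (fun x => f x * g x).
Proof.
move=> uf ug; have [[C fC] _] := uf; have [[D gD] _] := ug.
have CD0 (x : 'cV[R]_d) : 0 <= Num.max C D.
  by rewrite le_max (le_trans _ (fC x)).
case: (pselect (exists x : 'cV[R]_d, True)) => [[x0 _]|H]; last first.
  by split; [exists 0 => x | move=> e e0; exists 1 => // x]; case: H; exists x.
have {}CD0 := CD0 x0.
have := @ucb_lip 2 d (fun x => x 0 0 * x 1 0) (Num.max C D)
  (fun i => if i == 0 then f else g) (Num.max C D) CD0.
under [X in _ -> _ -> _ -> ucb X]eq_fun do rewrite !mxE /=.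
apply => //.
- move=> x y xA yA; rewrite big_ord_recl big_ord1 /=.
  rewrite (_ : lift ord0 ord0 = 1); last exact/val_inj.
  have -> : x 0 0 * x 1 0 - y 0 0 * y 1 0 =
    (x 0 0 - y 0 0) * x 1 0 + y 0 0 * (x 1 0 - y 1 0) by ring.
  apply: (le_trans (ler_normD _ _)); rewrite !normrM mulrDr lerD //.
    by rewrite mulrC ler_wpM2r.
  by rewrite ler_wpM2r.
- by move=> i; case: ifP.
- by move=> i x; case: ifP => _; rewrite le_max ?fC ?gD ?orbT.
Qed.

Lemma ucbZ d (c : R) (f : 'cV[R]_d -> R) : ucb f -> ucb (fun x => c * f x).
Proof. by apply: ucbM; exact: ucb_cst. Qed.

Lemma ucbN d (f : 'cV[R]_d -> R) : ucb f -> ucb (fun x => - f x).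
Proof. by move=> uf; under eq_fun do rewrite -mulN1r; exact: ucbZ. Qed.

Lemma ucbB d (f g : 'cV[R]_d -> R) : ucb f -> ucb g -> ucb (fun x => f x - g x).
Proof. by move=> uf ug; apply: ucbD => //; exact: ucbN. Qed.

Lemma ucbX2 d (f : 'cV[R]_d -> R) : ucb f -> ucb (fun x => f x ^+ 2).
Proof. by move=> uf; under eq_fun do rewrite expr2; exact: ucbM. Qed.

Lemma ucb_sum d (I : Type) (r : seq I) (f : I -> 'cV[R]_d -> R) :
  (forall i, ucb (f i)) -> ucb (fun x => \sum_(i <- r) f i x).
Proof.
move=> uf; elim: r => [|i r IH].
  by under eq_fun do rewrite big_nil; exact: ucb_cst.
by under eq_fun do rewrite big_cons; exact: ucbD.
Qed.

Definition consv d (y : R) (x : 'cV[R]_d) : 'cV[R]_d.+1 :=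
  col_mx (const_mx y : 'cV[R]_1) x.

Lemma consv0 d y (x : 'cV[R]_d) : consv y x ord0 0 = y.
Proof.
rewrite /consv (_ : ord0 = lshift d (ord0 : 'I_1)); last exact/val_inj.
by rewrite (@col_mxEu R 1 d 1) mxE.
Qed.

Lemma consvS d y (x : 'cV[R]_d) i : consv y x (lift ord0 i) 0 = x i 0.
Proof.
rewrite /consv (_ : lift ord0 i = rshift 1 i); last exact/val_inj.
by rewrite (@col_mxEd R 1 d 1).
Qed.

Lemma torus_intS d (f : 'cV[R]_d.+1 -> R) :
  torus_int f =
  (\int[lebesgue_measure]_(y in `[0, 1]) torus_int (fun x => f (consv y x)))%R.
Proof. by []. Qed.

Lemma ucb_consv d (f : 'cV[R]_d.+1 -> R) y : ucb f -> ucb (fun x => f (consv y x)).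
Proof.
move=> [[C fC] uf]; split; first by exists C.
move=> e /uf[del d0 H]; exists del => // x x' xx'; apply: H => i.
case: (unliftP ord0 i) => [j|] ->; first by rewrite !consvS.
by rewrite !consv0 subrr normr0 ltW.
Qed.

Let mu := @lebesgue_measure R.

Lemma integrable01 (f : R -> R) : continuous f ->
  mu.-integrable `[0%R, 1%R] (EFin \o f).
Proof.
move=> cf; apply: continuous_compact_integrable; first exact: segment_compact.
exact: continuous_subspaceT.
Qed.

(** These four facts are bundled for an induction on the dimension: in dimension d + 1 they need
    continuity of the inner integral, which follows from linearity, monotonicity and normalization
    in dimension d. *)
Let torus_int_spec d : Prop :=
  [/\ forall f g : 'cV[R]_d -> R, ucb f -> ucb g ->
        torus_int (fun x => f x + g x) = torus_int f + torus_int g,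
      forall c (f : 'cV[R]_d -> R), ucb f ->
        torus_int (fun x => c * f x) = c * torus_int f,
      forall f g : 'cV[R]_d -> R, ucb f -> ucb g -> (forall x, f x <= g x) ->
        torus_int f <= torus_int g &
      forall c, torus_int (fun _ : 'cV[R]_d => c) = c].

Let torus_int_spec_dist d : torus_int_spec d ->
  forall (f g : 'cV[R]_d -> R) (e : R), ucb f -> ucb g ->
    (forall x, `|f x - g x| <= e) -> `|torus_int f - torus_int g| <= e.
Proof.
move=> [TD TZ Tle Tc] f g e uf ug fg.
have ue := @ucb_cst d e.
rewrite ler_norml; apply/andP; split.
  rewrite lerBrDr addrC lerBlDr -[leRHS](congr2 +%R erefl (Tc e)) -TD //.
  apply: Tle => // [|x]; first exact: ucbD.
  by have := fg x; rewrite ler_norml => /andP[]; lra.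
rewrite lerBlDr -[leRHS](congr2 +%R (Tc e) erefl) -TD //.
apply: Tle => // [|x]; first exact: ucbD.
by have := fg x; rewrite ler_norml => /andP[]; lra.
Qed.

Let torus_int_spec_cont d : torus_int_spec d ->
  forall (f : 'cV[R]_d.+1 -> R), ucb f ->
  continuous (fun y => torus_int (fun x => f (consv y x))).
Proof.
move=> H f uf y; apply/(@cvgrPdist_le _ R^o) => e e0.
have [_ /(_ _ e0)[del d0 Hd]] := uf.
near=> z; apply: torus_int_spec_dist => //; [exact: ucb_consv..|] => x.
apply: Hd => i; case: (unliftP ord0 i) => [j|] ->.
  by rewrite !consvS subrr normr0 ltW.
rewrite !consv0; near: z; exact: (@cvgr_dist_le _ R^o _ _ _ id y (@cvg_id _ _)).
Unshelve. all: by end_near. Qed.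

Let torus_int_specP d : torus_int_spec d.
Proof.
elim: d => [|d IH]; first by split => // f g _ _ /(_ 0).
have cont := torus_int_spec_cont IH; have [TD TZ Tle Tc] := IH.
split.
- move=> f g uf ug; rewrite !torus_intS -RintegralD //;
    [|exact/integrable01/cont..].
  by apply: eq_Rintegral => y _; rewrite TD //; exact: ucb_consv.
- move=> c f uf; rewrite !torus_intS -RintegralZl //; [|exact/integrable01/cont].
  by apply: eq_Rintegral => y _; rewrite TZ //; exact: ucb_consv.
- move=> f g uf ug fg; rewrite !torus_intS; apply: le_Rintegral => //;
    [exact/integrable01/cont..|].
  by move=> y _; apply: Tle => //; exact: ucb_consv.
- move=> c; rewrite torus_intS.
  under eq_Rintegral do rewrite Tc.
  rewrite Rintegral_cst //= lebesgue_measure_itv /= lte_fin ltr01.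
  by rewrite oppr0 addr0 mulr1.
Qed.

Lemma torus_intD d (f g : 'cV[R]_d -> R) : ucb f -> ucb g ->
  torus_int (fun x => f x + g x) = torus_int f + torus_int g.
Proof. by case: (torus_int_specP d) => H _ _ _; exact: H. Qed.

Lemma torus_intZ d c (f : 'cV[R]_d -> R) : ucb f ->
  torus_int (fun x => c * f x) = c * torus_int f.
Proof. by case: (torus_int_specP d) => _ H _ _; exact: H. Qed.

Lemma le_torus_int d (f g : 'cV[R]_d -> R) : ucb f -> ucb g ->
  (forall x, f x <= g x) -> torus_int f <= torus_int g.
Proof. by case: (torus_int_specP d) => _ _ H _; exact: H. Qed.

Lemma torus_int_cst d c : torus_int (fun _ : 'cV[R]_d => c) = c.
Proof. by case: (torus_int_specP d) => _ _ _ H; exact: H. Qed.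

Lemma torus_int_dist d (f g : 'cV[R]_d -> R) (e : R) : ucb f -> ucb g ->
  (forall x, `|f x - g x| <= e) -> `|torus_int f - torus_int g| <= e.
Proof. exact: (torus_int_spec_dist (torus_int_specP d)). Qed.

Lemma torus_int_continuous d (f : 'cV[R]_d.+1 -> R) : ucb f ->
  continuous (fun y => torus_int (fun x => f (consv y x))).
Proof. exact: (torus_int_spec_cont (torus_int_specP d)). Qed.

Lemma torus_intN d (f : 'cV[R]_d -> R) : ucb f ->
  torus_int (fun x => - f x) = - torus_int f.
Proof.
by move=> uf; rewrite -mulN1r -torus_intZ //; congr torus_int; apply/funext => x;
  rewrite mulN1r.
Qed.

Lemma torus_intB d (f g : 'cV[R]_d -> R) : ucb f -> ucb g ->
  torus_int (fun x => f x - g x) = torus_int f - torus_int g.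
Proof. by move=> uf ug; rewrite torus_intD ?torus_intN //; exact: ucbN. Qed.

Lemma torus_int_ge0 d (f : 'cV[R]_d -> R) : ucb f -> (forall x, 0 <= f x) ->
  0 <= torus_int f.
Proof.
move=> uf f0; rewrite -[leLHS](@torus_int_cst d); apply: le_torus_int => //.
exact: ucb_cst.
Qed.

Lemma torus_int_sum d (I : Type) (r : seq I) (f : I -> 'cV[R]_d -> R) :
  (forall i, ucb (f i)) ->
  torus_int (fun x => \sum_(i <- r) f i x) = \sum_(i <- r) torus_int (f i).
Proof.
move=> uf; elim: r => [|i r IH].
  by under eq_fun do rewrite big_nil; rewrite torus_int_cst big_nil.
under eq_fun do rewrite big_cons.
by rewrite torus_intD ?IH ?big_cons //; exact: ucb_sum.
Qed.

End TorusIntegral.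

(** * Calculus on the torus: integrals of characters and of partial derivatives *)

Section TorusCalculus.
Context {R : realType}.
Let mu := @lebesgue_measure R.

Lemma FTC01 (F f : R -> R) : continuous f ->
  (forall x, is_derive x (1 : R) F (f x)) ->
  (\int[mu]_(x in `[0%R, 1%R]) f x)%R = F 1 - F 0.
Proof.
move=> cf dF.
have cF : continuous F.
  move=> x; apply/differentiable_continuous/derivable1_diffP.
  by case: (dF x).
rewrite /Rintegral (@continuous_FTC2 R f F 0 1) ?ltr01 //.
- exact: continuous_subspaceT.
- split.
  + by move=> x _; case: (dF x).
  + by apply: cvg_at_right_filter; exact: cF.
  + by apply: cvg_at_left_filter; exact: cF.
- by move=> x _; rewrite derive1E; case: (dF x).
Qed.

Lemma sinD2piZ (x : R) (m : int) : sin (x + 2 * pi * m%:~R) = sin x.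
Proof.
have H n (y : R) : sin (y + 2 * pi * n%:R) = sin y.
  by have := periodicn (@sinD2pi R) n y; rewrite -[_ *+ n]mulr_natr -[pi *+ 2]mulr_natl.
case: m => n; first exact: H.
by rewrite NegzE mulrNz mulrN -[in RHS](subrK (2 * pi * n.+1%:R) x) H.
Qed.

Lemma cosD2piZ (x : R) (m : int) : cos (x + 2 * pi * m%:~R) = cos x.
Proof. by rewrite -!sinDpihalf addrAC sinD2piZ. Qed.

Lemma is_derive_cos_affine (a b x : R) :
  is_derive x (1 : R) (fun y => cos (a * y + b)) (- (a * sin (a * x + b))).
Proof.
have -> : (fun y => cos (a * y + b)) = cos \o (fun y => a * y + b) by [].
have d1 : is_derive x (1:R) (fun y => a * y + b) a.
  have -> : (fun y : R => a * y + b) = (fun y => a *: y + b) by [].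
  by apply: is_derive_eq; rewrite addr0 /GRing.scale /= mulr1.
apply: is_derive_eq (is_derive1_comp _ _) _.
by rewrite mulrC mulrN.
Qed.

Lemma is_derive_sin_affine (a b x : R) :
  is_derive x (1 : R) (fun y => sin (a * y + b)) (a * cos (a * x + b)).
Proof.
have := is_derive_cos_affine a (b - pi / 2) x.
under eq_fun do rewrite addrA cosBpihalf.
by rewrite addrA sinBpihalf mulrN opprK.
Qed.

Lemma int01_cos (m : int) (th : R) :
  (\int[mu]_(y in `[0%R, 1%R]) cos (2 * pi * (m%:~R * y + th)))%R
  = if m == 0 then cos (2 * pi * th) else 0.
Proof.
have -> : (fun y : R => cos (2 * pi * (m%:~R * y + th))) =
          (fun y => cos ((2 * pi * m%:~R) * y + 2 * pi * th)).
  by apply/funext => y; rewrite mulrDr mulrA.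
have [->|m0] := eqVneq m 0.
  under eq_Rintegral do rewrite mulr0 mul0r add0r.
  rewrite Rintegral_cst //= lebesgue_measure_itv /= lte_fin ltr01.
  by rewrite oppr0 addr0 mulr1.
have c0 : 2 * pi * m%:~R != 0 :> R.
  by rewrite !mulf_neq0 ?intr_eq0 ?pnatr_eq0 // gt_eqF // pi_gt0.
set c := 2 * pi * m%:~R in c0 *.
have cf : continuous (fun y => cos (c * y + 2 * pi * th)).
  move=> y; apply: differentiable_continuous; apply/derivable1_diffP.
  by case: (is_derive_cos_affine c (2 * pi * th) y).
have dF x : is_derive x (1 : R) (fun y => c^-1 * sin (c * y + 2 * pi * th))
    (cos (c * x + 2 * pi * th)).
  have H := is_derive_sin_affine c (2 * pi * th) x.
  have -> : (fun y => c^-1 * sin (c * y + 2 * pi * th)) =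
     c^-1 \*: (fun y => sin (c * y + 2 * pi * th)) by [].
  by apply: is_derive_eq; rewrite /GRing.scale /= mulKf.
by rewrite (FTC01 cf dF) mulr1 mulr0 add0r [c + _]addrC sinD2piZ subrr.
Qed.

Lemma pairing_consv d (k : 'cV[int]_d.+1) y (x : 'cV[R]_d) :
  pairing k (consv y x) =
  (k ord0 0)%:~R * y + pairing (\col_i k (lift ord0 i) 0) x.
Proof.
rewrite /pairing big_ord_recl consv0; congr (_ + _).
by apply: eq_bigr => i _; rewrite consvS mxE.
Qed.

(** The free phase [th] makes the induction close: the contribution of the outer variable is
    absorbed into the phase of the inner integral. *)
Lemma torus_int_cos d (k : 'cV[int]_d) (th : R) :
  torus_int (fun x => cos (2 * pi * (pairing k x + th))) =
  if k == 0 then cos (2 * pi * th) else 0.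
Proof.
elim: d k th => [|d IH] k th.
  rewrite [k]flatmx0 eqxx /= /pairing big_ord0 add0r //.
rewrite torus_intS.
under eq_Rintegral => y _.
  under eq_fun do rewrite pairing_consv addrAC addrC.
  rewrite IH; over.
have [k0|k0] := eqVneq (\col_i k (lift ord0 i) 0) (0 : 'cV[int]_d).
  rewrite int01_cos.
  have -> : (k == 0) = (k ord0 0 == 0) => //.
  apply/eqP/eqP => [->|k00]; first by rewrite mxE.
  apply/colP => i; rewrite mxE; case: (unliftP ord0 i) => [j|] -> //.
  by have /colP/(_ j) := k0; rewrite !mxE.
rewrite Rintegral_cst //= mul0r; case: eqP => // k1.
by case/eqP: k0; apply/colP => i; rewrite !mxE k1 mxE.
Qed.

Lemma torus_int_sin d (k : 'cV[int]_d) (th : R) :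
  torus_int (fun x => sin (2 * pi * (pairing k x + th))) =
  if k == 0 then sin (2 * pi * th) else 0.
Proof.
have H (z : R) : sin (2 * pi * z) = cos (2 * pi * (z - 4^-1)).
  rewrite -cosBpihalf mulrBr; congr (cos (_ - _)).
  by field.
under eq_fun do rewrite H -addrA.
by rewrite torus_int_cos H.
Qed.

Definition evec d (i : 'I_d) : 'cV[R]_d := delta_mx i 0.

Lemma is_derive_line (V : normedModType R) (f : V -> R) (x v : V) (t l : R) :
  is_derive (t *: v + x) v f l <-> is_derive t (1 : R) (fun h => f (h *: v + x)) l.
Proof.
have E : (fun h : R => h^-1 *: ((f \o shift (t *: v + x)) (h *: v) - f (t *: v + x)))
  = (fun h : R => h^-1 *: (((fun h => f (h *: v + x)) \o shift t) (h *: (1:R)) -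
      f (t *: v + x))).
  apply/funext => h /=; congr (_ *: (f _ - _)).
  by rewrite addrA -scalerDl /GRing.scale /= mulr1.
split=> -[d1 d2]; split.
- by move: d1; rewrite /derivable E.
- by move: d2; rewrite /derive E.
- by move: d1; rewrite /derivable E.
- by move: d2; rewrite /derive E.
Qed.

Lemma is_derive_line0 (V : normedModType R) (f : V -> R) (x v : V) (l : R) :
  is_derive x v f l <-> is_derive (0 : R) (1 : R) (fun h => f (h *: v + x)) l.
Proof. by have := is_derive_line f x v 0 l; rewrite scale0r add0r. Qed.

Lemma MVT_any (f df : R -> R) (a h : R) :
  (forall x, is_derive x (1 : R) f (df x)) ->
  exists2 c, `|c - a| <= `|h| & f (a + h) - f a = df c * h.
Proof.
move=> H.
have cf : continuous f.
  by move=> x; apply: differentiable_continuous; apply/derivable1_diffP; case: (H x).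
case: (ltgtP h 0) => h0.
- have lt : a + h < a by lra.
  have [c] := MVT lt (fun x _ => H x) (continuous_subspaceT cf).
  rewrite in_itv /= => /andP[c1 c2] E; exists c.
    by rewrite !ltr0_norm ?subr_lt0 //; lra.
  by rewrite -opprB E; ring.
- have lt : a < a + h by lra.
  have [c] := MVT lt (fun x _ => H x) (continuous_subspaceT cf).
  rewrite in_itv /= => /andP[c1 c2] E; exists c.
    by rewrite !gtr0_norm ?subr_gt0 //; lra.
  by rewrite E; ring.
- by exists a; rewrite ?h0 ?mulr0 ?addr0 ?subrr // normr0.
Qed.

Lemma consv_lift d (y t : R) (x : 'cV[R]_d) j :
  t *: evec (lift ord0 j) + consv y x = consv y (t *: evec j + x).
Proof.
apply/colP => i; rewrite 2!mxE; case: (unliftP ord0 i) => [i'|] ->.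
  by rewrite !consvS !mxE (inj_eq lift_inj).
by rewrite !consv0 mxE /= mulr0 add0r.
Qed.

Lemma consv_ord0 d (y t : R) (x : 'cV[R]_d) :
  t *: evec ord0 + consv y x = consv (t + y) x.
Proof.
apply/colP => i; rewrite 2!mxE; case: (unliftP ord0 i) => [i'|] ->.
  by rewrite !consvS !mxE /= mulr0 add0r.
by rewrite !consv0 mxE eqxx /= mulr1.
Qed.

(** For the outermost variable this is differentiation under the integral sign, the fundamental
    theorem of calculus and periodicity. Any other variable is reached by induction on the
    dimension. *)
Lemma torus_int_pder d (i : 'I_d) (g g' : 'cV[R]_d -> R) :
  ucb g -> ucb g' -> (forall x, g (evec i + x) = g x) ->
  (forall x, is_derive x (evec i) g (g' x)) -> torus_int g' = 0.
Proof.
elim: d i g g' => [[]//|d IH] i g g' ug ug' pg dg.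
rewrite torus_intS; case: (unliftP ord0 i) => [j|] ij; subst i.
  have H y : torus_int (fun x => g' (consv y x)) = 0.
    apply: (IH j (fun x => g (consv y x))); [exact: ucb_consv|exact: ucb_consv|..].
      by move=> x; rewrite -[evec j]scale1r -consv_lift scale1r.
    move=> x; apply/is_derive_line0.
    under eq_fun do rewrite -consv_lift.
    by apply: (is_derive_line0 g _ _ _).1; exact: dg.
  under eq_Rintegral do rewrite H.
  by rewrite Rintegral_cst //= mul0r.
have dline x (t : R) : is_derive t (1 : R) (fun t => g (consv t x)) (g' (consv t x)).
  have := dg (consv t x).
  rewrite -[X in consv X]addr0 -consv_ord0 => /is_derive_line.
  by under eq_fun do rewrite consv_ord0 addr0.
(* By the mean value theorem the difference quotient of the integrand is a value of [g'] at distance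
   at most [|h|], so uniform continuity of [g'] makes the convergence uniform in the remaining
   variables. *)
have dPhi y : is_derive y (1 : R) (fun y => torus_int (fun x => g (consv y x)))
   (torus_int (fun x => g' (consv y x))).
  set l := torus_int _.
  suff H : h^-1 *: (((fun y => torus_int (fun x => g (consv y x))) \o shift y) (h *: (1 : R))
    - torus_int (fun x => g (consv y x))) @[h --> (0 : R)^'] --> l.
    by split; [apply/cvg_ex; exists l | exact: cvg_lim].
  apply/(@cvgrPdist_le _ R^o) => e e0.
  have [_ /(_ _ e0)[del d0 Hd]] := ug'.
  near=> h.
  have h0 : h != 0 by near: h; exact: nbhs_dnbhs_neq.
  have hd : `|h| <= del by near: h; exact: dnbhs0_le.
  rewrite /= /GRing.scale /= mulr1 -torus_intB; [|exact: ucb_consv..].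
  rewrite -torus_intZ; last by apply: ucbB; exact: ucb_consv.
  apply: torus_int_dist; [exact: ucb_consv|apply: ucbZ; apply: ucbB; exact: ucb_consv|].
  move=> x; have [c cy E] := MVT_any y h (dline x).
  rewrite [h + y]addrC E mulrC mulfK //; apply: Hd => i.
  case: (unliftP ord0 i) => [j|] ->.
    by rewrite !consvS subrr normr0 ltW.
  by rewrite !consv0 distrC; exact: (le_trans cy).
rewrite (FTC01 (torus_int_continuous ug') dPhi).
apply/eqP; rewrite subr_eq0; apply/eqP; congr torus_int; apply/funext => x.
by rewrite -[RHS]pg -[evec ord0]scale1r consv_ord0 addr0.
Unshelve. all: by end_near. Qed.

End TorusCalculus.

(** * Abstract Bessel and Parseval *)

Section ComplexSquares.
Context {R : realType}.
Local Notation C := R[i].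
Local Open Scope complex_scope.

(** The squared modulus, kept in [R] and free of square roots, so that complex estimates become real
    ones. *)
Definition sqn (z : C) : R := complex.Re z ^+ 2 + complex.Im z ^+ 2.

Definition cj (z : C) : C := Complex (complex.Re z) (- complex.Im z).

Lemma sqnE z : (sqn z)%:C = z * cj z.
Proof.
case: z => a b; rewrite /sqn /=; apply/eqP; rewrite eq_complex /=.
by apply/andP; split; apply/eqP; ring.
Qed.

Lemma Re_mulJ (z : C) : complex.Re (z * cj z) = sqn z.
Proof. by rewrite -sqnE. Qed.

Lemma sqn_ge0 z : 0 <= sqn z.
Proof. by rewrite addr_ge0 // sqr_ge0. Qed.

Lemma sqn0 : sqn 0 = 0.
Proof. by rewrite /sqn /= expr0n addr0. Qed.

Lemma sqnM z w : sqn (z * w) = sqn z * sqn w.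
Proof. by case: z w => [a b] [c e]; rewrite /sqn /=; ring. Qed.

Lemma sqnN z : sqn (- z) = sqn z.
Proof. by case: z => a b; rewrite /sqn /= !sqrrN. Qed.

Lemma sqnJ z : sqn (cj z) = sqn z.
Proof. by case: z => a b; rewrite /sqn /= !sqrrN. Qed.

Lemma sqnC (a : R) : sqn a%:C = a ^+ 2.
Proof. by rewrite /sqn /= expr0n addr0. Qed.

Lemma Re_add (z w : C) : complex.Re (z + w) = complex.Re z + complex.Re w.
Proof. by case: z w => [a b] [c e]. Qed.

Lemma Im_add (z w : C) : complex.Im (z + w) = complex.Im z + complex.Im w.
Proof. by case: z w => [a b] [c e]. Qed.

Lemma Re_opp (z : C) : complex.Re (- z) = - complex.Re z.
Proof. by case: z. Qed.

Lemma Im_opp (z : C) : complex.Im (- z) = - complex.Im z.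
Proof. by case: z. Qed.

Lemma Re_mul (z w : C) : complex.Re (z * w) =
  complex.Re z * complex.Re w - complex.Im z * complex.Im w.
Proof. by case: z w => [a b] [c e]. Qed.

Lemma Im_mul (z w : C) : complex.Im (z * w) =
  complex.Re z * complex.Im w + complex.Im z * complex.Re w.
Proof. by case: z w => [a b] [c e]. Qed.

Lemma Re_sum (I : Type) (r : seq I) (P : pred I) (F : I -> C) :
  complex.Re (\sum_(i <- r | P i) F i) = \sum_(i <- r | P i) complex.Re (F i).
Proof. exact: (big_morph _ Re_add erefl). Qed.

Lemma Im_sum (I : Type) (r : seq I) (P : pred I) (F : I -> C) :
  complex.Im (\sum_(i <- r | P i) F i) = \sum_(i <- r | P i) complex.Im (F i).
Proof. exact: (big_morph _ Im_add erefl). Qed.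

Lemma sqnD2 z w : sqn (z + w) <= 2 * sqn z + 2 * sqn w.
Proof.
rewrite /sqn Re_add Im_add -subr_ge0.
have -> : 2 * (complex.Re z ^+ 2 + complex.Im z ^+ 2)
  + 2 * (complex.Re w ^+ 2 + complex.Im w ^+ 2)
  - ((complex.Re z + complex.Re w) ^+ 2 + (complex.Im z + complex.Im w) ^+ 2)
  = (complex.Re z - complex.Re w) ^+ 2 + (complex.Im z - complex.Im w) ^+ 2 by ring.
by rewrite addr_ge0 // sqr_ge0.
Qed.

Lemma sqnB2 z w : sqn (z - w) <= 2 * sqn z + 2 * sqn w.
Proof. by rewrite (le_trans (sqnD2 _ _)) // sqnN. Qed.

Lemma Re2_le_sqn z : complex.Re z ^+ 2 <= sqn z.
Proof. by rewrite lerDl sqr_ge0. Qed.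

(** Weighted Cauchy-Schwarz: the sum of [w i * (a i / w i - t) ^+ 2] is a nonnegative quadratic
    polynomial in [t], evaluated at its minimum [A / W]. *)
Lemma sqr_sum_le (I : Type) (r : seq I) (P : pred I) (w a : I -> R) :
  (forall i, 0 < w i) ->
  (\sum_(i <- r | P i) a i) ^+ 2 <=
  (\sum_(i <- r | P i) w i) * \sum_(i <- r | P i) a i ^+ 2 / w i.
Proof.
move=> w0; set A := \sum_(i <- r | P i) a i; set W := \sum_(i <- r | P i) w i.
set B := \sum_(i <- r | P i) a i ^+ 2 / w i.
have W0 : 0 <= W by apply: sumr_ge0 => i _; exact: ltW.
have H t : 0 <= B - 2 * t * A + t ^+ 2 * W.
  rewrite /A /B /W !mulr_sumr -sumrB -big_split /=; apply: sumr_ge0 => i _.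
  have -> : a i ^+ 2 / w i - 2 * t * a i + t ^+ 2 * w i = w i * (a i / w i - t) ^+ 2.
    by field; rewrite gt_eqF.
  by rewrite mulr_ge0 ?sqr_ge0 // ltW.
have [W00|Wn0] := eqVneq W 0; last first.
  have Wp : 0 < W by rewrite lt_def Wn0.
  have := H (A / W) => H'; rewrite -subr_ge0.
  have -> : W * B - A ^+ 2 = W * (B - 2 * (A / W) * A + (A / W) ^+ 2 * W) by field.
  by rewrite mulr_ge0.
(* With total weight zero the quadratic is affine in [t]; unless [A] is zero, it would take the
   negative value -B - 2 at this [t]. *)
have := H ((B + 1) / A); rewrite W00 mulr0 addr0 mul0r.
have [->|A0] := eqVneq A 0; first by rewrite expr0n.
have -> : B - 2 * ((B + 1) / A) * A = - B - 2 by field.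
have B0 : 0 <= B by apply: sumr_ge0 => i _; rewrite divr_ge0 ?sqr_ge0 // ltW.
lra.
Qed.

Lemma sqn_sum_le (I : Type) (r : seq I) (P : pred I) (w : I -> R) (z : I -> C) :
  (forall i, 0 < w i) ->
  sqn (\sum_(i <- r | P i) z i) <=
  (\sum_(i <- r | P i) w i) * \sum_(i <- r | P i) sqn (z i) / w i.
Proof.
move=> w0; rewrite /sqn Re_sum Im_sum.
have -> : \sum_(i <- r | P i) (complex.Re (z i) ^+ 2 + complex.Im (z i) ^+ 2) / w i
  = \sum_(i <- r | P i) complex.Re (z i) ^+ 2 / w i
    + \sum_(i <- r | P i) complex.Im (z i) ^+ 2 / w i.
  by rewrite -big_split; apply: eq_bigr => i _; rewrite mulrDl.
by rewrite mulrDr lerD // sqr_sum_le.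
Qed.

Lemma sqn_sum_size (I : Type) (r : seq I) (z : I -> C) :
  sqn (\sum_(i <- r) z i) <= (size r)%:R * \sum_(i <- r) sqn (z i).
Proof.
have := @sqn_sum_le _ r xpredT (fun=> 1) z (fun=> ltr01).
rewrite big_const_seq count_predT iter_addr addr0.
by under [X in _ * X]eq_bigr do rewrite divr1.
Qed.

Lemma cjD (z w : C) : cj (z + w) = cj z + cj w.
Proof. by rewrite /cj Re_add Im_add opprD. Qed.

Lemma cjM (z w : C) : cj (z * w) = cj z * cj w.
Proof. by case: z w => [a b] [c e]; rewrite /cj /=; congr Complex; ring. Qed.

Lemma cjN (z : C) : cj (- z) = - cj z.
Proof. by case: z. Qed.

Lemma cjK : involutive cj.
Proof. by case=> a b; rewrite /cj /= opprK. Qed.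

Lemma cj0 : cj 0 = 0.
Proof. by rewrite /cj /= oppr0. Qed.

Lemma rcD (a b : R) : (a + b)%:C = a%:C + b%:C.
Proof. exact: rmorphD. Qed.

Lemma rcB (a b : R) : (a - b)%:C = a%:C - b%:C.
Proof. exact: rmorphB. Qed.

Lemma rcM (a b : R) : (a * b)%:C = a%:C * b%:C.
Proof. exact: rmorphM. Qed.

Lemma rcX (a : R) n : (a ^+ n)%:C = a%:C ^+ n.
Proof. exact: rmorphXn. Qed.

Lemma rc_nat n : (n%:R : R)%:C = n%:R.
Proof. exact: rmorph_nat. Qed.

Lemma rc_sum (I : Type) (r : seq I) (P : pred I) (F : I -> R) :
  (\sum_(i <- r | P i) F i)%:C = \sum_(i <- r | P i) (F i)%:C.
Proof. exact: rmorph_sum. Qed.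

Lemma cexpD (a b : R) : cexp (a + b) = cexp a * cexp b.
Proof.
apply/eqP; rewrite eq_complex /= mulrDr cosD sinD eqxx /=.
by rewrite addrC.
Qed.

Lemma cexpN (a : R) : cexp (- a) = cj (cexp a).
Proof. by rewrite /cexp mulrN cosN sinN. Qed.

Lemma sqn_cexp (a : R) : sqn (cexp a) = 1.
Proof. by rewrite /sqn /= cos2Dsin2. Qed.

Lemma cexp0 : cexp (0 : R) = 1.
Proof. by rewrite /cexp mulr0 cos0 sin0. Qed.

Lemma cexpDZ (a : R) (m : int) : cexp (a + m%:~R) = cexp a.
Proof. by rewrite /cexp mulrDr cosD2piZ sinD2piZ. Qed.

Lemma cexpMn (a : R) n : cexp (a *+ n) = cexp a ^+ n.
Proof. by elim: n => [|n IH]; rewrite ?mulr0n ?cexp0 // mulrS cexpD IH exprS. Qed.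

End ComplexSquares.

Section Bessel.
Context {R : realType} (X : Type).
Local Notation C := R[i].
Local Open Scope complex_scope.
(** Used twice: for the torus integral, where [P] is [cucb], and for the mean over the grid, where
    [P] holds of every function. *)
Variables (P : (X -> C) -> Prop) (I : (X -> C) -> C).
Hypothesis P_lin : forall a f g, P f -> P g -> P (fun x => f x + a * g x).
Hypothesis P_ip : forall f g, P f -> P g -> P (fun x => f x * cj (g x) ).
Hypothesis I_lin : forall a f g, P f -> P g ->
  I (fun x => f x + a * g x) = I f + a * I g.
Hypothesis I_conj : forall f g, P f -> P g ->
  I (fun x => g x * cj (f x) ) = cj (I (fun x => f x * cj (g x))).
Hypothesis I_pos : forall f, P f -> 0 <= complex.Re (I (fun x => f x * cj (f x) )).

Definition innerp (f g : X -> C) := I (fun x => f x * cj (g x) ).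

Lemma innerp_linl a f g h : P f -> P g -> P h ->
  innerp (fun x => f x + a * g x) h = innerp f h + a * innerp g h.
Proof.
move=> Pf Pg Ph; rewrite /innerp -I_lin; [|exact: P_ip..].
by congr I; apply/funext => x; rewrite mulrDl mulrA.
Qed.

Lemma innerp_sub a f e : P f -> P e -> innerp e e = 1 ->
  innerp (fun x => f x + a * e x) (fun x => f x + a * e x) =
  innerp f f + cj a * innerp f e + a * cj (innerp f e) + (sqn a)%:C.
Proof.
move=> Pf Pe ee; have Pfe : P (fun x => f x + a * e x) by exact: P_lin.
rewrite innerp_linl // /innerp [I (fun x => f x * _)]I_conj //.
rewrite [X in _ + _ * X]I_conj // -!/(innerp _ _) !innerp_linl // ee.
rewrite mulr1 !cjD !cjM [innerp e f]I_conj // cjK -/(innerp _ _).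
by rewrite /innerp -I_conj // -/(innerp _ _) sqnE; ring.
Qed.

(** Removing from [f] its component along the first vector leaves the other coefficients unchanged
    and lowers the energy by exactly the square of that coefficient; positivity ends the
    induction. *)
Lemma bessel (K : eqType) (r : seq K) (e : K -> X -> C) f :
  uniq r -> (forall k, P (e k)) ->
  {in r &, forall k l, innerp (e k) (e l) = (k == l)%:R} -> P f ->
  \sum_(k <- r) sqn (innerp f (e k)) <= complex.Re (innerp f f).
Proof.
move=> + Pe; elim: r f => [|k r IH] f /=; first by rewrite big_nil => *; exact: I_pos.
move=> /andP[kr ur] ek Pf; rewrite big_cons.
have kk : k \in k :: r by rewrite mem_head.
have ee : innerp (e k) (e k) = 1 by rewrite ek // eqxx.
pose a := - innerp f (e k); pose g := fun x => f x + a * e k x.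
have Pg : P g by exact: P_lin.
have gl l : l \in r -> innerp g (e l) = innerp f (e l).
  move=> lr; rewrite innerp_linl // ek ?inE ?lr ?orbT //.
  by case: eqP => [E|_]; [rewrite E lr in kr | rewrite mulr0 addr0].
have {IH} := IH g ur (sub_in2 (@mem_behead _ (k :: r)) ek) Pg.
have -> : \sum_(l <- r) sqn (innerp g (e l)) = \sum_(l <- r) sqn (innerp f (e l)).
  by apply: eq_big_seq => l lr; rewrite gl.
rewrite innerp_sub // !Re_add /a cjN !mulNr ![cj _ * _]mulrC !Re_opp.
rewrite !Re_mulJ sqnN /=; lra.
Qed.

Lemma parseval (K : eqType) (r : seq K) (e : K -> X -> C) (c : K -> C) :
  P (fun=> 0) -> uniq r -> (forall k, P (e k)) ->
  {in r &, forall k l, innerp (e k) (e l) = (k == l)%:R} ->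
  let f x := \sum_(k <- r) c k * e k x in
  complex.Re (innerp f f) = \sum_(k <- r) sqn (c k).
Proof.
(* The induction must also carry admissibility of the partial sum and its orthogonality to whatever
   is orthogonal to all the vectors used; the latter removes the cross terms. *)
move=> P0 + Pe; suff H : uniq r ->
  {in r &, forall k l, innerp (e k) (e l) = (k == l)%:R} ->
  let f x := \sum_(k <- r) c k * e k x in
  [/\ P f, forall g, P g -> {in r, forall k, innerp (e k) g = 0} -> innerp f g = 0
    & complex.Re (innerp f f) = \sum_(k <- r) sqn (c k)].
  by move=> ur er; have [_ _] := H ur er.
elim: r => [|k r IH] /=.
  move=> _ _; have -> : (fun x => \sum_(k <- [::]) c k * e k x) = fun=> 0.
    by apply/funext => x; rewrite big_nil.
  have i0 g : P g -> innerp (fun=> 0) g = 0.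
    move=> Pg; rewrite -[RHS](subrr (innerp (fun=> 0) g)) -mulN1r -innerp_linl //.
    by congr innerp; apply/funext => x; rewrite mulr0 addr0.
  by split => // [g Pg _|]; rewrite ?i0 // big_nil.
move=> /andP[kr ur] ek.
have ee : innerp (e k) (e k) = 1 by rewrite ek ?mem_head // eqxx.
have [Pf fo fn] := IH ur (sub_in2 (@mem_behead _ (k :: r)) ek).
have -> : (fun x => \sum_(l <- k :: r) c l * e l x) =
   (fun x => \sum_(l <- r) c l * e l x + c k * e k x).
  by apply/funext => x; rewrite big_cons addrC.
split; first exact: P_lin.
- move=> g Pg eg; rewrite innerp_linl // eg ?mem_head // mulr0 addr0 fo //.
  by move=> l lr; rewrite eg // inE lr orbT.
- rewrite innerp_sub // [innerp _ (e k)]fo // => [|l lr].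
    by rewrite cj0 !mulr0 !addr0 Re_add fn big_cons addrC.
  rewrite ek ?inE ?lr ?orbT ?eqxx //.
  by case: eqP => // E; rewrite -E lr in kr.
Qed.

End Bessel.

(** * Fourier coefficients on the torus *)

Section TorusFourier.
Context {R : realType}.
Local Notation C := R[i].
Local Open Scope complex_scope.

Definition cucb d (f : 'cV[R]_d -> C) : Prop :=
  ucb (fun x => complex.Re (f x)) /\ ucb (fun x => complex.Im (f x)).

Lemma cucbD d (f g : 'cV[R]_d -> C) : cucb f -> cucb g -> cucb (fun x => f x + g x).
Proof.
move=> [f1 f2] [g1 g2]; split.
  by under eq_fun do rewrite Re_add; exact: ucbD.
by under eq_fun do rewrite Im_add; exact: ucbD.
Qed.

Lemma cucbM d (f g : 'cV[R]_d -> C) : cucb f -> cucb g -> cucb (fun x => f x * g x).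
Proof.
move=> [f1 f2] [g1 g2]; split.
  by under eq_fun do rewrite Re_mul; apply: ucbB; exact: ucbM.
by under eq_fun do rewrite Im_mul; apply: ucbD; exact: ucbM.
Qed.

Lemma cucb_cst d (c : C) : cucb (fun _ : 'cV[R]_d => c).
Proof. by split; exact: ucb_cst. Qed.

Lemma cucbN d (f : 'cV[R]_d -> C) : cucb f -> cucb (fun x => - f x).
Proof. by move=> H; under eq_fun do rewrite -mulN1r; apply: cucbM => //; exact: cucb_cst. Qed.

Lemma cucbB d (f g : 'cV[R]_d -> C) : cucb f -> cucb g -> cucb (fun x => f x - g x).
Proof. by move=> uf ug; apply: cucbD => //; exact: cucbN. Qed.

Lemma cucbJ d (f : 'cV[R]_d -> C) : cucb f -> cucb (fun x => cj (f x)).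
Proof. by move=> [f1 f2]; split => //=; exact: ucbN. Qed.

Lemma cucb_real d (f : 'cV[R]_d -> R) : ucb f -> cucb (fun x => (f x)%:C).
Proof. by move=> uf; split => //=; exact: ucb_cst. Qed.

Lemma cucb_sum d (I : Type) (r : seq I) (f : I -> 'cV[R]_d -> C) :
  (forall i, cucb (f i)) -> cucb (fun x => \sum_(i <- r) f i x).
Proof.
move=> uf; split.
  by under eq_fun do rewrite Re_sum; apply: ucb_sum => i; case: (uf i).
by under eq_fun do rewrite Im_sum; apply: ucb_sum => i; case: (uf i).
Qed.

Lemma ucb_sqn d (f : 'cV[R]_d -> C) : cucb f -> ucb (fun x => sqn (f x)).
Proof. by move=> [f1 f2]; apply: ucbD; exact: ucbX2. Qed.

Lemma cos_lip (a b : R) : `|cos a - cos b| <= `|a - b|.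
Proof.
have H (x : R) : is_derive x (1 : R) cos (- sin x) by exact: is_derive_cos.
have [c _] := MVT_any b (a - b) H.
rewrite addrCA subrr addr0 => ->.
by rewrite normrM ler_piMl // normrN sin_max.
Qed.

Lemma pairingD d (k l : 'cV[int]_d) (x : 'cV[R]_d) :
  pairing (k + l) x = pairing k x + pairing l x.
Proof.
rewrite /pairing -big_split; apply: eq_bigr => i _ /=.
by rewrite mxE rmorphD mulrDl.
Qed.

Lemma pairingN d (k : 'cV[int]_d) (x : 'cV[R]_d) : pairing (- k) x = - pairing k x.
Proof.
rewrite /pairing -sumrN; apply: eq_bigr => i _ /=.
by rewrite mxE rmorphN mulNr.
Qed.

Lemma pairing0 d (x : 'cV[R]_d) : pairing 0 x = 0.
Proof. by rewrite /pairing big1 // => i _; rewrite mxE mul0r. Qed.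

Lemma ucb_cos d (k : 'cV[int]_d) (th : R) :
  ucb (fun x : 'cV[R]_d => cos (2 * pi * (pairing k x + th))).
Proof.
split; first by exists 1 => x; exact: cos_max.
move=> e e0; set K := 2 * pi * (\sum_i `|(k i 0)%:~R : R|).
have pi0 : 0 <= 2 * pi :> R by rewrite mulr_ge0 // pi_ge0.
have K0 : 0 <= K by rewrite mulr_ge0 // sumr_ge0.
have K1 : 0 < K + 1 by rewrite ltr_wpDl.
exists (e / (K + 1)); first by rewrite divr_gt0.
move=> x y xy; apply: (le_trans (cos_lip _ _)).
rewrite -mulrBr opprD addrACA subrr addr0 normrM (ger0_norm pi0).
apply: (@le_trans _ _ (K * (e / (K + 1)))); last first.
  by rewrite mulrCA -[leRHS]mulr1 ler_pM2l // ler_pdivrMr // mul1r lerDl.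
rewrite /K -[leRHS]mulrA ler_wpM2l // mulr_suml /pairing -sumrB.
apply: (le_trans (ler_norm_sum _ _ _)); apply: ler_sum => i _.
by rewrite -mulrBr normrM ler_wpM2l.
Qed.

Definition ek d (k : 'cV[int]_d) (x : 'cV[R]_d) : C := cexp (pairing k x).

Lemma cucb_ek d (k : 'cV[int]_d) : cucb (ek k).
Proof.
split.
  have := ucb_cos k 0; by under eq_fun do rewrite addr0.
have := ucb_cos k (- 4^-1).
suff -> : (fun x => cos (2 * pi * (pairing k x + - 4^-1))) =
  (fun x => complex.Im (ek k x)) by [].
apply/funext => x /=; rewrite -[RHS]cosBpihalf; congr cos.
by field.
Qed.

Lemma ekD d (k l : 'cV[int]_d) x : ek (k + l) x = ek k x * ek l x.
Proof. by rewrite /ek pairingD cexpD. Qed.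

Lemma ekN d (k : 'cV[int]_d) x : ek (- k) x = cj (ek k x).
Proof. by rewrite /ek pairingN cexpN. Qed.

Lemma ek0 d (x : 'cV[R]_d) : ek 0 x = 1.
Proof. by rewrite /ek pairing0 cexp0. Qed.

Lemma sqn_ek d (k : 'cV[int]_d) (x : 'cV[R]_d) : sqn (ek k x) = 1.
Proof. exact: sqn_cexp. Qed.

Lemma torus_cintD d (f g : 'cV[R]_d -> C) : cucb f -> cucb g ->
  torus_cint (fun x => f x + g x) = torus_cint f + torus_cint g.
Proof.
move=> [f1 f2] [g1 g2]; rewrite /torus_cint; apply/eqP; rewrite eq_complex /=.
by rewrite -!torus_intD //; apply/andP; split; apply/eqP; congr torus_int;
  apply/funext => x; rewrite ?Re_add ?Im_add.
Qed.

Lemma torus_cintZ d (a : C) (f : 'cV[R]_d -> C) : cucb f ->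
  torus_cint (fun x => a * f x) = a * torus_cint f.
Proof.
move=> [f1 f2]; case: a => a b; rewrite /torus_cint; apply/eqP; rewrite eq_complex /=.
rewrite -!torus_intZ // -torus_intB; [|exact: ucbZ..].
rewrite -torus_intD; [|exact: ucbZ..].
by apply/andP; split; apply/eqP; congr torus_int; apply/funext => x;
  rewrite ?Re_mul ?Im_mul.
Qed.

Lemma torus_cintJ d (f : 'cV[R]_d -> C) : cucb f ->
  torus_cint (fun x => cj (f x)) = cj (torus_cint f).
Proof. by move=> [f1 f2]; rewrite /torus_cint /cj /= torus_intN. Qed.

Lemma torus_cint_sum d (I : Type) (r : seq I) (f : I -> 'cV[R]_d -> C) :
  (forall i, cucb (f i)) ->
  torus_cint (fun x => \sum_(i <- r) f i x) = \sum_(i <- r) torus_cint (f i).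
Proof.
move=> uf; elim: r => [|i r IH].
  under eq_fun do rewrite big_nil.
  by rewrite big_nil /torus_cint /= torus_int_cst.
under eq_fun do rewrite big_cons.
by rewrite torus_cintD ?IH ?big_cons //; exact: cucb_sum.
Qed.

Lemma torus_cint_ek d (k : 'cV[int]_d) : torus_cint (ek k) = (k == 0)%:R.
Proof.
rewrite /torus_cint /=.
have := torus_int_cos k (0 : R); under eq_fun do rewrite addr0.
move=> ->; have := torus_int_sin k (0 : R); under eq_fun do rewrite addr0.
by move=> ->; rewrite mulr0 cos0 sin0; case: eqP.
Qed.

Definition tip d := @innerp R 'cV[R]_d (@torus_cint R d).

Let lin_ok d (a : C) (f g : 'cV[R]_d -> C) :
  cucb f -> cucb g -> cucb (fun x => f x + a * g x).
Proof. by move=> uf ug; apply: cucbD => //; apply: cucbM => //; exact: cucb_cst. Qed.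

Let ip_ok d (f g : 'cV[R]_d -> C) :
  cucb f -> cucb g -> cucb (fun x => f x * cj (g x)).
Proof. by move=> uf ug; apply: cucbM => //; exact: cucbJ. Qed.

Let lin_int d (a : C) (f g : 'cV[R]_d -> C) : cucb f -> cucb g ->
  torus_cint (fun x => f x + a * g x) = torus_cint f + a * torus_cint g.
Proof.
move=> uf ug; rewrite torus_cintD ?torus_cintZ //.
by apply: cucbM => //; exact: cucb_cst.
Qed.

Let ip_conj d (f g : 'cV[R]_d -> C) : cucb f -> cucb g ->
  torus_cint (fun x => g x * cj (f x)) = cj (torus_cint (fun x => f x * cj (g x))).
Proof.
move=> uf ug; rewrite -torus_cintJ; last exact: ip_ok.
by congr torus_cint; apply/funext => x; rewrite cjM cjK mulrC.
Qed.

Lemma Re_tip d (f : 'cV[R]_d -> C) :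
  complex.Re (tip f f) = torus_int (fun x => sqn (f x)).
Proof. by rewrite /tip /innerp /=; congr torus_int; apply/funext => x; exact: Re_mulJ. Qed.

Let ip_pos d (f : 'cV[R]_d -> C) : cucb f ->
  0 <= complex.Re (torus_cint (fun x => f x * cj (f x))).
Proof.
move=> uf; have := Re_tip f; rewrite /tip /innerp => ->.
by apply: torus_int_ge0 => [|x]; [exact: ucb_sqn|exact: sqn_ge0].
Qed.

Lemma tip_ek d (k l : 'cV[int]_d) : tip (ek k) (ek l) = (k == l)%:R.
Proof.
rewrite /tip /innerp; under eq_fun do rewrite -ekN -ekD.
by rewrite torus_cint_ek subr_eq0.
Qed.

Definition fcoef d (f : 'cV[R]_d -> C) (k : 'cV[int]_d) : C :=
  torus_cint (fun x => f x * cexp (- pairing k x)).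

Lemma fcoefE d (f : 'cV[R]_d -> C) k : fcoef f k = tip f (ek k).
Proof. by rewrite /fcoef /tip /innerp; under eq_fun do rewrite cexpN. Qed.

Lemma fcoef_lin d a (f g : 'cV[R]_d -> C) k : cucb f -> cucb g ->
  fcoef (fun x => f x + a * g x) k = fcoef f k + a * fcoef g k.
Proof.
move=> uf ug; rewrite !fcoefE /tip (innerp_linl (@ip_ok d) (@lin_int d)) //.
exact: cucb_ek.
Qed.

Lemma fcoefB d (f g : 'cV[R]_d -> C) k : cucb f -> cucb g ->
  fcoef (fun x => f x - g x) k = fcoef f k - fcoef g k.
Proof.
move=> uf ug; rewrite -[RHS]/(_ + _) -mulN1r -fcoef_lin //.
by congr fcoef; apply/funext => x; rewrite mulN1r.
Qed.

Lemma torus_bessel d (f : 'cV[R]_d -> C) (r : seq 'cV[int]_d) : uniq r -> cucb f ->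
  \sum_(k <- r) sqn (fcoef f k) <= torus_int (fun x => sqn (f x)).
Proof.
move=> ur uf; rewrite -Re_tip.
under eq_bigr do rewrite fcoefE.
apply: (bessel (@lin_ok d) (@ip_ok d) (@lin_int d) (@ip_conj d) (@ip_pos d)) => //.
- by move=> k; exact: cucb_ek.
- by move=> k l _ _; exact: tip_ek.
Qed.

(** Trigonometric polynomials, with arbitrary complex coefficients: no conjugate symmetry is
    imposed, so real parts are taken where real functions are required. *)
Definition tp d (r : seq 'cV[int]_d) (c : 'cV[int]_d -> C) (x : 'cV[R]_d) : C :=
  \sum_(k <- r) c k * ek k x.

Lemma cucb_tp d r c : cucb (@tp d r c).
Proof.
by apply: cucb_sum => k; apply: cucbM; [exact: cucb_cst|exact: cucb_ek].
Qed.

Lemma torus_parseval d (r : seq 'cV[int]_d) c : uniq r ->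
  torus_int (fun x => sqn (tp r c x)) = \sum_(k <- r) sqn (c k).
Proof.
move=> ur; rewrite -Re_tip.
apply: (parseval (@lin_ok d) (@ip_ok d) (@lin_int d) (@ip_conj d)) => //.
- exact: cucb_cst.
- by move=> k; exact: cucb_ek.
- by move=> k l _ _; exact: tip_ek.
Qed.

Lemma fcoef_tp d (r : seq 'cV[int]_d) c k : uniq r ->
  fcoef (tp r c) k = if k \in r then c k else 0.
Proof.
move=> ur; rewrite /fcoef.
have -> : (fun x => tp r c x * cexp (- pairing k x)) =
    (fun x => \sum_(l <- r) c l * ek (l - k) x).
  by apply/funext => x; rewrite mulr_suml; apply: eq_bigr => l _;
    rewrite ekD ekN cexpN mulrA.
rewrite torus_cint_sum => [|l]; last by apply: cucbM; [exact: cucb_cst|exact: cucb_ek].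
have E l : torus_cint (fun x => c l * ek (l - k) x) = c l * (l == k)%:R.
  by rewrite torus_cintZ ?torus_cint_ek ?subr_eq0 //; exact: cucb_ek.
under eq_bigr do rewrite E.
case: ifP => kr.
  rewrite (bigD1_seq k) //= eqxx mulr1 big1 ?addr0 // => l /negPf ->.
  by rewrite mulr0.
rewrite big1_seq // => l /= lr; case: eqP => [lk|_]; last by rewrite mulr0.
by rewrite -lk lr in kr.
Qed.

End TorusFourier.

(** * Frequencies, the grid and the discrete Fourier transform *)

Section Lattice.

(** The sup norm fits the boxes of modes and takes natural values, as dyadic shells require; the
    maximum with 1 keeps negative powers meaningful at the zero frequency. *)
Definition kap d (k : 'cV[int]_d) : nat := maxn 1 (\max_i `|k i 0%R|%N).

Lemma kap_gt0 d (k : 'cV[int]_d) : (0 < kap k)%N.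
Proof. by rewrite /kap leq_max. Qed.

Lemma leq_kap d (k : 'cV[int]_d) i : (`|k i 0%R| <= kap k)%N.
Proof. by rewrite /kap leq_max (bigD1 i) //= leq_max leqnn /= orbT. Qed.

Lemma kap_leP d (k : 'cV[int]_d) m : (0 < m)%N ->
  (forall i, (`|k i 0%R| <= m)%N) -> (kap k <= m)%N.
Proof. by move=> m0 H; rewrite /kap geq_max m0; apply/bigmax_leqP. Qed.

Lemma modes_bound d J (k : 'cV[int]_d) : k \in modes d J ->
  forall i, (- (J./2)%:Z <= k i 0) && (k i 0 < J%:Z - (J./2)%:Z).
Proof.
move=> /mapP[j _ ->] i; rewrite mxE.
by move: (nat_of_ord (j i)) (ltn_ord (j i)) => x; lia.
Qed.

Lemma mem_modes d J (k : 'cV[int]_d) :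
  (forall i, (- (J./2)%:Z <= k i 0) && (k i 0 < J%:Z - (J./2)%:Z)) ->
  k \in modes d J.
Proof.
move=> H; have Hi i : (`|(k i 0 + (J./2)%:Z)%R| < J)%N by have := H i; lia.
apply/mapP; exists [ffun i => Ordinal (Hi i)]; first by rewrite mem_enum.
apply/colP => i; rewrite mxE ffunE /=; have := H i; lia.
Qed.

Lemma modes_uniq d J : uniq (modes d J).
Proof.
rewrite map_inj_uniq ?enum_uniq // => j j' /colP E; apply/ffunP => i.
by have := E i; rewrite !mxE => /addIr [] /val_inj.
Qed.

Lemma size_modes d J : size (modes d J) = (J ^ d)%N.
Proof. by rewrite size_map -cardE card_ffun !card_ord. Qed.

Lemma modes_sub d J N : (J <= N)%N -> {subset modes d J <= modes d N}.
Proof.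
move=> JN k kJ; apply: mem_modes => i; have := modes_bound kJ i.
have h1 := odd_double_half J; have h2 := odd_double_half N.
have := half_leq JN; case: (odd J) (odd N) h1 h2 => -[]; lia.
Qed.

Lemma notin_modes_kap d N (k : 'cV[int]_d) : (0 < N)%N -> k \notin modes d N ->
  (N <= 2 * kap k)%N.
Proof.
move=> N0 kN; rewrite leqNgt; apply/negP => H; case/negP: kN; apply: mem_modes => i.
have := leq_kap k i; have := odd_double_half N; case: (odd N); lia.
Qed.

(** Each frequency is charged to its dyadic shell 2^j <= [kap k] < 2^(j+1). Since p is at least d +
    1, shell j weighs at most 4^d 2^(-j), and the geometric series contributes the factor 2. *)
Lemma lattice_sum (R : realType) d p : (d < p)%N ->
  exists2 Z : R, 0 < Z & forall r : seq 'cV[int]_d, uniq r ->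
    \sum_(k <- r) (kap k)%:R ^- p <= Z.
Proof.
move=> dp; exists (2 * 4 ^+ d) => [|r ur]; first by rewrite mulr_gt0 // exprn_gt0.
pose lev (k : 'cV[int]_d) := trunc_log 2 (kap k).
pose m := (\max_(k <- r) lev k).+1.
have levm k : k \in r -> (lev k < m)%N.
  by move=> kr; rewrite /m ltnS; apply: leq_bigmax_seq.
have lev1 k : (2 ^ lev k <= kap k)%N by rewrite trunc_logP // kap_gt0.
have lev2 k : (kap k < 2 ^ (lev k).+1)%N by rewrite trunc_log_ltn.
have H1 : \sum_(k <- r) (kap k)%:R ^- p <=
    \sum_(k <- r) \sum_(j < m | j == lev k :> nat) 2%:R ^- (j * p) :> R.
  rewrite big_seq [leRHS]big_seq; apply: ler_sum => k kr.
  rewrite (big_pred1 (Ordinal (levm k kr))) //= exprM -exprVn -[X in _ <= X]exprVn.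
  rewrite lerXn2r ?nnegrE ?invr_ge0 ?exprn_ge0 ?ler0n //.
  rewrite lef_pV2 ?posrE ?exprn_gt0 ?ltr0n ?kap_gt0 //.
  by rewrite -natrX ler_nat.
(* At most (2^(j+2))^d frequencies lie in the j-th dyadic shell. *)
apply: (le_trans H1); rewrite (exchange_big_dep xpredT) //=.
apply: (@le_trans _ _ (\sum_(j < m) 4 ^+ d * 2 ^- j)).
  apply: ler_sum => j _.
  rewrite big_const_seq iter_addr_0 -[leLHS]mulr_natl -size_filter.
  set s := [seq i <- r | _].
  have ss : (size s <= (2 ^ (j.+2)) ^ d)%N.
    rewrite -size_modes; apply: uniq_leq_size; first exact: filter_uniq.
    move=> k; rewrite mem_filter => /andP[/eqP jk _]; apply: mem_modes => i.
    have := leq_kap k i; have := lev2 k; rewrite -jk.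
    by rewrite (expnS 2 j.+1) mul2n doubleK; lia.
  apply: (@le_trans _ _ (((2 ^ (j.+2)) ^ d)%:R * 2%:R ^- (j * p))).
    by rewrite ler_wpM2r ?invr_ge0 ?exprn_ge0 // ler_nat.
  rewrite ler_pdivrMr ?exprn_gt0 // mulrAC ler_pdivlMr ?exprn_gt0 //.
  rewrite -(natrX _ 4) -!(natrX _ 2) -!natrM ler_nat -expnM -expnD.
  by rewrite -[4%N]/(2 ^ 2)%N -expnM -expnD leq_exp2l //; nia.
rewrite -mulr_sumr mulrC ler_wpM2r ?exprn_ge0 //.
have -> : \sum_(j < m) (2:R) ^- j = 2 - 2 * 2 ^- m.
  elim: (m) => [|n IH]; first by rewrite big_ord0 expr0 invr1 mulr1 subrr.
  rewrite big_ord_recr /= IH exprS; field.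
  by rewrite expf_neq0.
by rewrite lerBlDr lerDl mulr_ge0 // invr_ge0 exprn_ge0.
Qed.

End Lattice.

(** * Discrete orthogonality and aliasing on the grid *)

Section GridFourier.
Context {R : realType}.
Local Notation C := R[i].
Local Open Scope complex_scope.

Lemma cos2pi_lt1 (t : R) : 0 < t -> t < 1 -> cos (2 * pi * t) < 1.
Proof.
have pp := pi_gt0 R.
have H (u : R) : 0 < u -> u <= 2^-1 -> cos (2 * pi * u) < 1.
  move=> u0 u1; rewrite -[ltRHS]cos0 ltr_cos ?in_itv /= ?lexx ?pi_ge0 //.
    by rewrite !mulr_gt0.
  by apply/andP; split; [rewrite !mulr_ge0 // ltW | nra].
move=> t0 t1; have [|th] := lerP t 2^-1; first exact: H.
have := H (1 - t); rewrite mulrBr mulr1 => H'.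
have := cosD2piZ (- (2 * pi * t)) 1; rewrite mulr1 cosN addrC => <-.
by apply: H'; lra.
Qed.

(* The representative in [[N]]^d of the class of l modulo N. *)
Definition repN d (N : nat) (l : 'cV[int]_d) : 'cV[int]_d :=
  \col_i (modz (l i 0 + (N./2)%:Z) N%:Z - (N./2)%:Z).

Lemma repN_modes d N (l : 'cV[int]_d) : (0 < N)%N -> repN N l \in modes d N.
Proof.
move=> N0; apply: mem_modes => i; rewrite mxE.
have Nz : N%:Z != 0 by lia.
have := modz_ge0 (l i 0 + (N./2)%:Z) Nz.
have := ltz_pmod (l i 0 + (N./2)%:Z) (_ : 0 < N%:Z); lia.
Qed.

Lemma repN_id d N (l : 'cV[int]_d) : l \in modes d N -> repN N l = l.
Proof.
move=> lN; apply/colP => i; rewrite mxE modz_small ?addrK //.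
have := modes_bound lN i; lia.
Qed.

Lemma repN_eq d N (k l : 'cV[int]_d) :
  (repN N k == repN N l) = [forall i, (N%:Z %| k i 0%R - l i 0%R)%Z].
Proof.
apply/eqP/forallP => [/colP H i|H].
  have := H i; rewrite !mxE => /addIr /eqP.
  by rewrite eqz_mod_dvd opprD addrACA subrr addr0.
apply/colP => i; rewrite !mxE; congr (_ - _); apply/eqP.
by rewrite eqz_mod_dvd opprD addrACA subrr addr0.
Qed.

Definition gmean d N (w : grid d N -> C) : C :=
  (N%:R ^- d) * \sum_(n : {ffun 'I_d -> 'I_N}) w n.

Lemma geom_root (N : nat) (z : C) : z ^+ N = 1 -> z != 1 ->
  \sum_(j < N) z ^+ j = 0.
Proof.
move=> zN z1; apply/eqP; have := subrX1 z N; rewrite zN subrr => /esym/eqP.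
by rewrite mulf_eq0 subr_eq0 (negPf z1).
Qed.

Lemma cexp_frac (N : nat) (m : int) : (0 < N)%N ->
  (cexp (m%:~R / N%:R : R) == 1) = (N%:Z %| m)%Z.
Proof.
move=> N0; have Nr : N%:R != 0 :> R by rewrite pnatr_eq0 -lt0n.
have Np : 0 < N%:R :> R by rewrite ltr0n.
rewrite {1}(divz_eq m N%:Z) rmorphD rmorphM /= -[(Posz N)%:~R]/(N%:R) mulrDl mulfK //.
rewrite addrC cexpDZ.
have r0 : 0 <= (m %% N%:Z)%Z by apply: modz_ge0; lia.
have r1 : (m %% N%:Z)%Z < N%:Z by apply: ltz_pmod; lia.
have -> : (N%:Z %| m)%Z = ((m %% N%:Z)%Z == 0) by apply/dvdz_mod0P/eqP.
move: (m %% N%:Z)%Z r0 r1 => [a|a] // _ aN.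
case: (posnP a) => [->|ap]; first by rewrite mul0r cexp0 eqxx.
rewrite -[(Posz _)%:~R]/(_%:R).
have : cos (2 * pi * (a%:R / N%:R)) < 1 :> R.
  apply: cos2pi_lt1; first by rewrite divr_gt0 // ltr0n.
  by rewrite ltr_pdivrMr // mul1r ltr_nat; lia.
by move=> clt; rewrite eq_complex /= (lt_eqF clt) /=; lia.
Qed.

Lemma pairing_grid d N (k : 'cV[int]_d) (n : grid d N) :
  cexp (pairing k (gridpoint R n)) =
  \prod_i cexp ((k i 0)%:~R / N%:R) ^+ (n i).
Proof.
rewrite /pairing (big_morph _ (@cexpD R) (@cexp0 R)); apply: eq_bigr => i _.
rewrite -cexpMn; congr cexp.
by rewrite mxE -[RHS]mulr_natr mulrA mulrAC.
Qed.

(** The sum over the grid factors into one geometric sum per coordinate. If N does not divide some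
    [k i 0], that factor sums all powers of a nontrivial N-th root of unity and vanishes. *)
Lemma gmean_ek d N (k : 'cV[int]_d) : (0 < N)%N ->
  gmean (fun n : grid d N => ek k (gridpoint R n)) =
  [forall i, (N%:Z %| k i 0%R)%Z]%:R.
Proof.
move=> N0; rewrite /gmean /ek; under eq_bigr do rewrite pairing_grid.
rewrite -(bigA_distr_bigA (fun i (j : 'I_N) => cexp ((k i 0)%:~R / N%:R : R) ^+ j)) /=.
have Nr : N%:R != 0 :> C by rewrite pnatr_eq0 -lt0n.
case: forallP => H.
  rewrite (eq_bigr (fun=> N%:R)); last first.
    move=> i _; have := H i; rewrite -cexp_frac // => /eqP ->.
    by under eq_bigr do rewrite expr1n; rewrite sumr_const card_ord.
  by rewrite prodr_const card_ord mulVf // expf_neq0.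
have [i Hi] : exists i, ~ (N%:Z %| k i 0%R)%Z by exact/existsNP.
rewrite (bigD1 i) //= geom_root ?mul0r ?mulr0 //.
  by rewrite -cexpMn -[_ *+ N]mulr_natr divfK ?pnatr_eq0 -?lt0n // -[_%:~R]add0r cexpDZ cexp0.
by rewrite cexp_frac //; exact/negP.
Qed.

Definition dftc d N (w : grid d N -> C) (k : 'cV[int]_d) : C :=
  gmean (fun n => w n * cexp (- pairing k (gridpoint R n))).

Lemma dftE d N m (v : grid d N -> 'cV[R]_m) k i :
  dft v k i 0 = dftc (fun n => (v n i 0)%:C) k.
Proof.
rewrite /dft /dftc /gmean mxE summxE; congr (_ * _); apply: eq_bigr => n _.
by rewrite !mxE mulrC.
Qed.

Lemma gmeanD d N (f g : grid d N -> C) :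
  gmean (fun n => f n + g n) = gmean f + gmean g.
Proof. by rewrite /gmean big_split mulrDr. Qed.

Lemma gmeanZ d N a (f : grid d N -> C) :
  gmean (fun n => a * f n) = a * gmean f.
Proof. by rewrite /gmean -mulr_sumr mulrCA. Qed.

Lemma gmean_sum d N (I : Type) (r : seq I) (f : I -> grid d N -> C) :
  gmean (fun n => \sum_(i <- r) f i n) = \sum_(i <- r) gmean (f i).
Proof. by rewrite /gmean exchange_big mulr_sumr. Qed.

(** The exact aliasing formula: characters with congruent frequencies coincide on the grid, and all
    others are orthogonal there. *)
Lemma dftc_tp d N (r : seq 'cV[int]_d) c k : (0 < N)%N ->
  dftc (fun n : grid d N => tp r c (gridpoint R n)) k =
  \sum_(l <- r | repN N l == repN N k) c l.
Proof.
move=> N0; rewrite /dftc.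
have -> : (fun n : grid d N => tp r c (gridpoint R n) * cexp (- pairing k (gridpoint R n)))
  = (fun n => \sum_(l <- r) c l * ek (l - k) (gridpoint R n)).
  apply/funext => n; rewrite mulr_suml; apply: eq_bigr => l _.
  by rewrite ekD ekN cexpN mulrA.
rewrite gmean_sum [RHS]big_mkcond /=; apply: eq_bigr => l _.
rewrite gmeanZ gmean_ek // repN_eq.
under eq_forallb do rewrite !mxE.
by case: ifP; rewrite ?mulr1 ?mulr0.
Qed.

Lemma gmean_real d N (w : grid d N -> R) :
  gmean (fun n => (w n)%:C) = (N%:R ^- d * \sum_(n : {ffun 'I_d -> 'I_N}) w n)%:C.
Proof.
rewrite /gmean rmorphM rmorph_sum fmorphV rmorphXn /= rmorph_nat //.
Qed.

Lemma gmeanJ d N (f : grid d N -> C) : gmean (fun n => cj (f n)) = cj (gmean f).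
Proof.
rewrite /gmean cjM (big_morph _ (@cjD R) (@cj0 R)); congr (_ * _).
have -> : N%:R ^- d = ((N%:R ^- d : R))%:C :> C.
  by rewrite fmorphV rmorphXn /= rmorph_nat.
by rewrite /cj /= oppr0.
Qed.

Lemma dftc_bessel d N (w : grid d N -> C) : (0 < N)%N ->
  \sum_(k <- modes d N) sqn (dftc w k) <=
  N%:R ^- d * \sum_(n : {ffun 'I_d -> 'I_N}) sqn (w n).
Proof.
move=> N0.
have Np : 0 <= N%:R ^- d :> R by rewrite invr_ge0 exprn_ge0.
have E : complex.Re (innerp (@gmean d N) w w) =
    N%:R ^- d * \sum_(n : {ffun 'I_d -> 'I_N}) sqn (w n).
  by rewrite /innerp; under eq_fun do rewrite -sqnE; rewrite gmean_real.
rewrite -E.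
have D k : dftc w k = innerp (@gmean d N) w (fun n => ek k (gridpoint R n)).
  by rewrite /dftc /innerp; under eq_fun do rewrite cexpN.
under eq_bigr do rewrite D.
apply: (@bessel R (grid d N) (fun=> True)) => //.
- by move=> a f g _ _; rewrite gmeanD gmeanZ.
- move=> f g _ _; rewrite -gmeanJ; congr gmean.
  by apply/funext => n; rewrite cjM cjK mulrC.
- move=> f _; under eq_fun do rewrite -sqnE; rewrite gmean_real /=.
  by rewrite mulr_ge0 // sumr_ge0 // => n _; exact: sqn_ge0.
- exact: modes_uniq.
- move=> k l kN lN; rewrite /innerp; under eq_fun do rewrite -ekN -ekD.
  rewrite gmean_ek // -[k in RHS](repN_id kN) -[l in RHS](repN_id lN) repN_eq.
  by congr ((_ : bool)%:R); apply: eq_forallb => i; rewrite !mxE.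
Qed.

End GridFourier.

(** * Aliasing and interpolation *)

Section Aliasing.
Context {R : realType} {d : nat} (s : nat).
Local Notation C := R[i].
Local Open Scope complex_scope.

(** Stands in for the Sobolev weight 1 + |k|^(2s), which dominates it ([wgt_le_hsw]). *)
Definition wgt (k : 'cV[int]_d) : R := (kap k)%:R ^+ (2 * s).

Lemma wgt_gt0 k : 0 < wgt k.
Proof. by rewrite exprn_gt0 // ltr0n kap_gt0. Qed.

Lemma sum_wgt_filter (r : seq 'cV[int]_d) (P : pred 'cV[int]_d) (c : 'cV[int]_d -> C) :
  \sum_(k <- r | P k) wgt k * sqn (c k) <= \sum_(k <- r) wgt k * sqn (c k).
Proof.
rewrite big_mkcond; apply: ler_sum => k _; case: ifP => // _.
by rewrite mulr_ge0 ?sqn_ge0 // ltW // wgt_gt0.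
Qed.

Variable Z : R.
Hypothesis HZ : forall r : seq 'cV[int]_d, uniq r ->
  \sum_(k <- r) (kap k)%:R ^- (2 * s) <= Z.

Lemma lattice_ge0 : 0 <= Z.
Proof. by have := HZ (erefl : uniq [::]); rewrite big_nil. Qed.

(** The Sobolev embedding for finite sums: Cauchy-Schwarz with weights [(wgt k)^-1], whose total is
    bounded by the lattice sum. *)
Lemma sqn_sum_bound (r : seq 'cV[int]_d) (c : 'cV[int]_d -> C) : uniq r ->
  sqn (\sum_(k <- r) c k) <= Z * \sum_(k <- r) wgt k * sqn (c k).
Proof.
move=> ur.
have := @sqn_sum_le _ _ r xpredT (fun k => (wgt k)^-1) c
  (fun k => ltac:(by rewrite invr_gt0 wgt_gt0)).
under [X in _ * X]eq_bigr do rewrite invrK mulrC.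
move=> H; apply: (le_trans H); rewrite ler_wpM2r ?HZ //.
by apply: sumr_ge0 => k _; rewrite mulr_ge0 ?sqn_ge0 // ltW // wgt_gt0.
Qed.

(** For [k] among the N-modes these are the proper aliases of [k]: exclusion of the box removes
    exactly [k] from its residue class. *)
Let far N k (l : 'cV[int]_d) := (repN N l == k) && (l \notin modes d N).

(** An alias of [k] is [k + N z] with [z] determined by it, and [N * kap z <= 2 * kap l]. The sum
    over aliases is thus at most (2/N)^(2s) times a lattice sum over distinct [z]. *)
Lemma lattice_alias N (r : seq 'cV[int]_d) k : (0 < N)%N -> uniq r ->
  k \in modes d N ->
  \sum_(l <- r | far N k l) (wgt l)^-1 <= 2 ^+ (2 * s) * N%:R ^- (2 * s) * Z.
Proof.
move=> N0 ur kN.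
pose z (l : 'cV[int]_d) : 'cV[int]_d := \col_i (divz (l i 0 - k i 0) N%:Z).
have zE l : repN N l = k -> l = k + N%:Z *: z l.
  move=> lk; have /eqP : repN N l = repN N k by rewrite lk repN_id.
  rewrite repN_eq => /forallP H; apply/colP => i; rewrite !mxE mulrC divzK //.
  by rewrite addrCA subrr addr0.
rewrite -big_filter.
have H l : far N k l -> (N * kap (z l) <= 2 * kap l)%N.
  move=> /andP[/eqP lk lN]; have E := zE l lk.
  have h0 := notin_modes_kap N0 lN.
  (* [H'] handles the coordinates of [z l]; the lower bound 1 built into [kap] is covered by
     [h0]. *)
  suff H' : forall i, (N * `|z l i 0%R| <= 2 * kap l)%N.
    rewrite mulnC -leq_divRL //; apply: kap_leP.
      by rewrite leq_divRL // mul1n.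
    by move=> i; rewrite leq_divRL // mulnC.
  move=> i; have := leq_kap l i; have := modes_bound kN i.
  have := congr1 (fun v : 'cV[int]_d => v i 0) E; rewrite mxE [X in _ + X]mxE.
  move: (z l i 0) => a; have := odd_double_half N.
  case: (eqVneq a 0) => [->|a0]; first by rewrite absz0 muln0.
  (* Here |k_i| <= N/2 <= |N a|/2, so N a = l_i - k_i forces |N a| <= 2 |l_i|. *)
  have NN : (N <= N * `|a|)%N by rewrite leq_pmulr // absz_gt0.
  have -> : (N * `|a|)%N = `|(N%:Z * a)%R|%N by rewrite abszM.
  have {NN} : (N <= `|(N%:Z * a)%R|)%N by rewrite abszM.
  move: (N%:Z * a) => b.
  move: (l i 0) (k i 0) => li ki.
  by case: (odd N); lia.
set t := [seq l <- r | far N k l].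
have uz : uniq [seq z l | l <- t].
  rewrite map_inj_in_uniq ?filter_uniq // => l l'.
  rewrite !mem_filter => /andP[/andP[/eqP l1 _] _] /andP[/andP[/eqP l1' _] _] zz.
  by rewrite (zE l l1) (zE l' l1') zz.
apply: (@le_trans _ _ (\sum_(l <- t) 2 ^+ (2 * s) * N%:R ^- (2 * s) * (kap (z l))%:R ^- (2 * s))).
  rewrite big_seq [leRHS]big_seq; apply: ler_sum => l.
  rewrite mem_filter => /andP[/H Hl _].
  rewrite -mulrA -invfM ler_pdivlMr; last first.
    by rewrite mulr_gt0 // exprn_gt0 // ltr0n ?kap_gt0.
  rewrite mulrC ler_pdivrMr ?wgt_gt0 // /wgt -!exprMn -!natrM.
  by rewrite lerXn2r ?nnegrE ?ler0n ?ler_nat.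
rewrite -mulr_sumr ler_wpM2l //.
by rewrite -(big_map z xpredT (fun k => (kap k)%:R ^- (2 * s))) HZ.
Qed.

Definition alias_cst : R := 2 ^+ (2 * s) * Z.

Lemma alias_cst_ge0 : 0 <= alias_cst.
Proof. by rewrite mulr_ge0 ?exprn_ge0 // lattice_ge0. Qed.

Lemma alias_sum N (r : seq 'cV[int]_d) c k : (0 < N)%N -> uniq r ->
  k \in modes d N ->
  sqn (\sum_(l <- r | far N k l) c l) <=
  alias_cst * N%:R ^- (2 * s) * \sum_(l <- r | far N k l) wgt l * sqn (c l).
Proof.
move=> N0 ur kN.
have := @sqn_sum_le _ _ r (far N k) (fun k => (wgt k)^-1) c
  (fun k => ltac:(by rewrite invr_gt0 wgt_gt0)).
under [X in _ * X]eq_bigr do rewrite invrK mulrC.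
move=> H; apply: (le_trans H); rewrite ler_wpM2r //.
  by apply: sumr_ge0 => l _; rewrite mulr_ge0 ?sqn_ge0 // ltW // wgt_gt0.
by apply: (le_trans (lattice_alias N0 ur kN)); rewrite /alias_cst mulrAC.
Qed.

Lemma dftc_tp_split N (r : seq 'cV[int]_d) c k : (0 < N)%N -> uniq r ->
  k \in modes d N ->
  dftc (fun n : grid d N => tp r c (gridpoint R n)) k =
  (if k \in r then c k else 0) + \sum_(l <- r | far N k l) c l.
Proof.
move=> N0 ur kN; rewrite dftc_tp // (bigID (fun l => l \in modes d N)) /=.
congr (_ + _); last by rewrite repN_id.
rewrite (repN_id kN) (eq_bigl (fun l => l == k)); last first.
  move=> l; apply/andP/eqP => [[/eqP lk lN]|->]; last by rewrite repN_id.
  by rewrite -(repN_id lN).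
case: ifP => kr.
  by rewrite -big_filter filter_pred1_uniq // big_seq1.
by rewrite big1_seq // => l /andP[/eqP -> ]; rewrite kr.
Qed.

Lemma fcoef_dftc_tp N (r : seq 'cV[int]_d) c k : (0 < N)%N -> uniq r ->
  k \in modes d N ->
  sqn (fcoef (tp r c) k - dftc (fun n : grid d N => tp r c (gridpoint R n)) k) <=
  alias_cst * N%:R ^- (2 * s) * \sum_(l <- r) wgt l * sqn (c l).
Proof.
move=> N0 ur kN; rewrite fcoef_tp // dftc_tp_split // opprD addrA subrr add0r sqnN.
apply: (le_trans (alias_sum c N0 ur kN)); rewrite ler_wpM2l ?sum_wgt_filter //.
by rewrite mulr_ge0 ?alias_cst_ge0 // invr_ge0 exprn_ge0.
Qed.

(** Inside the box the coefficients of the polynomial cancel. What remains is its tail outside the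
    box and the aliases folded into the box; Parseval bounds both, giving the terms [2 ^+ (2 * s)]
    and [alias_cst]. *)
Lemma interp_tp N (r : seq 'cV[int]_d) c : (0 < N)%N -> uniq r ->
  torus_int (fun x => sqn (tp r c x -
     tp (modes d N) (dftc (fun n : grid d N => tp r c (gridpoint R n))) x)) <=
  2 * (2 ^+ (2 * s) + alias_cst) * N%:R ^- (2 * s) * \sum_(l <- r) wgt l * sqn (c l).
Proof.
move=> N0 ur.
pose E k := \sum_(l <- r | far N k l) c l.
pose r' := [seq l <- r | l \notin modes d N].
have ur' : uniq r' by exact: filter_uniq.
have um := modes_uniq d N.
have split_tp x : tp r c x - tp (modes d N) (dftc (fun n : grid d N => tp r c (gridpoint R n))) x
   = tp r' c x - tp (modes d N) E x.
  have -> : tp (modes d N) (dftc (fun n : grid d N => tp r c (gridpoint R n))) x =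
     tp [seq l <- r | l \in modes d N] c x + tp (modes d N) E x.
    rewrite /tp (eq_big_seq (fun k => (if k \in r then c k * ek k x else 0) + E k * ek k x)).
      rewrite big_split /=; congr (_ + _); rewrite -big_mkcond -big_filter.
      apply: perm_big; apply: uniq_perm; rewrite ?filter_uniq // => k.
      by rewrite !mem_filter andbC.
    move=> k kN; rewrite dftc_tp_split // mulrDl; congr (_ + _).
    by case: ifP; rewrite ?mul0r.
  rewrite opprD addrA; congr (_ - _); rewrite {1}/tp (bigID (fun l => l \in modes d N)) /=.
  by rewrite /tp !big_filter addrAC subrr add0r.
under eq_fun do rewrite split_tp.
have uA := @cucb_tp R d r' c; have uB := @cucb_tp R d (modes d N) E.
apply: (@le_trans _ _ (torus_int (fun x => 2 * sqn (tp r' c x) + 2 * sqn (tp (modes d N) E x)))).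
  apply: le_torus_int => [||x]; last exact: sqnB2.
    by apply: ucb_sqn; exact: cucbB.
  by apply: ucbD; apply: ucbZ; exact: ucb_sqn.
rewrite torus_intD; [|by apply: ucbZ; exact: ucb_sqn..].
rewrite !torus_intZ; [|exact: ucb_sqn..].
rewrite !torus_parseval // -mulrDr -!mulrA ler_wpM2l // mulrDl lerD //.
  rewrite mulr_sumr mulr_sumr big_filter.
  apply: (@le_trans _ _ (\sum_(l <- r | l \notin modes d N)
      2 ^+ (2 * s) * (N%:R ^- (2 * s) * (wgt l * sqn (c l))))).
    apply: ler_sum => l lN; rewrite !mulrA ler_peMl ?sqn_ge0 //.
    rewrite mulrAC ler_pdivlMr ?exprn_gt0 ?ltr0n // mul1r /wgt -exprMn -natrM.
    by rewrite lerXn2r ?nnegrE ?ler0n ?ler_nat ?notin_modes_kap.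
  rewrite big_mkcond; apply: ler_sum => l _; case: ifP => _ //.
  by rewrite !mulr_ge0 ?exprn_ge0 ?invr_ge0 ?exprn_ge0 ?sqn_ge0 // ltW // wgt_gt0.
apply: (@le_trans _ _ (\sum_(k <- modes d N) alias_cst * N%:R ^- (2 * s) *
     \sum_(l <- r | far N k l) wgt l * sqn (c l))).
  rewrite big_seq [leRHS]big_seq; apply: ler_sum => k kN; exact: alias_sum.
rewrite -mulr_sumr -mulrA ler_wpM2l ?alias_cst_ge0 // ler_wpM2l ?invr_ge0 ?exprn_ge0 //.
(* Each frequency is an alias of exactly one mode, [repN N l], so the double sum collapses to a
   single sum over [r]. *)
rewrite (exchange_big_dep xpredT) //=; apply: ler_sum => l _.
have x0 : 0 <= wgt l * sqn (c l) by rewrite mulr_ge0 ?sqn_ge0 // ltW // wgt_gt0.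
rewrite big_mkcond /= (bigD1_seq (repN N l)) ?repN_modes //=.
rewrite big1 => [|k /negPf kl]; last by rewrite /far eq_sym kl.
by rewrite addr0; case: ifP.
Qed.

(* The square of the H^s norm is at most S, up to a constant. Unlike a bound on Fourier
   coefficients, uniform approximation also controls the values on the grid. *)
Definition HapC (S : R) (f : 'cV[R]_d -> C) : Prop :=
  forall e : R, 0 < e -> exists r c,
    [/\ uniq r, \sum_(k <- r) wgt k * sqn (c k) <= S &
        forall x, sqn (f x - tp r c x) <= e].

Definition Hap (S : R) (f : 'cV[R]_d -> R) : Prop := HapC S (fun x => (f x)%:C).

Lemma Hap_ge0 S f : Hap S f -> 0 <= S.
Proof.
move=> /(_ 1 ltr01)[r [c [_ H _]]]; apply: (le_trans _ H).
by apply: sumr_ge0 => k _; rewrite mulr_ge0 ?sqn_ge0 // ltW // wgt_gt0.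
Qed.

Lemma sqn_fcoef_le (g : 'cV[R]_d -> C) k e : cucb g -> (forall x, sqn (g x) <= e) ->
  sqn (fcoef g k) <= e.
Proof.
move=> ug ge; have := @torus_bessel R d g [:: k] (erefl _) ug.
rewrite big_seq1 => H; apply: (le_trans H); rewrite -[leRHS](@torus_int_cst R d).
by apply: le_torus_int => //; [exact: ucb_sqn|exact: ucb_cst].
Qed.

Lemma gmean_le N (w : grid d N -> R) e : (0 < N)%N -> (forall n, w n <= e) ->
  N%:R ^- d * \sum_(n : {ffun 'I_d -> 'I_N}) w n <= e.
Proof.
move=> N0 we; rewrite mulrC ler_pdivrMr ?exprn_gt0 ?ltr0n //.
apply: (@le_trans _ _ (\sum_(n : {ffun 'I_d -> 'I_N}) e)); first exact: ler_sum.
by rewrite sumr_const card_ffun !card_ord -[_ *+ _]mulr_natr natrX.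
Qed.

Lemma dftc_sum_le N (w : grid d N -> C) e : (0 < N)%N -> (forall n, sqn (w n) <= e) ->
  \sum_(k <- modes d N) sqn (dftc w k) <= e.
Proof. by move=> N0 we; apply: (le_trans (dftc_bessel w N0)); exact: gmean_le. Qed.

Lemma sqn_dftc_le N (w : grid d N -> C) k e : (0 < N)%N -> k \in modes d N ->
  (forall n, sqn (w n) <= e) -> sqn (dftc w k) <= e.
Proof.
move=> N0 kN we; apply: le_trans (dftc_sum_le N0 we).
rewrite (bigD1_seq k) ?modes_uniq //= lerDl; apply: sumr_ge0 => l _; exact: sqn_ge0.
Qed.

Lemma dftcB N (f g : grid d N -> C) k :
  dftc (fun n => f n - g n) k = dftc f k - dftc g k.
Proof.
rewrite /dftc -[RHS]/(_ + _) -mulN1r -gmeanZ -gmeanD; congr gmean.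
by apply/funext => n; ring.
Qed.

(** Fourier and discrete coefficients are both controlled by the sup norm, so the bound passes from
    the uniform approximant to [f]. Two applications of |a + b|^2 <= 2|a|^2 + 2|b|^2 turn the two
    errors e/8 into e. *)
Lemma fcoef_dftc_Hap S (f : 'cV[R]_d -> R) N k : ucb f -> Hap S f -> (0 < N)%N ->
  k \in modes d N ->
  sqn (fcoef (fun x => (f x)%:C) k - dftc (fun n : grid d N => (f (gridpoint R n))%:C) k)
  <= 2 * alias_cst * N%:R ^- (2 * s) * S.
Proof.
move=> uf Hf N0 kN; apply/ler_addgt0Pr => e e0.
have [r [c [ur cS fe]]] := Hf (e / 8) (divr_gt0 e0 (ltr0n _ 8)).
have uF := cucb_real uf; have uT := @cucb_tp R d r c.
pose g x := (f x)%:C - tp r c x.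
have E : fcoef (fun x => (f x)%:C) k - dftc (fun n : grid d N => (f (gridpoint R n))%:C) k
  = (fcoef (tp r c) k - dftc (fun n : grid d N => tp r c (gridpoint R n)) k)
    + (fcoef g k - dftc (fun n : grid d N => g (gridpoint R n)) k).
  by rewrite /g fcoefB // dftcB; ring.
rewrite E; apply: (le_trans (sqnD2 _ _)).
have h1 := fcoef_dftc_tp c N0 ur kN.
have h2 : sqn (fcoef g k) <= e / 8 by apply: sqn_fcoef_le => //; exact: cucbB.
have h3 : sqn (dftc (fun n : grid d N => g (gridpoint R n)) k) <= e / 8.
  by apply: sqn_dftc_le => // n; exact: fe.
have h4 := sqnB2 (fcoef g k) (dftc (fun n : grid d N => g (gridpoint R n)) k).
have h5 : alias_cst * N%:R ^- (2 * s) * \sum_(l <- r) wgt l * sqn (c l)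
   <= alias_cst * N%:R ^- (2 * s) * S.
  by rewrite ler_wpM2l // mulr_ge0 ?alias_cst_ge0 // invr_ge0 exprn_ge0.
move: h1 h2 h3 h4 h5.
set a := sqn _; set b := sqn _; set b' := sqn _; set a' := sqn _; set w := _ * \sum_(_ <- _) _.
by rewrite -!mulrA; lra.
Qed.

(** The remainder [g] is small at the grid points too, so discrete Bessel together with Parseval
    bounds its interpolant independently of N. *)
Lemma interp_Hap S (f : 'cV[R]_d -> R) N : ucb f -> Hap S f -> (0 < N)%N ->
  torus_int (fun x => sqn ((f x)%:C -
     tp (modes d N) (dftc (fun n : grid d N => (f (gridpoint R n))%:C)) x)) <=
  4 * (2 ^+ (2 * s) + alias_cst) * N%:R ^- (2 * s) * S.
Proof.
move=> uf Hf N0; apply/ler_addgt0Pr => e e0.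
have [r [c [ur cS fe]]] := Hf (e / 8) (divr_gt0 e0 (ltr0n _ 8)).
have uF := cucb_real uf; have uT := @cucb_tp R d r c.
pose g x := (f x)%:C - tp r c x.
have ug : cucb g by exact: cucbB.
pose I (h : 'cV[R]_d -> C) := tp (modes d N) (dftc (fun n : grid d N => h (gridpoint R n))).
have uI h : cucb (I h) by exact: cucb_tp.
have E x : (f x)%:C - I (fun x => (f x)%:C) x = (tp r c x - I (tp r c) x) + (g x - I g x).
  rewrite /I /tp -/(tp r c x).
  have -> : \sum_(k <- modes d N) dftc (fun n : grid d N => g (gridpoint R n)) k * ek k x
     = \sum_(k <- modes d N) dftc (fun n : grid d N => (f (gridpoint R n))%:C) k * ek k x
     - \sum_(k <- modes d N) dftc (fun n : grid d N => tp r c (gridpoint R n)) k * ek k x.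
    by rewrite -sumrB; apply: eq_bigr => k _; rewrite dftcB mulrBl.
  by rewrite /g; ring.
under eq_fun do rewrite -/(I (fun x => (f x)%:C)) E.
apply: (@le_trans _ _ (torus_int (fun x => 2 * sqn (tp r c x - I (tp r c) x)
   + 4 * (e / 8) + 4 * sqn (I g x)))).
  apply: le_torus_int => [||x].
  - by apply: ucb_sqn; apply: cucbD; exact: cucbB.
  - apply: ucbD; first apply: ucbD; last exact/ucbZ/ucb_sqn.
      by apply/ucbZ/ucb_sqn; exact: cucbB.
    exact: ucb_cst.
  - have := sqnD2 (tp r c x - I (tp r c) x) (g x - I g x).
    by have := sqnB2 (g x) (I g x); have := fe x; rewrite -/(g x); lra.
have u1 : ucb (fun x => sqn (tp r c x - I (tp r c) x)) by apply: ucb_sqn; exact: cucbB.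
have u2 : ucb (fun x => sqn (I g x)) by exact: ucb_sqn.
rewrite !torus_intD ?torus_intZ ?torus_int_cst //; try exact: ucb_cst; try exact: ucbZ.
  have h1 := interp_tp c N0 ur.
  have h2 : torus_int (fun x => sqn (I g x)) <= e / 8.
    by rewrite /I torus_parseval ?modes_uniq //; apply: dftc_sum_le => // n; exact: fe.
  have h5 : 2 * (2 ^+ (2 * s) + alias_cst) * N%:R ^- (2 * s) * \sum_(l <- r) wgt l * sqn (c l)
     <= 2 * (2 ^+ (2 * s) + alias_cst) * N%:R ^- (2 * s) * S.
    by rewrite ler_wpM2l // !mulr_ge0 ?addr_ge0 ?alias_cst_ge0 ?exprn_ge0.
  move: h1 h2 h5; rewrite -/(I (tp r c)) -!mulrA.
  set a := torus_int _; set b := torus_int _; set w := (_ * _) in |- *; lra.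
by apply: ucbD; [exact: ucbZ|exact: ucb_cst].
Qed.
End Aliasing.

(** * Fejer means *)

Section Fejer.
Context {R : realType} {d : nat}.
Local Notation C := R[i].
Local Open Scope complex_scope.

(* The test functions of Korovkin's theorem: against them the Fejer kernel
   integrates to 1/n. *)
Lemma periodic_modulus (f : 'cV[R]_d -> R) (e : R) : ucb f -> torus_periodic f -> 0 < e ->
  exists2 A, 0 <= A & forall x y : 'cV[R]_d,
    `|f x - f y| <= e + A * \sum_i (1 - cos (2 * pi * (x i 0 - y i 0))).
Proof.
move=> [[M fM] uf] pf e0; have [del d0 Hd] := uf e e0.
have pp := pi_gt0 R.
pose del' := Num.min del 2^-1.
have d'0 : 0 < del' by rewrite lt_min d0 invr_gt0 ltr0n.
have d'h : del' <= 2^-1 by rewrite ge_min lexx orbT.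
have c0 : 0 < 1 - cos (2 * pi * del').
  by rewrite subr_gt0; apply: cos2pi_lt1 => //; lra.
have M0 : 0 <= M by exact: le_trans (fM 0).
exists (2 * M / (1 - cos (2 * pi * del'))) => [|x y].
  by rewrite !mulr_ge0 // invr_ge0 ltW.
set A := _ / _; have A0 : 0 <= A by rewrite !mulr_ge0 // invr_ge0 ltW.
(* Subtracting nearest integers brings every coordinate difference into [-1/2, 1/2]. If all of them
   are at most [del'], uniform continuity applies; otherwise one cosine term is at least
   [1 - cos (2 * pi * del')], and [A] is chosen so that this pays for the trivial bound [2 * M]. *)
pose z : 'cV[int]_d := \col_i Num.floor (x i 0 - y i 0 + 2^-1).
have zi i : `|x i 0 - y i 0 - (z i 0)%:~R| <= 2^-1.
  have := floor_itv (x i 0 - y i 0 + 2^-1); rewrite mxE => /andP[h1 h2].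
  by move: h2; rewrite rmorphD /= ler_norml => h2; apply/andP; split; lra.
have t0 i : 0 <= 1 - cos (2 * pi * (x i 0 - y i 0)) by rewrite subr_ge0 cos_le1.
have S0 : 0 <= A * \sum_i (1 - cos (2 * pi * (x i 0 - y i 0))).
  by rewrite mulr_ge0 // sumr_ge0.
case: (pselect (forall i, `|x i 0 - y i 0 - (z i 0)%:~R| <= del')) => H.
  rewrite -(pf y z); apply: (@le_trans _ _ e); last by rewrite lerDl.
  apply: Hd => i; rewrite mxE [map_mx _ _ _ _]mxE opprD addrA; apply: (le_trans (H i)).
  by rewrite ge_min lexx.
have [i /negP] : exists i, ~ (`|x i 0 - y i 0 - (z i 0)%:~R| <= del') by exact/existsNP.
rewrite -ltNge => Hi.
have h1 : `|f x - f y| <= 2 * M.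
  by apply: (le_trans (ler_normB _ _)); have := fM x; have := fM y; lra.
apply: (le_trans h1).
have h2 : 1 - cos (2 * pi * del') <= \sum_i (1 - cos (2 * pi * (x i 0 - y i 0))).
  rewrite (bigD1 i) //= -[leLHS]addr0 lerD ?sumr_ge0 // lerD2l lerN2.
  rewrite -(cosD2piZ _ (- z i 0)) rmorphN mulrN -mulrBr -cos_norm.
  rewrite normrM (ger0_norm (_ : 0 <= 2 * pi)); last by rewrite mulr_ge0 // ltW.
  have := zi i; set t := `|_| in Hi * => ti.
  have t0' : 0 <= t by exact: normr_ge0.
  rewrite ltW // ltr_cos ?in_itv /=.
  - by rewrite ltr_pM2l // mulr_gt0.
  - by apply/andP; split; [rewrite !mulr_ge0 // ltW | nra].
  - by apply/andP; split; [rewrite !mulr_ge0 // ltW | nra].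
apply: (@le_trans _ _ (A * (1 - cos (2 * pi * del')))).
  by rewrite /A divfK // gt_eqF.
apply: (@le_trans _ _ (A * \sum_i (1 - cos (2 * pi * (x i 0 - y i 0))))).
  by rewrite ler_wpM2l.
by rewrite lerDr ltW.
Qed.

Section Kernel.
Variable n : nat.
Hypothesis n0 : (0 < n)%N.
Local Notation J := {ffun 'I_d -> 'I_n}.

Definition jv (j : J) : 'cV[int]_d := \col_i (j i)%:Z.

(* The kernel whose convolution with f is the Fejer mean of f: a nonnegative
   trigonometric polynomial with coefficients in [0, 1]. *)
Definition fejer (x y : 'cV[R]_d) : R :=
  n%:R ^- d * sqn (\sum_(j : J) ek (jv j) x * cj (ek (jv j) y)).

Lemma fejer_ge0 x y : 0 <= fejer x y.
Proof. by rewrite mulr_ge0 ?sqn_ge0 // invr_ge0 exprn_ge0. Qed.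

Lemma fejerE x y : (fejer x y)%:C = (n%:R ^- d : R)%:C *
  \sum_(j : J) \sum_(j' : J) ek (jv j - jv j') x * cj (ek (jv j - jv j') y).
Proof.
rewrite /fejer rcM sqnE (big_morph _ (@cjD R) (@cj0 R)) /=; congr (_ * _).
rewrite mulr_suml; apply: eq_bigr => j _; rewrite mulr_sumr; apply: eq_bigr => j' _.
by rewrite !ekD !ekN !cjM !cjK; ring.
Qed.

Lemma ucb_fejer x : ucb (fejer x).
Proof.
apply: ucbZ; apply: ucb_sqn; apply: cucb_sum => j; apply: cucbM; first exact: cucb_cst.
by apply: cucbJ; exact: cucb_ek.
Qed.

Lemma torus_cint_fejer (G : 'cV[R]_d -> C) x : cucb G ->
  torus_cint (fun y => G y * (fejer x y)%:C) = (n%:R ^- d : R)%:C *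
  \sum_(j : J) \sum_(j' : J) fcoef G (jv j - jv j') * ek (jv j - jv j') x.
Proof.
move=> uG.
have uk k : cucb (fun y => G y * cexp (- pairing k y)).
  apply: cucbM => //; under eq_fun do rewrite cexpN; apply: cucbJ; exact: cucb_ek.
have -> : (fun y => G y * (fejer x y)%:C) = (fun y => (n%:R ^- d : R)%:C *
  \sum_(j : J) \sum_(j' : J) ek (jv j - jv j') x * (G y * cexp (- pairing (jv j - jv j') y))).
  apply/funext => y; rewrite fejerE mulrCA; congr (_ * _).
  rewrite mulr_sumr; apply: eq_bigr => j _; rewrite mulr_sumr; apply: eq_bigr => j' _.
  by rewrite cexpN -/(ek _ _); ring.
have uj j j' : cucb (fun y => ek (jv j - jv j') x * (G y * cexp (- pairing (jv j - jv j') y))).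
  by apply: cucbM => //; exact: cucb_cst.
rewrite torus_cintZ; last by apply: cucb_sum => j; exact: cucb_sum.
congr (_ * _); rewrite torus_cint_sum => [|j]; last exact: cucb_sum.
apply: eq_bigr => j _; rewrite torus_cint_sum //; apply: eq_bigr => j' _.
by rewrite torus_cintZ // mulrC.
Qed.

Lemma torus_int_fejer (g : 'cV[R]_d -> R) x : ucb g ->
  torus_cint (fun y => (g y)%:C * (fejer x y)%:C) = (torus_int (fun y => g y * fejer x y))%:C.
Proof.
move=> ug; rewrite /torus_cint; apply/eqP; rewrite eq_complex /=; apply/andP; split; apply/eqP.
  by congr torus_int; apply/funext => y; rewrite mul0r subr0.
rewrite -[RHS](@torus_int_cst R d); congr torus_int; apply/funext => y.
by rewrite mulr0 mul0r addr0.
Qed.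

Lemma jv_inj : injective jv.
Proof.
move=> j j' /colP E; apply/ffunP => i; have := E i; rewrite !mxE => -[].
exact: val_inj.
Qed.

Lemma nd0 : (n%:R ^+ d : R) != 0.
Proof. by rewrite expf_neq0 // pnatr_eq0 -lt0n. Qed.

Lemma torus_int_fejer1 x : torus_int (fejer x) = 1.
Proof.
have u1 := @ucb_cst R d 1; apply: (@complexI R).
have -> : fejer x = (fun y => 1 * fejer x y) by apply/funext => y; rewrite mul1r.
rewrite -torus_int_fejer // torus_cint_fejer; last exact: cucb_real.
have E (j j' : J) : fcoef (fun=> (1 : R)%:C) (jv j - jv j') * ek (jv j - jv j') x = (j' == j)%:R.
  rewrite /fcoef; under eq_fun do rewrite mul1r -pairingN -/(ek _ _).
  rewrite torus_cint_ek oppr_eq0 subr_eq0 (inj_eq jv_inj) eq_sym.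
  by case: eqP => [->|_]; rewrite ?mul0r // subrr ek0 mulr1.
have E2 (j : J) : \sum_(j' : J)
    fcoef (fun=> (1 : R)%:C) (jv j - jv j') * ek (jv j - jv j') x = 1.
  under eq_bigr do rewrite E.
  by rewrite (bigD1 j) //= eqxx big1 ?addr0 // => j' /negPf ->.
under eq_bigr do rewrite E2.
rewrite sumr_const card_ffun !card_ord natrX -rc_nat.
by rewrite -rcX -rcM mulVf // nd0.
Qed.

(** Only pairs with j' = j + e_i contribute; there are (n - 1) n^(d-1) of them, against the
    normalization n^d. *)
Lemma torus_int_fejer_cos (x : 'cV[R]_d) i :
  torus_int (fun y => cos (2 * pi * (x i 0 - y i 0)) * fejer x y) = 1 - n%:R^-1.
Proof.
pose ei : 'cV[int]_d := delta_mx i 0.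
have pe (y : 'cV[R]_d) : pairing ei y = y i 0.
  rewrite /pairing (bigD1 i) //= mxE !eqxx mul1r big1 ?addr0 // => l /negPf li.
  by rewrite mxE li mul0r.
pose G y := ek ei x * cj (ek ei y).
have uG : cucb G by apply: cucbM; [exact: cucb_cst|apply: cucbJ; exact: cucb_ek].
have -> : torus_int (fun y => cos (2 * pi * (x i 0 - y i 0)) * fejer x y) =
   complex.Re (torus_cint (fun y => G y * (fejer x y)%:C)).
  rewrite /torus_cint /=; congr torus_int; apply/funext => y.
  by rewrite mulr0 subr0 !pe mulrN opprK mulrBr cosB.
rewrite torus_cint_fejer //.
have E (j j' : J) : fcoef G (jv j - jv j') * ek (jv j - jv j') x = (jv j' == jv j + ei)%:R.
  have -> : fcoef G (jv j - jv j') = ek ei x * (jv j' == jv j + ei)%:R.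
    have <- : torus_cint (ek (- ei - (jv j - jv j')) : _ -> C) = (jv j' == jv j + ei)%:R.
      by rewrite torus_cint_ek opprB [- ei + _]addrC -addrA -opprD subr_eq0.
    rewrite -torus_cintZ; last exact: cucb_ek.
    congr torus_cint; apply/funext => y.
    by rewrite /G ekD !ekN cexpN mulrA.
  case: eqP => [E|_]; last by rewrite mulr0 mul0r.
  by rewrite mulr1 -ekD E opprD [jv j + _]addrA subrr sub0r subrr ek0.
have E2 (j : J) : \sum_(j' : J) fcoef G (jv j - jv j') * ek (jv j - jv j') x =
   ((j i).+1 < n)%N%:R.
  under eq_bigr do rewrite E.
  case: ltnP => [lt|ge]; last first.
    rewrite big1 // => j' _; case: eqP => // /colP/(_ i); rewrite !mxE !eqxx /= => Ei.
    by have := ltn_ord (j' i); move: Ei ge; move: (nat_of_ord _) (nat_of_ord _) => a b; lia.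
  pose j1 : J := [ffun l => if l == i then Ordinal lt else j l].
  have j1E : jv j1 = jv j + ei.
    apply/colP => l; rewrite !mxE ffunE; case: eqP => [->|_] /=; last by rewrite addr0.
    by rewrite -addn1 PoszD.
  rewrite (bigD1 j1) //= j1E eqxx big1 ?addr0 // => j'.
  by rewrite -j1E (inj_eq jv_inj) => /negPf ->.
under eq_bigr do rewrite E2.
pose g (l : 'I_d) (a : 'I_n) : C := if l == i then (a.+1 < n)%N%:R else 1.
have -> : \sum_(j : J) ((j i).+1 < n)%N%:R = \sum_(j : J) \prod_l g l (j l) :> C.
  apply: eq_bigr => j _; rewrite (bigD1 i) //= {1}/g eqxx big1 ?mulr1 // => l /negPf li.
  by rewrite /g li.
rewrite -bigA_distr_bigA (bigD1 i) //=.
have -> : \sum_j g i j = n.-1%:R.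
  rewrite /g eqxx; case: (n) n0 => // m _.
  rewrite big_ord_recr /= ltnn addr0 (eq_bigr (fun=> 1)) => [|a _].
    by rewrite sumr_const card_ord.
  by rewrite /= ltnS ltn_ord.
rewrite (eq_bigr (fun=> n%:R)) => [|l /negPf li]; last first.
  by rewrite /g li sumr_const card_ord.
rewrite prodr_const cardC1 card_ord.
have -> : n.-1%:R * n%:R ^+ d.-1 = (n.-1%:R * n%:R ^+ d.-1 : R)%:C :> C.
  by rewrite rcM rcX !rc_nat.
have d0 : (0 < d)%N by exact: leq_ltn_trans (ltn_ord i).
rewrite -rcM /= -[in X in X * _](prednK d0); move: d.-1 => d'.
have Nr : n%:R != 0 :> R by rewrite pnatr_eq0 -lt0n.
have -> : n.-1%:R = n%:R - 1 :> R by rewrite -[in RHS](prednK n0) -natr1 addrK.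
by rewrite exprS /=; field; rewrite Nr expf_neq0.
Qed.

End Kernel.

(** The approximant is a Fejer mean. Positivity and unit mass of the kernel bound its distance to
    [f] by the average of the modulus from [periodic_modulus], which is at most eps + A d / n. *)
Lemma Hap_fourier s S (f : 'cV[R]_d -> R) : ucb f -> torus_periodic f ->
  (forall r : seq 'cV[int]_d, uniq r ->
     \sum_(k <- r) wgt s k * sqn (fcoef (fun x => (f x)%:C) k) <= S) ->
  Hap s S f.
Proof.
move=> uf pf fS e e0.
(* Chosen so that [(2 * eps) ^+ 2 <= 4 * eps <= e]: one [eps] is for the modulus, the other for A d
   / n. *)
pose eps := Num.min 1 (e / 4).
have ep0 : 0 < eps by rewrite lt_min ltr01 divr_gt0.
have ep1 : (2 * eps) ^+ 2 <= e.
  have h1 : eps <= 1 by rewrite ge_min lexx.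
  have h2 : eps <= e / 4 by rewrite ge_min lexx orbT.
  by rewrite exprMn; nra.
have [A A0 fA] := periodic_modulus uf pf ep0.
have [n n0 nA] : exists2 n, (0 < n)%N & A * d%:R * n%:R^-1 <= eps.
  have x0 : 0 <= A * d%:R / eps by rewrite divr_ge0 ?mulr_ge0 // ltW.
  exists (Num.truncn (A * d%:R / eps)).+1 => //.
  have := truncnS_gt (A * d%:R / eps); rewrite ltr_pdivrMr // => h.
  by rewrite ler_pdivrMr ?ltr0n // [eps * _]mulrC ltW.
pose F x := (f x)%:C; have uF : cucb F by exact: cucb_real.
pose r := undup [seq jv jj.1 - jv jj.2 | jj : {ffun 'I_d -> 'I_n} * {ffun 'I_d -> 'I_n}].
(* The Fejer multiplier, written as the number of pairs with difference [k] divided by n^d. It is at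
   most 1 because [j'] and [k] determine [j]. *)
pose w (k : 'cV[int]_d) : R := n%:R ^- d *
  \sum_(j : {ffun 'I_d -> 'I_n}) \sum_(j' : {ffun 'I_d -> 'I_n}) (jv j - jv j' == k)%:R.
have w0 k : 0 <= w k.
  rewrite mulr_ge0 ?invr_ge0 ?exprn_ge0 // sumr_ge0 // => j _.
  by rewrite sumr_ge0.
have w1 k : w k <= 1.
  rewrite /w mulrC ler_pdivrMr ?exprn_gt0 ?ltr0n // mul1r exchange_big /=.
  apply: (@le_trans _ _ (\sum_(j' : {ffun 'I_d -> 'I_n}) 1)); last first.
    by rewrite sumr_const card_ffun !card_ord natrX.
  apply: ler_sum => j' _.
  case: (pselect (exists j : {ffun 'I_d -> 'I_n}, jv j - jv j' = k)) => [[j1 E]|H]; last first.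
    by rewrite big1 // => j _; case: eqP => // E; case: H; exists j.
  rewrite (bigD1 j1) //= big1 ?addr0 => [|j /negPf jj]; first by case: eqP.
  by rewrite -E (inj_eq (addIr _)) (inj_eq (@jv_inj _)) jj.
exists r, (fun k => (w k)%:C * fcoef F k); split.
- exact: undup_uniq.
- apply: le_trans (fS r (undup_uniq _)); apply: ler_sum => k _.
  apply: ler_wpM2l; first by rewrite ltW // wgt_gt0.
  rewrite sqnM sqnC ler_piMl ?sqn_ge0 //.
  by rewrite expr_le1.
move=> x.
have -> : tp r (fun k => (w k)%:C * fcoef F k) x =
    torus_cint (fun y => F y * (fejer n x y)%:C).
  rewrite torus_cint_fejer //.
  transitivity (\sum_(k <- r) (n%:R ^- d : R)%:C * \sum_(j : {ffun 'I_d -> 'I_n})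
     \sum_(j' : {ffun 'I_d -> 'I_n}) (jv j - jv j' == k)%:R * (fcoef F k * ek k x)).
    apply: eq_bigr => k _; rewrite /w rcM rc_sum -!mulrA; congr (_ * _).
    rewrite mulr_suml; apply: eq_bigr => j _; rewrite rc_sum mulr_suml.
    by apply: eq_bigr => j' _; rewrite rc_nat.
  rewrite -mulr_sumr exchange_big /=; congr (_ * _); apply: eq_bigr => j _.
  rewrite exchange_big /=; apply: eq_bigr => j' _.
  rewrite (bigD1_seq (jv j - jv j')) ?undup_uniq //=; last first.
    rewrite mem_undup; apply/mapP; exists (j, j') => //; exact: mem_enum.
  rewrite eqxx mul1r big1 ?addr0 // => k /negPf; rewrite eq_sym => ->.
  by rewrite mul0r.
have uk := ucb_fejer n x.
rewrite torus_int_fejer // -rcB sqnC /=.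
have -> : f x - torus_int (fun y => f y * fejer n x y) =
    torus_int (fun y => (f x - f y) * fejer n x y).
  under [in RHS]eq_fun do rewrite mulrBl.
  rewrite torus_intB; [|exact: ucbZ|exact: ucbM].
  by rewrite torus_intZ // torus_int_fejer1 // mulr1.
apply: (le_trans _ ep1); rewrite -real_normK ?num_real // lerXn2r ?nnegrE ?normr_ge0 //.
  by rewrite mulr_ge0 // ltW.
pose h (y : 'cV[R]_d) := eps + A * \sum_i (1 - cos (2 * pi * (x i 0 - y i 0))).
have uc i : ucb (fun y : 'cV[R]_d => cos (2 * pi * (x i 0 - y i 0))).
  have := @ucb_cos R d (- delta_mx i 0) (x i 0).
  set G := fun y => _; suff -> : G = (fun y => cos (2 * pi * (x i 0 - y i 0))) by [].
  apply/funext => y; rewrite /G; congr (cos (_ * _)); rewrite addrC pairingN; congr (_ - _).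
  rewrite /pairing (bigD1 i) //= mxE !eqxx mul1r big1 ?addr0 // => l /negPf li.
  by rewrite mxE li mul0r.
have uh : ucb h.
  apply: ucbD; first exact: ucb_cst.
  by apply: ucbZ; apply: ucb_sum => i; apply: ucbB => //; exact: ucb_cst.
have I1 : torus_int (fun y => h y * fejer n x y) <= 2 * eps.
  have -> : (fun y => h y * fejer n x y) = (fun y => eps * fejer n x y +
     A * \sum_i (fejer n x y - cos (2 * pi * (x i 0 - y i 0)) * fejer n x y)).
    apply/funext => y; rewrite /h mulrDl -mulrA mulr_suml.
    by congr (_ + _ * _); apply: eq_bigr => i _; rewrite mulrBl mul1r.
  have ui i : ucb (fun y => fejer n x y - cos (2 * pi * (x i 0 - y i 0)) * fejer n x y).
    by apply: ucbB => //; exact: ucbM.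
  have uS := ucb_sum (index_enum 'I_d) ui.
  rewrite (torus_intD (ucbZ eps uk) (ucbZ A uS)) (torus_intZ eps uk) (torus_intZ A uS).
  rewrite (torus_int_sum _ ui) torus_int_fejer1 // mulr1.
  rewrite (eq_bigr (fun=> n%:R^-1)) => [|i _].
    rewrite sumr_const card_ord -[_ *+ d]mulr_natl mulrA; lra.
  rewrite torus_intB //; last exact: ucbM.
  by rewrite torus_int_fejer1 // torus_int_fejer_cos // opprB addrCA subrr addr0.
have ud : ucb (fun y => (f x - f y) * fejer n x y).
  by apply: ucbM => //; apply: ucbB => //; exact: ucb_cst.
have fk y : `|(f x - f y) * fejer n x y| <= h y * fejer n x y.
  by rewrite normrM (ger0_norm (fejer_ge0 _ _ _)) ler_wpM2r ?fejer_ge0.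
apply: le_trans I1; rewrite ler_norml; apply/andP; split.
  rewrite lerNl -torus_intN //; apply: le_torus_int; [exact: ucbN|exact: ucbM|] => y.
  by apply: le_trans (fk y); rewrite -normrN ler_norm.
apply: le_torus_int => [//||y]; first exact: ucbM.
by apply: le_trans (fk y); exact: ler_norm.
Qed.

End Fejer.

(** * Closure properties of the approximation class *)

Section ApproxClass.
Context {R : realType} {d : nat} (s : nat).
Local Notation C := R[i].
Local Open Scope complex_scope.
Implicit Types (f g : 'cV[R]_d -> R).

Lemma sum_sub_seq (K : eqType) (r r' : seq K) (F : K -> R) : uniq r -> uniq r' ->
  {subset r <= r'} -> \sum_(k <- r') (if k \in r then F k else 0) = \sum_(k <- r) F k.
Proof.
move=> ur ur' rr; rewrite -big_mkcond -big_filter; apply: perm_big.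
apply: uniq_perm; rewrite ?filter_uniq // => k; rewrite mem_filter.
by case: (boolP (k \in r)) => // /rr ->.
Qed.

Lemma tp_sub_seq (r r' : seq 'cV[int]_d) (c : 'cV[int]_d -> C) x : uniq r -> uniq r' ->
  {subset r <= r'} -> tp r' (fun k => if k \in r then c k else 0) x = tp r c x.
Proof.
move=> ur ur' rr; rewrite /tp.
rewrite (eq_bigr (fun k => if k \in r then c k * ek k x else 0)); last first.
  by move=> k _; case: ifP; rewrite ?mul0r.
rewrite -big_mkcond -big_filter; apply: perm_big.
apply: uniq_perm; rewrite ?filter_uniq // => k; rewrite mem_filter.
by case: (boolP (k \in r)) => // /rr ->.
Qed.

Lemma HapC_add S T (f g : 'cV[R]_d -> C) : HapC s S f -> HapC s T g ->
  HapC s (2 * S + 2 * T) (fun x => f x + g x).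
Proof.
move=> Hf Hg e e0; have e4 : 0 < e / 4 by rewrite divr_gt0.
have [r [c [ur cS fe]]] := Hf _ e4; have [r' [c' [ur' cS' ge]]] := Hg _ e4.
pose q := undup (r ++ r'); have uq : uniq q by exact: undup_uniq.
have rq : {subset r <= q} by move=> k kr; rewrite mem_undup mem_cat kr.
have rq' : {subset r' <= q} by move=> k kr; rewrite mem_undup mem_cat kr orbT.
pose a k := (if k \in r then c k else 0); pose b k := (if k \in r' then c' k else 0).
exists q, (fun k => a k + b k); split => //.
  apply: (@le_trans _ _ (\sum_(k <- q) (2 * (wgt s k * sqn (a k)) + 2 * (wgt s k * sqn (b k))))).
    apply: ler_sum => k _; rewrite ![2 * (_ * _)]mulrCA -mulrDr.
    by rewrite ler_wpM2l ?sqnD2 // ltW // wgt_gt0.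
  rewrite big_split /= -!mulr_sumr lerD // ler_wpM2l //.
    apply: le_trans cS; rewrite -(sum_sub_seq _ ur uq rq); apply: ler_sum => k _.
    by rewrite /a; case: ifP => // _; rewrite sqn0 mulr0.
  apply: le_trans cS'; rewrite -(sum_sub_seq _ ur' uq rq'); apply: ler_sum => k _.
  by rewrite /b; case: ifP => // _; rewrite sqn0 mulr0.
move=> x.
have -> : tp q (fun k => a k + b k) x = tp r c x + tp r' c' x.
  rewrite -(tp_sub_seq c x ur uq rq) -(tp_sub_seq c' x ur' uq rq') /tp -big_split.
  by apply: eq_bigr => k _; rewrite mulrDl.
rewrite opprD addrACA; apply: (le_trans (sqnD2 _ _)).
by have := fe x; have := ge x; lra.
Qed.

Lemma HapC_scale S (a : C) (f : 'cV[R]_d -> C) : HapC s S f ->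
  HapC s (sqn a * S) (fun x => a * f x).
Proof.
move=> Hf e e0; have a0 := sqn_ge0 a.
have a1 : 0 < sqn a + 1 by rewrite ltr_wpDl.
have [r [c [ur cS fe]]] := Hf (e / (sqn a + 1)) (divr_gt0 e0 a1).
exists r, (fun k => a * c k); split => // [|x].
  under eq_bigr do rewrite sqnM mulrCA.
  by rewrite -mulr_sumr ler_wpM2l.
have -> : tp r (fun k => a * c k) x = a * tp r c x.
  by rewrite /tp mulr_sumr; apply: eq_bigr => k _; rewrite mulrA.
rewrite -mulrBr sqnM; apply: (@le_trans _ _ (sqn a * (e / (sqn a + 1)))).
  by rewrite ler_wpM2l.
by rewrite mulrCA ler_piMr ?(ltW e0) // ler_pdivrMr // mul1r; lra.
Qed.

Lemma HapC0 : HapC s 0 (fun _ : 'cV[R]_d => 0).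
Proof.
move=> e e0; exists [::], (fun=> 0); split => //; first by rewrite big_nil.
by move=> x; rewrite /tp big_nil subr0 sqn0 ltW.
Qed.

Lemma HapC_mono S T (f : 'cV[R]_d -> C) : S <= T -> HapC s S f -> HapC s T f.
Proof.
move=> ST Hf e /Hf[r [c [ur cS fe]]]; exists r, c; split => //.
exact: le_trans ST.
Qed.

(** The bound [T] is fixed before the functions, here and in the later closure lemmas, so that one
    constant serves the whole input set. *)
Lemma HapC_sum n S : exists T, forall f : 'I_n -> 'cV[R]_d -> C,
  (forall i, HapC s S (f i)) -> HapC s T (fun x => \sum_i f i x).
Proof.
elim: n => [|n [T IH]].
  exists 0 => f _; under eq_fun do rewrite big_ord0; exact: HapC0.
exists (2 * S + 2 * T) => f Hf; under eq_fun do rewrite big_ord_recl.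
by apply: HapC_add => //; exact: IH.
Qed.

Lemma HapC_ek k : HapC s (wgt s k) (@ek R d k).
Proof.
move=> e e0; exists [:: k], (fun=> 1); split => // [|x].
  by rewrite big_seq1 /sqn /= expr1n expr0n addr0 mulr1.
by rewrite /tp big_seq1 mul1r subrr sqn0 ltW.
Qed.

Lemma kapN (k : 'cV[int]_d) : kap (- k) = kap k.
Proof. by rewrite /kap; congr maxn; apply: eq_bigr => i _; rewrite mxE abszN. Qed.

(** The real part is half the sum of the term and its conjugate, which has frequency [- k] and the
    same weight. *)
Lemma Hap_Re_ek k (z : C) : Hap s (4 * sqn z * wgt s k) (fun x : 'cV[R]_d => complex.Re (z * ek k x)).
Proof.
have H1 := HapC_scale z (HapC_ek k).
have H2 : HapC s (sqn z * wgt s k) (fun x => cj z * ek (- k) x).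
  have := HapC_scale (cj z) (HapC_ek (- k)).
  by rewrite /wgt kapN sqnJ.
have := HapC_scale (2^-1 : R)%:C (HapC_add H1 H2).
rewrite sqnC => H; have {}H := HapC_mono (_ : _ <= 4 * sqn z * wgt s k) H.
rewrite /Hap; set G := fun x => _; suff -> : G = (fun x => (2^-1)%:C * (z * ek k x + cj z * ek (- k) x)).
  apply: H; have h1 : 0 <= sqn z * wgt s k by rewrite mulr_ge0 ?sqn_ge0 // ltW // wgt_gt0.
  by rewrite -mulrA exprVn; lra.
apply/funext => x; rewrite /G ekN -cjM; case: (z * _) => a b /=.
by apply/eqP; rewrite eq_complex /=; apply/andP; split; apply/eqP; field.
Qed.

Lemma HapD S T f g : Hap s S f -> Hap s T g ->
  Hap s (2 * S + 2 * T) (fun x => f x + g x).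
Proof. by move=> Hf Hg; have := HapC_add Hf Hg; under eq_fun do rewrite -rcD. Qed.

Lemma HapZ S a f : Hap s S f -> Hap s (a ^+ 2 * S) (fun x => a * f x).
Proof. by move=> Hf; have := HapC_scale a%:C Hf; under eq_fun do rewrite -rcM; rewrite sqnC. Qed.

Lemma Hap_cst (a : R) : Hap s (a ^+ 2) (fun _ : 'cV[R]_d => a).
Proof.
have := HapC_scale a%:C (HapC_ek 0); under eq_fun do rewrite ek0 mulr1.
rewrite sqnC /wgt /kap (_ : \max_i _ = 0)%N ?expr1n ?mulr1 //.
by apply: big1 => i _; rewrite mxE.
Qed.

Lemma Hap_mono S T f : S <= T -> Hap s S f -> Hap s T f.
Proof. exact: HapC_mono. Qed.

Lemma Hap_sum n S : exists T, forall f : 'I_n -> 'cV[R]_d -> R,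
  (forall i, Hap s S (f i)) -> Hap s T (fun x => \sum_i f i x).
Proof.
have [T HT] := HapC_sum n S; exists T => f Hf.
by rewrite /Hap; under eq_fun do rewrite rc_sum; exact: HT.
Qed.

Lemma Hap_sum_seq (I : eqType) (r : seq I) (S : I -> R) : exists T, forall f : I -> 'cV[R]_d -> R,
  (forall i, i \in r -> Hap s (S i) (f i)) -> Hap s T (fun x => \sum_(i <- r) f i x).
Proof.
elim: r => [|i r [T IH]].
  exists 0 => f _; under eq_fun do rewrite big_nil; exact: HapC0.
exists (2 * S i + 2 * T) => f Hf; under eq_fun do rewrite big_cons.
apply: HapD; first by apply: Hf; rewrite mem_head.
by apply: IH => j jr; apply: Hf; rewrite inE jr orbT.
Qed.

(** Uniform limits keep the same [S]; this lets compositions be estimated on polynomials only. *)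
Lemma Hap_lim S f : (forall e : R, 0 < e -> exists2 g, Hap s S g &
  forall x, (f x - g x) ^+ 2 <= e) -> Hap s S f.
Proof.
move=> H e e0; have e4 : 0 < e / 4 by rewrite divr_gt0.
have [g Hg fg] := H _ e4; have [r [c [ur cS ge]]] := Hg _ e4.
exists r, c; split => // x.
have -> : (f x)%:C - tp r c x = (f x - g x)%:C + ((g x)%:C - tp r c x).
  by rewrite rcB addrA subrK.
apply: (le_trans (sqnD2 _ _)); rewrite sqnC.
by have := fg x; have := ge x; lra.
Qed.

Lemma Hap_near S f e : Hap s S f -> 0 < e -> exists r c,
  [/\ uniq r, \sum_(k <- r) wgt s k * sqn (c k) <= S &
      forall x, `|f x - complex.Re (tp r c x)| <= e].
Proof.
move=> Hf e0; have [r [c [ur cS fe]]] := Hf _ (exprn_gt0 2 e0).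
exists r, c; split => // x.
rewrite -(@ler_pXn2r _ 2) ?nnegrE ?normr_ge0 ?(ltW e0) // real_normK ?num_real //.
apply: le_trans (fe x); apply: le_trans (Re2_le_sqn _).
by rewrite Re_add Re_opp.
Qed.

Lemma Hap_ucb S f : Hap s S f -> ucb f.
Proof.
move=> Hf; split.
  have [r [c [_ _ fe]]] := Hap_near Hf ltr01.
  have [[[D HD] _] _] := @cucb_tp R d r c.
  exists (1 + D) => x; rewrite -[f x](subrK (complex.Re (tp r c x))).
  by apply: (le_trans (ler_normD _ _)); rewrite lerD.
move=> e e0; have e3 : 0 < e / 3 by rewrite divr_gt0.
have [r [c [_ _ fe]]] := Hap_near Hf e3.
have [[_ /(_ _ e3)[del d0 Hd]] _] := @cucb_tp R d r c.
exists del => // x y /Hd; have := fe x; have := fe y; rewrite !ler_norml.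
by move=> /andP[? ?] /andP[? ?] /andP[? ?]; apply/andP; split; lra.
Qed.

Lemma ek_periodic k (x : 'cV[R]_d) (z : 'cV[int]_d) : ek k (x + map_mx intr z) = ek k x.
Proof.
rewrite /ek; have -> : pairing k (x + map_mx intr z) =
    pairing k x + (\sum_i k i 0 * z i 0)%:~R.
  rewrite rmorph_sum /pairing -big_split; apply: eq_bigr => i _ /=.
  by rewrite !mxE mulrDr rmorphM.
exact: cexpDZ.
Qed.

Lemma tp_periodic r c : torus_periodic (@tp R d r c).
Proof. by move=> x z; apply: eq_bigr => k _; rewrite ek_periodic. Qed.

Lemma Hap_sup Z S f : (forall r : seq 'cV[int]_d, uniq r ->
    \sum_(k <- r) (kap k)%:R ^- (2 * s) <= Z) -> Hap s S f ->
  forall x, f x ^+ 2 <= 2 * Z * S.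
Proof.
move=> HZ Hf x; apply/ler_addgt0Pr => e e0.
have [r [c [ur cS fe]]] := Hf (e / 2) (divr_gt0 e0 (ltr0n _ 2)).
rewrite -sqnC -[(f x)%:C](subrK (tp r c x)).
apply: (le_trans (sqnD2 _ _)).
have h := sqn_sum_bound HZ (fun k => c k * ek k x) ur.
have h2 : Z * \sum_(k <- r) wgt s k * sqn (c k * ek k x) <= Z * S.
  rewrite ler_wpM2l ?(lattice_ge0 HZ) //; apply: le_trans cS.
  by apply: ler_sum => k _; rewrite sqnM sqn_ek mulr1.
by have := fe x; move: (le_trans h h2); rewrite -/(tp r c x) -mulrA; lra.
Qed.

End ApproxClass.

(** * Dyadic truncations and composition with smooth maps *)

Section Pairs.
Context {R : realType} {d : nat} (i : 'I_d).
Implicit Types (u v : 'cV[R]_d -> R) (C lam mu gam : R).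

Definition de u : 'cV[R]_d -> R := fun x => 'D_(evec i) u x.

(* u and v stand for two consecutive dyadic truncations of one function at frequency
   lam: m derivatives along e_i, each costing a factor lam in sup norm and in the L^2
   distance of u and v, where gam is the energy of the frequencies between the two
   truncations. The class is stable under products and smooth maps with a constant
   that depends on neither lam nor gam. *)
Fixpoint Pcl m C lam mu gam u v : Prop :=
  [/\ ucb u /\ ucb v, torus_periodic u /\ torus_periodic v,
      forall x, `|u x| <= C * mu /\ `|v x| <= C * mu &
      torus_int (fun x => (u x - v x) ^+ 2) <= C ^+ 2 * gam * mu ^+ 2] /\
  match m with
  | 0 => True
  | m'.+1 => [/\ forall x, derivable u x (evec i), forall x, derivable v x (evec i) &
      Pcl m' C lam (mu * lam) gam (de u) (de v)]
  end.

Lemma Pcl_base m C lam mu gam u v : Pcl m C lam mu gam u v ->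
  [/\ ucb u /\ ucb v, torus_periodic u /\ torus_periodic v,
      forall x, `|u x| <= C * mu /\ `|v x| <= C * mu &
      torus_int (fun x => (u x - v x) ^+ 2) <= C ^+ 2 * gam * mu ^+ 2].
Proof. by case: m => [|m] []. Qed.

Lemma Pcl_pred m C lam mu gam u v : Pcl m.+1 C lam mu gam u v -> Pcl m C lam mu gam u v.
Proof.
elim: m mu u v => [|m IH] mu u v; first by case.
by move=> [H [du dv /IH H']]; split.
Qed.

Lemma Pcl_mono m C C' lam mu gam u v : 0 <= C -> C <= C' -> 0 <= lam -> 0 <= mu ->
  0 <= gam -> Pcl m C lam mu gam u v -> Pcl m C' lam mu gam u v.
Proof.
move=> C0 CC l0 + g0; elim: m mu u v => [|m IH] mu u v m0.
all: move=> [[u1 u2 u3 u4] H]; split.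
1,3: split => // [x|].
1,3: by have [h1 h2] := u3 x; split; [apply: le_trans h1 _|apply: le_trans h2 _];
  rewrite ler_wpM2r.
1,2: apply: le_trans u4 _; rewrite ler_wpM2r ?sqr_ge0 // ler_wpM2r //.
1,2: by rewrite lerXn2r ?nnegrE // (le_trans C0).
by [].
by case: H => du dv H; split => //; apply: IH => //; rewrite mulr_ge0.
Qed.

Lemma torus_int_sqrD u v : ucb u -> ucb v ->
  torus_int (fun x => (u x + v x) ^+ 2) <=
  2 * torus_int (fun x => u x ^+ 2) + 2 * torus_int (fun x => v x ^+ 2).
Proof.
move=> uu uv; have u2 := ucbX2 uu; have v2 := ucbX2 uv.
rewrite -(torus_intZ 2 u2) -(torus_intZ 2 v2) -(torus_intD (ucbZ 2 u2) (ucbZ 2 v2)).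
apply: le_torus_int => [||x]; first exact/ucbX2/ucbD.
  by apply: ucbD; exact: ucbZ.
by have := sqr_ge0 (u x - v x); rewrite !expr2; lra.
Qed.

Lemma torus_int_sqrM u v K : ucb u -> ucb v -> 0 <= K -> (forall x, `|v x| <= K) ->
  torus_int (fun x => (u x * v x) ^+ 2) <= K ^+ 2 * torus_int (fun x => u x ^+ 2).
Proof.
move=> uu uv K0 vK; have u2 := ucbX2 uu.
rewrite -(torus_intZ _ u2); apply: le_torus_int => [||x]; first exact/ucbX2/ucbM.
  exact: ucbZ.
rewrite exprMn mulrC ler_wpM2r ?sqr_ge0 // -real_normK ?num_real //.
by rewrite lerXn2r ?nnegrE.
Qed.

Lemma Pcl0 m C lam mu gam : 0 <= C -> 0 <= lam -> 0 <= mu -> 0 <= gam ->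
  Pcl m C lam mu gam (fun=> 0) (fun=> 0).
Proof.
move=> C0 l0 + g0; elim: m mu => [|m IH] mu m0.
all: split; first (split; [split; exact: ucb_cst|by []|move=> x; rewrite normr0; split;
  exact: mulr_ge0|]).
1,3: under eq_fun do rewrite subrr expr0n; rewrite torus_int_cst.
1,2: by rewrite !mulr_ge0 ?sqr_ge0.
by [].
have -> : de (fun=> 0) = (fun=> 0).
  by apply/funext => x; exact: (@derive_cst _ _ R^o).
split; [| |by apply: IH; rewrite mulr_ge0].
all: by move=> x; exact: (@derivable_cst _ _ R^o).
Qed.

Lemma PclD m C1 C2 lam mu gam u1 v1 u2 v2 : 0 <= C1 -> 0 <= C2 -> 0 <= lam -> 0 <= mu ->
  0 <= gam -> Pcl m C1 lam mu gam u1 v1 -> Pcl m C2 lam mu gam u2 v2 ->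
  Pcl m (2 * (C1 + C2)) lam mu gam (fun x => u1 x + u2 x) (fun x => v1 x + v2 x).
Proof.
move=> C10 C20 l0 + g0; elim: m mu u1 v1 u2 v2 => [|m IH] mu u1 v1 u2 v2 m0.
all: move=> [[[uu1 uv1] [pu1 pv1] b1 d1] H1] [[[uu2 uv2] [pu2 pv2] b2 d2] H2]; split.
1,3: split; [split; exact: ucbD|by split=> x z; rewrite ?pu1 ?pu2 ?pv1 ?pv2| |].
1,3: move=> x; have [h1 h2] := b1 x; have [h3 h4] := b2 x.
1,2: have E : 2 * (C1 + C2) * mu = (C1 * mu + C2 * mu) + (C1 * mu + C2 * mu) by ring.
1,2: have p1 := mulr_ge0 C10 m0; have p2 := mulr_ge0 C20 m0.
1,2: split; apply: (le_trans (ler_normD _ _)); rewrite E; lra.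
1,2: under eq_fun do rewrite opprD addrACA.
1,2: apply: (le_trans (torus_int_sqrD (ucbB uu1 uv1) (ucbB uu2 uv2))).
1,2: have E : (2 * (C1 + C2)) ^+ 2 * gam * mu ^+ 2 = 4 * (C1 ^+ 2 * gam * mu ^+ 2)
  + 4 * (C2 ^+ 2 * gam * mu ^+ 2) + 8 * (C1 * C2 * gam * mu ^+ 2) by ring.
1,2: have p1 : 0 <= C1 ^+ 2 * gam * mu ^+ 2 by rewrite !mulr_ge0 ?sqr_ge0.
1,2: have p2 : 0 <= C2 ^+ 2 * gam * mu ^+ 2 by rewrite !mulr_ge0 ?sqr_ge0.
1,2: have p3 : 0 <= C1 * C2 * gam * mu ^+ 2 by rewrite !mulr_ge0 ?sqr_ge0.
1,2: rewrite E; move: d1 d2; lra.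
  by [].
case: H1 => du1 dv1 P1; case: H2 => du2 dv2 P2.
split; [by move=> x; exact: derivableD|by move=> x; exact: derivableD|].
have -> : de (fun x => u1 x + u2 x) = (fun x => de u1 x + de u2 x).
  by apply/funext => x; exact: deriveD.
have -> : de (fun x => v1 x + v2 x) = (fun x => de v1 x + de v2 x).
  by apply/funext => x; exact: deriveD.
by apply: IH => //; rewrite mulr_ge0.
Qed.

(** Leibniz rule: differentiating either factor multiplies its scale by [lam], so both terms of the
    derivative live at scale [mu1 * mu2 * lam] and induction on [m] applies. For distances, u1 u2 -
    v1 v2 = (u1 - v1) u2 + (u2 - v2) v1. *)
Lemma PclM m C1 C2 : 0 <= C1 -> 0 <= C2 -> exists2 C3, 0 <= C3 &
  forall lam mu1 mu2 gam u1 v1 u2 v2, 0 <= lam -> 0 <= mu1 -> 0 <= mu2 -> 0 <= gam ->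
  Pcl m C1 lam mu1 gam u1 v1 -> Pcl m C2 lam mu2 gam u2 v2 ->
  Pcl m C3 lam (mu1 * mu2) gam (fun x => u1 x * u2 x) (fun x => v1 x * v2 x).
Proof.
move=> C10 C20.
have base lam mu1 mu2 gam u1 v1 u2 v2 : 0 <= lam -> 0 <= mu1 -> 0 <= mu2 -> 0 <= gam ->
  Pcl 0 C1 lam mu1 gam u1 v1 -> Pcl 0 C2 lam mu2 gam u2 v2 ->
  Pcl 0 (2 * C1 * C2) lam (mu1 * mu2) gam (fun x => u1 x * u2 x) (fun x => v1 x * v2 x).
  move=> l0 m10 m20 g0 [[[uu1 uv1] [pu1 pv1] b1 d1] _] [[[uu2 uv2] [pu2 pv2] b2 d2] _].
  split => //; split; [split; exact: ucbM|by split=> x z; rewrite ?pu1 ?pu2 ?pv1 ?pv2| |].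
    move=> x; have [h1 h2] := b1 x; have [h3 h4] := b2 x.
    have E : 2 * C1 * C2 * (mu1 * mu2) = (C1 * mu1) * (C2 * mu2) + (C1 * mu1) * (C2 * mu2)
      by ring.
    have p : 0 <= (C1 * mu1) * (C2 * mu2) by rewrite !mulr_ge0.
    split; rewrite normrM E.
      by apply: (le_trans (ler_pM (normr_ge0 _) (normr_ge0 _) h1 h3)); rewrite lerDl.
    by apply: (le_trans (ler_pM (normr_ge0 _) (normr_ge0 _) h2 h4)); rewrite lerDl.
  have -> : (fun x => (u1 x * u2 x - v1 x * v2 x) ^+ 2) =
     (fun x => ((u1 x - v1 x) * u2 x + (u2 x - v2 x) * v1 x) ^+ 2).
    by apply/funext => x; congr (_ ^+ 2); ring.
  have uB1 := ucbB uu1 uv1; have uB2 := ucbB uu2 uv2.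
  apply: (le_trans (torus_int_sqrD (ucbM uB1 uu2) (ucbM uB2 uv1))).
  have k2 : 0 <= C2 * mu2 by rewrite mulr_ge0.
  have k1 : 0 <= C1 * mu1 by rewrite mulr_ge0.
  have h1 := torus_int_sqrM uB1 uu2 k2 (fun x => (b2 x).1).
  have h2 := torus_int_sqrM uB2 uv1 k1 (fun x => (b1 x).2).
  have h3 := ler_wpM2l (sqr_ge0 (C2 * mu2)) d1.
  have h4 := ler_wpM2l (sqr_ge0 (C1 * mu1)) d2.
  have E : (2 * C1 * C2) ^+ 2 * gam * (mu1 * mu2) ^+ 2 =
    2 * ((C2 * mu2) ^+ 2 * (C1 ^+ 2 * gam * mu1 ^+ 2)) +
    2 * ((C1 * mu1) ^+ 2 * (C2 ^+ 2 * gam * mu2 ^+ 2)) by ring.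
  rewrite E; have := le_trans h1 h3; have := le_trans h2 h4; lra.
elim: m => [|m [C3 C30 IH]].
  by exists (2 * C1 * C2) => [|*]; [rewrite !mulr_ge0|exact: base].
have C40 : 0 <= 2 * C1 * C2 + 2 * (C3 + C3) by rewrite addr_ge0 ?mulr_ge0 ?addr_ge0.
exists (2 * C1 * C2 + 2 * (C3 + C3)) => //.
move=> lam mu1 mu2 gam u1 v1 u2 v2 l0 m10 m20 g0 P1 P2.
have B := base lam mu1 mu2 gam u1 v1 u2 v2 l0 m10 m20 g0
  (conj (Pcl_base P1) I) (conj (Pcl_base P2) I).
have CC : 2 * C1 * C2 <= 2 * C1 * C2 + 2 * (C3 + C3) by rewrite lerDl mulr_ge0 ?addr_ge0.
have CC' : 2 * (C3 + C3) <= 2 * C1 * C2 + 2 * (C3 + C3) by rewrite lerDr !mulr_ge0.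
have C120 : 0 <= 2 * C1 * C2 by rewrite !mulr_ge0.
have [B' _] := Pcl_mono (m := 0) C120 CC l0 (mulr_ge0 m10 m20) g0 B.
split; first exact: B'.
have [_ [du1 dv1 D1]] := P1; have [_ [du2 dv2 D2]] := P2.
split; [by move=> x; exact: derivableM|by move=> x; exact: derivableM|].
have E (w1 w2 : 'cV[R]_d -> R) : (forall x, derivable w1 x (evec i)) -> (forall x, derivable w2 x (evec i)) ->
    de (fun x => w1 x * w2 x) = (fun x => w1 x * de w2 x + de w1 x * w2 x).
  move=> dw1 dw2; apply/funext => x; rewrite [LHS]deriveM //.
  by rewrite /GRing.scale /= [w2 x * _]mulrC.
rewrite !E //.
apply: Pcl_mono CC' _ _ _ _ => //; rewrite ?mulr_ge0 ?addr_ge0 //.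
apply: PclD => //; rewrite ?mulr_ge0 //.
  by rewrite -mulrA; apply: IH => //; [rewrite mulr_ge0|exact: Pcl_pred].
by rewrite mulrAC; apply: IH => //; [rewrite mulr_ge0|exact: Pcl_pred].
Qed.

Lemma Pcl_sum n m C : 0 <= C -> exists2 C', 0 <= C' &
  forall lam mu gam (u v : 'I_n -> 'cV[R]_d -> R), 0 <= lam -> 0 <= mu -> 0 <= gam ->
  (forall c, Pcl m C lam mu gam (u c) (v c)) ->
  Pcl m C' lam mu gam (fun x => \sum_c u c x) (fun x => \sum_c v c x).
Proof.
move=> C0; elim: n => [|n [C' C'0 IH]].
  exists 0 => // lam mu gam u v l0 m0 g0 _.
  have E (w : 'I_0 -> 'cV[R]_d -> R) : (fun x => \sum_c w c x) = (fun=> 0).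
    by apply/funext => x; rewrite big_ord0.
  by rewrite !E; exact: Pcl0.
exists (2 * (C + C')); first by rewrite mulr_ge0 // addr_ge0.
move=> lam mu gam u v l0 m0 g0 H.
have E (w : 'I_n.+1 -> 'cV[R]_d -> R) : (fun x => \sum_c w c x) =
    (fun x => w ord0 x + \sum_c w (lift ord0 c) x).
  by apply/funext => x; rewrite big_ord_recl.
rewrite !E; apply: PclD => //; exact: IH.
Qed.

Lemma pairing_evec (l : 'cV[int]_d) (h : R) (x : 'cV[R]_d) :
  pairing l (h *: evec i + x) = (l i 0)%:~R * h + pairing l x.
Proof.
rewrite /pairing (bigD1 i) //= [in RHS](bigD1 i) //= !mxE !eqxx mulr1 mulrDr addrA.
by congr (_ + _); apply: eq_bigr => j /negPf ji; rewrite !mxE ji mulr0 add0r.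
Qed.

Lemma is_derive_cos_pairing l th (x : 'cV[R]_d) :
  is_derive x (evec i) (fun x => cos (2 * pi * (pairing l x + th)))
    (- (2 * pi * (l i 0)%:~R * sin (2 * pi * (pairing l x + th)))).
Proof.
apply/is_derive_line0.
have := is_derive_cos_affine (2 * pi * (l i 0)%:~R) (2 * pi * (pairing l x + th)) 0.
rewrite mulr0 add0r.
set G := fun y => _; suff -> : (fun h : R => cos (2 * pi * (pairing l (h *: evec i + x) + th))) = G by [].
by apply/funext => h; rewrite /G pairing_evec; congr cos; ring.
Qed.

Lemma is_derive_sin_pairing l th (x : 'cV[R]_d) :
  is_derive x (evec i) (fun x => sin (2 * pi * (pairing l x + th)))
    (2 * pi * (l i 0)%:~R * cos (2 * pi * (pairing l x + th))).
Proof.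
apply/is_derive_line0.
have := is_derive_sin_affine (2 * pi * (l i 0)%:~R) (2 * pi * (pairing l x + th)) 0.
rewrite mulr0 add0r.
set G := fun y => _; suff -> : (fun h : R => sin (2 * pi * (pairing l (h *: evec i + x) + th))) = G by [].
by apply/funext => h; rewrite /G pairing_evec; congr sin; ring.
Qed.

Lemma ucb_sin (k : 'cV[int]_d) (th : R) :
  ucb (fun x : 'cV[R]_d => sin (2 * pi * (pairing k x + th))).
Proof.
have := ucb_cos k (th - 4^-1).
set G := fun y => _; suff -> : G = (fun x => sin (2 * pi * (pairing k x + th))) by [].
by apply/funext => x; rewrite /G -cosBpihalf; congr cos; field.
Qed.

Lemma torus_int_by_parts u w w' : ucb u -> torus_periodic u -> ucb (de u) ->
  (forall x, derivable u x (evec i)) -> ucb w -> ucb w' -> torus_periodic w ->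
  (forall x, is_derive x (evec i) w (w' x)) ->
  torus_int (fun x => de u x * w x) = - torus_int (fun x => u x * w' x).
Proof.
move=> uu pu ud du uw uw' pw dw.
have pe f : torus_periodic f -> forall x : 'cV[R]_d, f (evec i + x) = f x :> R.
  move=> pf x; rewrite addrC -[RHS](pf x (delta_mx i 0)); congr (f (_ + _)).
  by apply/colP => j; rewrite !mxE; case: (_ && _).
apply/eqP; rewrite -subr_eq0 opprK -torus_intD; [|exact: ucbM..].
apply/eqP; apply: (@torus_int_pder R d i (fun x => u x * w x)).
- exact: ucbM.
- by apply: ucbD; exact: ucbM.
- by move=> x; rewrite !pe.
move=> x; have du' := derivableP (du x).
have := @is_deriveM _ _ u w x (evec i) _ _ du' (dw x).
by rewrite /GRing.scale /= [w x * _]mulrC addrC.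
Qed.

(** Integration by parts exchanges the cosine and sine integrals up to sign and the factor 2 pi k_i;
    the squared modulus ignores the exchange. *)
Lemma sqn_fcoef_de u k : ucb u -> torus_periodic u -> ucb (de u) ->
  (forall x, derivable u x (evec i)) ->
  sqn (fcoef (fun x => (de u x)%:C%C) k) =
  (2 * pi * (k i 0)%:~R) ^+ 2 * sqn (fcoef (fun x => (u x)%:C%C) k).
Proof.
move=> uu pu ud du.
have E f : fcoef (fun x => (f x)%:C%C) k =
   Complex (torus_int (fun x => f x * cos (2 * pi * (pairing (- k) x + 0))))
           (torus_int (fun x => f x * sin (2 * pi * (pairing (- k) x + 0)))) :> R[i].
  rewrite /fcoef /torus_cint; congr Complex; congr torus_int; apply/funext => x.
    by rewrite /= mul0r subr0 addr0 pairingN.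
  by rewrite /= mul0r addr0 addr0 pairingN.
have pc (x : 'cV[R]_d) z : cexp (pairing (- k) (x + map_mx intr z)) = cexp (pairing (- k) x).
  exact: ek_periodic.
have uc := ucb_cos (- k) (0 : R); have us := ucb_sin (- k) (0 : R).
rewrite !E.
rewrite (torus_int_by_parts uu pu ud du uc _ _ (is_derive_cos_pairing (- k) 0)); first last.
- move=> x z; have := pc x z; rewrite /cexp !addr0 => -[]//.
- by apply: ucbN; exact: ucbZ.
rewrite (torus_int_by_parts uu pu ud du us _ _ (is_derive_sin_pairing (- k) 0)); first last.
- move=> x z; have := pc x z; rewrite /cexp !addr0 => -[]//.
- exact: ucbZ.
have -> : torus_int (fun x => u x * - (2 * pi * ((- k) i 0)%:~R * sin (2 * pi * (pairing (- k) x + 0)))) =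
   2 * pi * (k i 0)%:~R * torus_int (fun x => u x * sin (2 * pi * (pairing (- k) x + 0))).
  rewrite -torus_intZ; last exact: ucbM.
  by congr torus_int; apply/funext => x; rewrite mxE rmorphN /=; ring.
have -> : torus_int (fun x => u x * (2 * pi * ((- k) i 0)%:~R * cos (2 * pi * (pairing (- k) x + 0)))) =
   - (2 * pi * (k i 0)%:~R) * torus_int (fun x => u x * cos (2 * pi * (pairing (- k) x + 0))).
  rewrite -torus_intZ; last exact: ucbM.
  by congr torus_int; apply/funext => x; rewrite mxE rmorphN /=; ring.
by rewrite /sqn /=; ring.
Qed.

Lemma iter_de_Pcl m C lam mu gam u v : Pcl m C lam mu gam u v ->
  Pcl 0 C lam (mu * lam ^+ m) gam (iter m de u) (iter m de v) /\
  forall k, sqn (fcoef (fun x => (iter m de u x)%:C%C) k) =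
    (2 * pi * (k i 0)%:~R) ^+ (2 * m) * sqn (fcoef (fun x => (u x)%:C%C) k).
Proof.
elim: m mu u v => [|m IH] mu u v.
  by rewrite expr0 mulr1 => P; split=> // k; rewrite muln0 expr0 mul1r.
move=> P; have [[[uu uv] [pu pv] _ _] [du dv D]] := P.
have [Q F] := IH _ _ _ D; rewrite !iterSr exprS mulrA; split=> // k; rewrite F.
have [[ud _] _ _ _] := Pcl_base D.
by rewrite sqn_fcoef_de // mulrA -exprD mulnS addnC.
Qed.

End Pairs.

(** * Smooth maps applied to pairs of truncations *)

Section Composition.
Context {R : realType}.

Lemma box_bounded n (F : 'cV[R]_n -> R) (A : R) : continuous F ->
  exists2 C : R, 0 <= C & forall x : 'cV[R]_n, (forall i, `|x i 0| <= A) -> `|F x| <= C.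
Proof.
move=> cF.
pose K := [set v : 'rV[R]_n | forall i, `[- A, A]%classic (v ord0 i)].
have cK : compact K.
  by apply: (@rV_compact R n (fun=> `[- A, A]%classic)) => _; exact: segment_compact.
have cT : continuous (fun v : 'rV[R]_n => v^T : 'cV[R]_n).
  move=> v /= B /nbhs_ballP[e e0 eB]; apply/nbhs_ballP; exists e => // w [_ vw].
  by apply: eB; split => // i j; rewrite !mxE; exact: vw.
have cg : continuous (fun v : 'rV[R]_n => `|F v^T|).
  move=> v; apply: (@continuous_comp _ _ _ (fun v : 'rV[R]_n => F v^T) Num.norm).
    by apply: (@continuous_comp _ _ _ (fun v : 'rV[R]_n => v^T : 'cV[R]_n) F); [exact: cT|exact: cF].
  exact: norm_continuous.
have inK (x : 'cV[R]_n) : (forall i, `|x i 0| <= A) -> K x^T.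
  by move=> xA i; rewrite /= in_itv /= mxE -ler_norml.
case: (pselect (K !=set0)) => [K0|K0].
  have [c cKc Hc] := compact_EVT_max K0 cK (continuous_subspaceT cg).
  exists `|F c^T| => // x /inK Kx.
  by have := Hc x^T (mem_set Kx); rewrite trmxK.
by exists 0 => // x /inK Kx; case: K0; exists x^T.
Qed.

Lemma chain_curve n (F : 'cV[R]_n -> R) (U : R -> 'cV[R]_n) (t : R) :
  (forall x, differentiable F x) ->
  (forall c, derivable (fun h => U h c 0) t 1) ->
  is_derive t (1 : R) (fun h => F (U h))
    (\sum_c 'D_1 (fun h => U h c 0) t * 'D_(evec c) F (U t)).
Proof.
move=> dF dU.
have dU' : derivable U t 1.
  by apply/derivable_mxP => c j; rewrite (ord1 j).
have dfU : differentiable U t by exact/derivable1_diffP.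
have dFU : differentiable (F \o U) t by exact: differentiable_comp.
split; first exact/derivable1_diffP.
rewrite [LHS](deriveE (f := F \o U)) // diff_comp //= -[X in 'd F _ X](deriveE (f := U)) //.
have E : 'D_1 U t = \sum_c ('D_1 (fun h => U h c 0) t) *: evec c.
  apply/colP => i; rewrite derive_mx // mxE summxE (bigD1 i) //= big1 ?addr0.
    by rewrite !mxE !eqxx mulr1.
  by move=> c /negPf ci; rewrite !mxE eq_sym ci mulr0.
rewrite {1}E linear_sum; apply: eq_bigr => c _.
by rewrite linearZ /= -deriveE.
Qed.

Lemma smooth_comp_diff m n (f : 'cV[R]_m -> 'cV[R]_n) hs j : smooth f ->
  forall x, differentiable (fun x => iter_derive hs f x j 0) x.
Proof.
move=> sf x; have H := @differentiable_coord R n 1 (iter_derive hs f x) j 0.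
exact: (@differentiable_comp _ _ _ _ (iter_derive hs f) (fun N : 'cV[R]_n => N j 0)).
Qed.

Lemma derive_iter_derive m n (f : 'cV[R]_m -> 'cV[R]_n) hs j c x : smooth f ->
  'D_(evec c) (fun x => iter_derive hs f x j 0) x = iter_derive (evec c :: hs) f x j 0.
Proof. by move=> sf; rewrite /= derive_mx ?mxE //; exact: diff_derivable. Qed.

Lemma smooth_box_lip m n (f : 'cV[R]_m -> 'cV[R]_n) hs j (A : R) : smooth f -> exists2 L : R, 0 <= L &
  forall x y : 'cV[R]_m, (forall i, `|x i 0| <= A) -> (forall i, `|y i 0| <= A) ->
  `|iter_derive hs f x j 0 - iter_derive hs f y j 0| <= L * \sum_i `|x i 0 - y i 0|.
Proof.
move=> sf; pose F hs x := iter_derive hs f x j 0.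
have dF hs' x : differentiable (F hs') x by exact: smooth_comp_diff.
(* [MVT_any] places the intermediate parameter only in [-1, 1], so the point may lie on the
   extension of the segment beyond [y]; a cube of half-width 3A contains it. *)
have /fin_all_exists2[C C0 HC] (c : 'I_m) : exists2 C : R, 0 <= C & forall x : 'cV[R]_m,
    (forall i, `|x i 0| <= A + (A + A)) -> `|F (evec c :: hs) x| <= C.
  by apply: box_bounded => x; apply: differentiable_continuous.
exists (\sum_c C c) => [|x y xA yA]; first by rewrite sumr_ge0.
pose U (h : R) := y + h *: (x - y).
have dUc c h : is_derive h (1 : R) (fun h => U h c 0) (x c 0 - y c 0).
  have -> : (fun h => U h c 0) = (fun h : R => (x c 0 - y c 0) *: h + y c 0).
    by apply/funext => h'; rewrite /U !mxE addrC mulrC.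
  by apply: is_derive_eq; rewrite addr0 /GRing.scale /= mulr1.
have dFU h := chain_curve (U := U) (t := h) (dF hs)
  (fun c => let: DeriveDef d _ := dUc c h in d).
have [c] := MVT_any 0 1 dFU.
rewrite subr0 normr1 add0r mulr1 => c1 E.
have U1 : U 1 = x by rewrite /U scale1r addrC subrK.
have U0 : U 0 = y by rewrite /U scale0r addr0.
rewrite -/(F hs x) -/(F hs y) -U1 -U0 E U1 U0.
apply: (le_trans (ler_norm_sum _ _ _)); rewrite mulr_sumr; apply: ler_sum => i _.
have [_ ->] := dUc i c; rewrite normrM mulrC; apply: ler_wpM2r => //.
rewrite derive_iter_derive //.
apply: (@le_trans _ _ (C i)); last by rewrite (bigD1 i) //= lerDl sumr_ge0.
apply: HC => l; rewrite /U !mxE; apply: (le_trans (ler_normD _ _)); rewrite lerD //.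
rewrite normrM -[leRHS]mul1r ler_pM //.
by apply: (le_trans (ler_normB _ _)); rewrite lerD.
Qed.

Lemma sqr_sum_card n (a : 'I_n -> R) : (\sum_c a c) ^+ 2 <= n%:R * \sum_c a c ^+ 2.
Proof.
have := @sqr_sum_le R _ (index_enum 'I_n) xpredT (fun=> 1) a (fun=> ltr01).
rewrite sumr_const card_ord; by under [X in _ * X]eq_bigr do rewrite divr1.
Qed.

Context {d : nat} (i : 'I_d).

(** The induction runs over all iterated derivatives [hs] of [f] at once: by the chain rule the
    derivative of the composition is a sum of products of a further derivative of [f] at the
    argument, at scale 1, with a derivative of the argument, at scale [lam]. The case m = 0 uses
    boundedness and the Lipschitz property of [f] on the cube containing the arguments. *)
Lemma Pcl_comp m n q (f : 'cV[R]_n -> 'cV[R]_q) hs j A : smooth f -> 0 <= A ->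
  exists2 C, 0 <= C & forall lam gam (u v : 'I_n -> 'cV[R]_d -> R), 0 <= lam -> 0 <= gam ->
  (forall c, Pcl i m A lam 1 gam (u c) (v c)) ->
  Pcl i m C lam 1 gam (fun x => iter_derive hs f (\col_c u c x) j 0)
                      (fun x => iter_derive hs f (\col_c v c x) j 0).
Proof.
move=> sf A0; pose F hs x := iter_derive hs f x j 0.
have dF hs' x : differentiable (F hs') x by exact: smooth_comp_diff.
have base hs' : exists2 C, 0 <= C & forall lam gam (u v : 'I_n -> 'cV[R]_d -> R),
  0 <= lam -> 0 <= gam -> (forall c, Pcl i 0 A lam 1 gam (u c) (v c)) ->
  Pcl i 0 C lam 1 gam (fun x => F hs' (\col_c u c x)) (fun x => F hs' (\col_c v c x)).
  have [C0 C00 HC0] : exists2 C : R, 0 <= C & forall x : 'cV[R]_n,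
    (forall i, `|x i 0| <= A) -> `|F hs' x| <= C.
    by apply: box_bounded => x; apply: differentiable_continuous.
  have [L L0 HL] := smooth_box_lip hs' j A sf.
  exists (C0 + L * n%:R * A) => [|lam gam u v l0 g0 H]; first by rewrite addr_ge0 ?mulr_ge0.
  have ub c x : `|u c x| <= A by have [[_ _ /(_ x)[]]] := H c; rewrite mulr1.
  have vb c x : `|v c x| <= A by have [[_ _ /(_ x)[]]] := H c; rewrite mulr1.
  have uu c : ucb (u c) by have [[[]]] := H c.
  have uv c : ucb (v c) by have [[[]]] := H c.
  have up c : torus_periodic (u c) by have [[_ []]] := H c.
  have vp c : torus_periodic (v c) by have [[_ []]] := H c.
  have uF : ucb (fun x => F hs' (\col_c u c x)) by exact: (ucb_lip L0 HL).
  have vF : ucb (fun x => F hs' (\col_c v c x)) by exact: (ucb_lip L0 HL).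
  have LA : 0 <= L * n%:R * A by rewrite !mulr_ge0.
  split => //; split => //.
  - by split => x z; congr F; apply/colP => c; rewrite !mxE ?up ?vp.
  - move=> x; rewrite mulr1; split; apply: (@le_trans _ _ C0); rewrite ?lerDl //;
      by apply: HC0 => c; rewrite mxE.
  have ud c : ucb (fun x => (u c x - v c x) ^+ 2) by apply: ucbX2; exact: ucbB.
  have uS := ucb_sum (index_enum 'I_n) ud.
  apply: (@le_trans _ _ (torus_int (fun x => L ^+ 2 * n%:R * \sum_c (u c x - v c x) ^+ 2))).
    apply: le_torus_int => [||x]; [by apply: ucbX2; exact: ucbB|exact: ucbZ|].
    have h := HL (\col_c u c x) (\col_c v c x) (fun c => ltac:(by rewrite mxE))
      (fun c => ltac:(by rewrite mxE)).
    rewrite -real_normK ?num_real //.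
    apply: (@le_trans _ _ ((L * \sum_c `|u c x - v c x|) ^+ 2)).
      rewrite lerXn2r ?nnegrE ?mulr_ge0 ?sumr_ge0 //.
      by apply: (le_trans h); rewrite ler_wpM2l // ler_sum // => c _; rewrite !mxE.
    rewrite exprMn -mulrA ler_wpM2l ?sqr_ge0 //.
    apply: (le_trans (sqr_sum_card _)); rewrite ler_wpM2l // ler_sum // => c _.
    by rewrite real_normK ?num_real.
  rewrite (torus_intZ _ uS) (torus_int_sum _ ud) expr1n mulr1.
  apply: (@le_trans _ _ (L ^+ 2 * n%:R * \sum_(c < n) A ^+ 2 * gam)).
    rewrite ler_wpM2l ?mulr_ge0 ?sqr_ge0 // ler_sum // => c _.
    by have [[_ _ _]] := H c; rewrite expr1n mulr1.
  rewrite sumr_const card_ord -[(A ^+ 2 * gam) *+ n]mulr_natl.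
  have -> : L ^+ 2 * n%:R * (n%:R * (A ^+ 2 * gam)) = (L * n%:R * A) ^+ 2 * gam by ring.
  by rewrite ler_wpM2r // lerXn2r ?nnegrE ?addr_ge0 // lerDr.
elim: m hs => [|m IH] hs; first exact: base.
have [C1 C10 H1] := base hs.
have /fin_all_exists2[C2 C20 H2] (c : 'I_n) := IH (evec c :: hs).
pose C2' := \sum_c C2 c.
have C2'0 : 0 <= C2' by exact: sumr_ge0.
have C2le c : C2 c <= C2' by rewrite /C2' (bigD1 c) //= lerDl sumr_ge0.
have [C3 C30 H3] := @PclM R d i m C2' A C2'0 A0.
have [C4 C40 H4] := @Pcl_sum R d i n m C3 C30.
exists (C1 + C4) => [|lam gam u v l0 g0 H]; first by rewrite addr_ge0.
have P0 c : Pcl i 0 A lam 1 gam (u c) (v c) by split => //; exact: Pcl_base (H c).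
have Pm c : Pcl i m A lam 1 gam (u c) (v c) by exact: Pcl_pred.
have B := H1 lam gam u v l0 g0 P0.
have CC : C1 <= C1 + C4 by rewrite lerDl.
have [B' _] := Pcl_mono (m := 0) C10 CC l0 ler01 g0 B.
have D (w : 'I_n -> 'cV[R]_d -> R) : (forall c x, derivable (w c) x (evec i)) ->
    forall x, is_derive x (evec i) (fun x => F hs (\col_c w c x))
      (\sum_c F (evec c :: hs) (\col_c w c x) * de i (w c) x).
  move=> dw x; apply/is_derive_line0.
  have dl c : is_derive (0 : R) (1 : R) (fun h : R => (\col_c w c (h *: evec i + x)) c 0) (de i (w c) x).
    have -> : (fun h : R => (\col_c w c (h *: evec i + x)) c 0) = (fun h : R => w c (h *: evec i + x)).
      by apply/funext => h; rewrite mxE.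
    by apply: (is_derive_line0 (w c) _ _ _).1; exact: derivableP.
  have := chain_curve (U := fun h : R => \col_c w c (h *: evec i + x)) (t := 0) (dF hs)
    (fun c => let: DeriveDef d _ := dl c in d).
  rewrite scale0r add0r; set S1 := \sum_c _.
  suff -> : S1 = \sum_c F (evec c :: hs) (\col_c w c x) * de i (w c) x by [].
  apply: eq_bigr => c _; case: (dl c) => _ ->.
  by rewrite derive_iter_derive // mulrC.
have du c x : derivable (u c) x (evec i) by case: (H c) => _ [].
have dv c x : derivable (v c) x (evec i) by case: (H c) => _ [].
split; first exact: B'.
split; [by move=> x; case: (D u du x)|by move=> x; case: (D v dv x)|].
have -> : de i (fun x => iter_derive hs f (\col_c u c x) j 0) =
   (fun x => \sum_c F (evec c :: hs) (\col_c u c x) * de i (u c) x).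
  by apply/funext => x; case: (D u du x).
have -> : de i (fun x => iter_derive hs f (\col_c v c x) j 0) =
   (fun x => \sum_c F (evec c :: hs) (\col_c v c x) * de i (v c) x).
  by apply/funext => x; case: (D v dv x).
apply: (@Pcl_mono R d i m C4) => //; rewrite ?mulr_ge0 ?lerDr //.
apply: H4 => //; first by rewrite mulr_ge0.
move=> c; apply: H3 => //.
  by apply: (@Pcl_mono R d i m (C2 c)) => //; exact: H2.
by rewrite -[lam in Pcl _ _ _ _ lam]mul1r; case: (H c) => _ [].
Qed.

End Composition.

(** * Summation over dyadic scales and Sobolev bounds for compositions *)

Section CompositionSobolev.
Context {R : realType} {d : nat} (s : nat).
Hypothesis s0 : (0 < s)%N.
Local Notation C := R[i].
Local Open Scope complex_scope.
Local Notation w J := ((2 ^ J)%N%:R : R).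

Lemma norm_intr_absz (z : int) : `|z%:~R| = `|z|%N%:R :> R.
Proof. by rewrite natr_absz intr_norm. Qed.

(** Trades the weight q^(2s) for a sum over scales 2^J <= q, so that only unweighted tails of the
    composition need bounds. *)
Lemma dyadic_upper N q : (q < 2 ^ N)%N ->
  q%:R ^+ (2 * s) <= 2 ^+ (2 * s) * \sum_(J < N | (2 ^ J <= q)%N) w J ^+ (2 * s).
Proof.
move=> qN.
have S0 : 0 <= \sum_(J < N | (2 ^ J <= q)%N) w J ^+ (2 * s).
  by apply: sumr_ge0 => J _; rewrite exprn_ge0.
have [->|q0] := posnP q.
  by rewrite expr0n muln_eq0 /= eqn0Ngt s0 mulr_ge0 ?exprn_ge0 ?sumr_ge0 // => J _;
    rewrite exprn_ge0.
have JN : (trunc_log 2 q < N)%N.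
  by rewrite -(ltn_exp2l _ _ (isT : (1 < 2)%N)) (leq_ltn_trans _ qN) // trunc_logP.
apply: (@le_trans _ _ (2 ^+ (2 * s) * w (trunc_log 2 q) ^+ (2 * s))).
  rewrite -exprMn -natrM lerXn2r ?nnegrE ?ler0n ?ler_nat // -expnS ltnW //.
  exact: trunc_log_ltn.
rewrite ler_wpM2l ?exprn_ge0 // (bigD1 (Ordinal JN)) /= ?trunc_logP // lerDl.
by apply: sumr_ge0 => J _; rewrite exprn_ge0.
Qed.

Lemma dyadic_geom N : \sum_(J < N.+1) w J ^+ (2 * s) <= 2 * w N ^+ (2 * s).
Proof.
elim: N => [|N IH]; first by rewrite big_ord1 expr1n; lra.
rewrite big_ord_recr /= (le_trans (lerD IH (lexx _))) //.
have h : 2 * w N ^+ (2 * s) <= w N.+1 ^+ (2 * s).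
  rewrite expnS natrM exprMn ler_wpM2r ?exprn_ge0 //.
  by rewrite -[leLHS]expr1 ler_eXn2l ?ltr1n // muln_gt0.
by move: h; lra.
Qed.

(** The converse trade: summing over scales the weighted tails of the argument gives back its
    weighted energy. *)
Lemma dyadic_lower N q :
  \sum_(J < N | (2 ^ J < q)%N) w J ^+ (2 * s) <= 2 * q%:R ^+ (2 * s).
Proof.
elim: N => [|N IH]; first by rewrite big_ord0 mulr_ge0 ?exprn_ge0.
case: (ltnP (2 ^ N) q) => h; last first.
  by rewrite big_mkcond big_ord_recr /= ltnNge h addr0 -big_mkcond.
apply: le_trans (_ : 2 * w N ^+ (2 * s) <= _); last first.
  by rewrite ler_wpM2l // lerXn2r ?nnegrE ?ler0n ?ler_nat // ltnW.
apply: le_trans (dyadic_geom N); rewrite big_mkcond; apply: ler_sum => J _.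
by case: ifP => // _; rewrite exprn_ge0.
Qed.

Variable Z : R.
Hypothesis HZ : forall r : seq 'cV[int]_d, uniq r ->
  \sum_(k <- r) (kap k)%:R ^- (2 * s) <= Z.

Section Direction.
Variable i : 'I_d.

Definition dmult (c : 'cV[int]_d -> C) (k : 'cV[int]_d) : C :=
  Complex 0 (2 * pi * (k i 0)%:~R) * c k.

Lemma is_derive_Re_tp r c (x : 'cV[R]_d) :
  is_derive x (evec i) (fun x => complex.Re (tp r c x)) (complex.Re (tp r (dmult c) x)).
Proof.
elim: r => [|k r IH].
  have -> : (fun x => complex.Re (tp [::] c x)) = cst (0 : R).
    by apply/funext => y; rewrite /tp big_nil.
  rewrite /tp big_nil; exact: is_derive_cst.
have -> : (fun x => complex.Re (tp (k :: r) c x)) =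
  (fun x => (complex.Re (c k) * cos (2 * pi * (pairing k x + 0))
     + (- complex.Im (c k)) * sin (2 * pi * (pairing k x + 0))) + complex.Re (tp r c x)).
  by apply/funext => y; rewrite /tp big_cons Re_add Re_mul /= addr0 mulNr.
have H1 := is_derive_cos_pairing i k 0 x; have H2 := is_derive_sin_pairing i k 0 x.
have H1' := @is_deriveZ _ _ R^o _ (complex.Re (c k)) x (evec i) _ H1.
have H2' := @is_deriveZ _ _ R^o _ (- complex.Im (c k)) x (evec i) _ H2.
have H := is_deriveD (is_deriveD H1' H2') IH.
apply: (@is_derive_eq _ _ _ _ _ _ _ _ H).
rewrite /tp big_cons Re_add; congr (_ + _).
rewrite /dmult Re_mul /GRing.scale /= !addr0; case: (c k) => a b /=; ring.
Qed.

(** The sharp truncation at frequency [Lam], made real. It is applied only to polynomials, so no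
    convergence question arises. *)
Definition rt r c (Lam : nat) (x : 'cV[R]_d) : R :=
  complex.Re (tp [seq l <- r | (kap l <= Lam)%N] c x).

Lemma de_rt r c Lam : de i (rt r c Lam) = rt r (dmult c) Lam.
Proof. by apply/funext => x; have [] := is_derive_Re_tp [seq l <- r | (kap l <= Lam)%N] c x. Qed.

Lemma sqr_Re_tp_le r c (x : 'cV[R]_d) : uniq r ->
  complex.Re (tp r c x) ^+ 2 <= Z * \sum_(k <- r) wgt s k * sqn (c k).
Proof.
move=> ur; apply: (le_trans (Re2_le_sqn _)).
have h := sqn_sum_bound HZ (fun k => c k * ek k x) ur.
apply: (le_trans h); by under eq_bigr do rewrite sqnM sqn_ek mulr1.
Qed.

Lemma torus_int_Re_tp r c : uniq r ->
  torus_int (fun x : 'cV[R]_d => complex.Re (tp r c x) ^+ 2) <= \sum_(k <- r) sqn (c k).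
Proof.
move=> ur; rewrite -torus_parseval //; have [u1 _] := @cucb_tp R d r c.
apply: le_torus_int => [||x]; [exact: ucbX2|exact/ucb_sqn/cucb_tp|exact: Re2_le_sqn].
Qed.

Lemma tp_cond r (P Q : pred 'cV[int]_d) c (x : 'cV[R]_d) : (forall l, P l -> Q l) ->
  tp [seq l <- r | Q l] c x = tp [seq l <- r | P l] c x + tp [seq l <- r | Q l && ~~ P l] c x.
Proof.
move=> PQ; rewrite /tp !big_filter (bigID P) /=; congr (_ + _).
apply: eq_bigl => l; case Pl : (P l); last by rewrite andbF.
by rewrite (PQ l) ?Pl.
Qed.

Lemma rt_bound r c Lam Lam' B : uniq r -> (Lam <= Lam')%N -> 0 <= B ->
  Z * (\sum_(l <- r | (kap l <= Lam')%N) wgt s l * sqn (c l)) <= B ^+ 2 ->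
  forall x, `|rt r c Lam x| <= B.
Proof.
move=> ur LL B0 H x; rewrite -(@ler_pXn2r _ 2) ?nnegrE ?normr_ge0 //.
rewrite real_normK ?num_real //; apply: le_trans H.
apply: (le_trans (sqr_Re_tp_le _ _ _)); first exact: filter_uniq.
rewrite ler_wpM2l ?(lattice_ge0 HZ) // big_filter big_mkcond [leRHS]big_mkcond /=.
apply: ler_sum => l _; have h : 0 <= wgt s l * sqn (c l).
  by rewrite mulr_ge0 ?sqn_ge0 // ltW // wgt_gt0.
by case: ifP => h1; case: ifP => h2 //; rewrite (leq_trans h1 LL) in h2.
Qed.

Lemma ucb_rt r c Lam : ucb (rt r c Lam).
Proof. by have [] := @cucb_tp R d [seq l <- r | (kap l <= Lam)%N] c. Qed.

Lemma rt_periodic r c Lam : torus_periodic (rt r c Lam).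
Proof. by move=> x z; rewrite /rt tp_periodic. Qed.

Lemma Pcl_tp0 r c Lam A mu gam : uniq r -> 0 <= A -> 0 <= mu -> 0 <= gam ->
  Z * (\sum_(l <- r | (kap l <= 2 * Lam)%N) wgt s l * sqn (c l)) <= (A * mu) ^+ 2 ->
  \sum_(l <- r | (kap l <= 2 * Lam)%N && ~~ (kap l <= Lam)%N) sqn (c l)
    <= A ^+ 2 * gam * mu ^+ 2 ->
  Pcl i 0 A Lam%:R mu gam (rt r c Lam) (rt r c (2 * Lam)).
Proof.
move=> ur A0 mu0 g0 H1 H2; have AM := mulr_ge0 A0 mu0.
have L2 : (Lam <= 2 * Lam)%N by rewrite leq_pmull.
split => //; split; [by split; exact: ucb_rt|by split; exact: rt_periodic|..].
  by move=> x; split; apply: (rt_bound ur _ AM H1).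
apply: le_trans H2; rewrite -big_filter.
apply: le_trans (torus_int_Re_tp _ (filter_uniq _ ur)).
apply: le_torus_int => [||x]; first by apply: ucbX2; apply: ucbB; exact: ucb_rt.
  by apply: ucbX2; have [] := @cucb_tp R d
    [seq l <- r | (kap l <= 2 * Lam)%N && ~~ (kap l <= Lam)%N] c.
rewrite /rt (@tp_cond r (fun l => (kap l <= Lam)%N) (fun l => (kap l <= 2 * Lam)%N)) => [|l h].
  by rewrite Re_add opprD addrA subrr add0r sqrrN.
exact: leq_trans L2.
Qed.

(** A derivative acts on the coefficients by [dmult]. On frequencies up to [2 * Lam] it costs at
    most 2 pi (2 Lam) = 4 pi Lam: the factor [4 * pi] goes into the constant and [Lam] into the
    scale. *)
Lemma Pcl_tp m r c Lam A mu gam : uniq r -> 0 <= A -> 0 <= mu -> 0 <= gam ->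
  Z * (\sum_(l <- r | (kap l <= 2 * Lam)%N) wgt s l * sqn (c l)) <= (A * mu) ^+ 2 ->
  \sum_(l <- r | (kap l <= 2 * Lam)%N && ~~ (kap l <= Lam)%N) sqn (c l)
    <= A ^+ 2 * gam * mu ^+ 2 ->
  Pcl i m (A * (4 * pi) ^+ m) Lam%:R mu gam (rt r c Lam) (rt r c (2 * Lam)).
Proof.
move=> ur + + g0; elim: m A mu c => [|m IH] A mu c A0 mu0 H1 H2.
  by rewrite expr0 mulr1; exact: Pcl_tp0.
have pi1 : 1 <= 4 * pi :> R by have := pi_ge2 R; lra.
have base := Pcl_tp0 ur A0 mu0 g0 H1 H2.
have AA : A <= A * (4 * pi) ^+ m.+1 by rewrite ler_peMr // exprn_ege1.
split; first by have [] := Pcl_mono A0 AA (ler0n _ _) mu0 g0 base.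
split; [by move=> x; case: (is_derive_Re_tp [seq l <- r | (kap l <= Lam)%N] c x)
       |by move=> x; case: (is_derive_Re_tp [seq l <- r | (kap l <= 2 * Lam)%N] c x)|].
have dm l : (kap l <= 2 * Lam)%N -> sqn (dmult c l) <= (4 * pi * Lam%:R) ^+ 2 * sqn (c l).
  move=> lL; rewrite /dmult sqnM ler_wpM2r ?sqn_ge0 //.
  rewrite /sqn /= expr0n add0r -(@real_normK _ (2 * pi * _)) ?num_real //.
  rewrite lerXn2r ?nnegrE ?mulr_ge0 ?pi_ge0 // normrM (ger0_norm (_ : 0 <= 2 * pi)) ?mulr_ge0 ?pi_ge0 //.
  have -> : 4 * pi * Lam%:R = (2 * pi) * (2 * Lam)%N%:R :> R by rewrite natrM; ring.
  rewrite ler_wpM2l ?mulr_ge0 ?pi_ge0 // norm_intr_absz ler_nat.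
  exact: leq_trans (leq_kap l i) lL.
rewrite !de_rt exprS mulrA; apply: IH; rewrite ?mulr_ge0 ?pi_ge0 //.
  have -> : (A * (4 * pi) * (mu * Lam%:R)) ^+ 2 = (4 * pi * Lam%:R) ^+ 2 * (A * mu) ^+ 2 by ring.
  have k0 : 0 <= (4 * pi * Lam%:R : R) ^+ 2 by exact: sqr_ge0.
  apply: le_trans (ler_wpM2l k0 H1); rewrite mulrCA ler_wpM2l ?(lattice_ge0 HZ) //.
  rewrite mulr_sumr; apply: ler_sum => l lL; rewrite mulrCA ler_wpM2l ?dm //.
  by rewrite ltW // wgt_gt0.
have -> : (A * (4 * pi)) ^+ 2 * gam * (mu * Lam%:R) ^+ 2 =
   (4 * pi * Lam%:R) ^+ 2 * (A ^+ 2 * gam * mu ^+ 2) by ring.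
have k0 : 0 <= (4 * pi * Lam%:R : R) ^+ 2 by exact: sqr_ge0.
apply: le_trans (ler_wpM2l k0 H2); rewrite mulr_sumr; apply: ler_sum => l /andP[lL _].
exact: dm.
Qed.

(* Let G_J be f applied to the truncations at frequency 2^J, with m = s + 1. Splitting
   G = (G - G_J) + G_J, the part of frequency at least 2^J is bounded in L^2 by the tail
   gam J of the argument (f is Lipschitz) plus 4^(-Jm) X J, where X J is the energy of
   the m-th derivative of G_J. The Pcl estimate gives X (J+1) <= 2 X J + C 4^(Jm) gam J,
   so Y J = X J / 4^J contracts by 1/2 and is summable. This replaces the Moser
   estimate for compositions. *)
Lemma comp_dir_bound n q (f : 'cV[R]_n -> 'cV[R]_q) j L S : smooth f -> 0 <= L ->
  (forall x y, `|f x j 0 - f y j 0| <= L * \sum_c `|x c 0 - y c 0|) -> 0 <= S ->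
  exists2 B, 0 <= B & forall (r : 'I_n -> seq 'cV[int]_d) (c : 'I_n -> 'cV[int]_d -> C),
  (forall a, uniq (r a)) ->
  (forall a, \sum_(k <- r a) wgt s k * sqn (c a k) <= S) ->
  let G x := f (\col_a complex.Re (tp (r a) (c a) x)) j 0 in
  forall r0 : seq 'cV[int]_d, uniq r0 ->
  \sum_(k <- r0) (`|k i 0%R|%N)%:R ^+ (2 * s) * sqn (fcoef (fun x => (G x)%:C) k) <= B.
Proof.
move=> sf L0 fL S0; have Z0 := lattice_ge0 HZ.
(* As [Z * S <= A0 ^+ 2], [A0] bounds the truncations in sup norm; as [1 <= A0], its square may be
   put in front of [gam J]. *)
pose A0 : R := 1 + Z * S; have ZS0 : 0 <= Z * S by rewrite mulr_ge0.
have A00 : 0 <= A0 by rewrite addr_ge0.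
have A01 : 1 <= A0 by rewrite lerDl.
have A0Z : Z * S <= A0 ^+ 2 by rewrite /A0 expr2; nra.
pose m := s.+1; pose A := A0 * (4 * pi) ^+ m.
have pi40 : 0 <= 4 * pi :> R by rewrite mulr_ge0 // pi_ge0.
have A_0 : 0 <= A by rewrite mulr_ge0 // exprn_ge0.
have [K K0 HK] := @Pcl_comp R d i m n q f [::] j A sf A_0.
(* The two summands are the bounds [TN] and [YN] on the sums of [T J] and [Y J], with the
   coefficients these carry once [EJ] is multiplied by the weight of the scale. *)
pose B0 := 2 * (L ^+ 2 * n%:R) * (n%:R * (2 * S)) + 2 * (2 * K ^+ 2 + K ^+ 2 * (n%:R * (2 * S))).
exists (2 ^+ (2 * s) * B0) => [|r c ur cS G r0 ur0].
  have q1 : 0 <= n%:R * (2 * S) by rewrite !mulr_ge0.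
  have q2 : 0 <= L ^+ 2 * n%:R by rewrite mulr_ge0 ?sqr_ge0.
  have q3 := sqr_ge0 K; rewrite mulr_ge0 ?exprn_ge0 // /B0.
  by have := mulr_ge0 q2 q1; have := mulr_ge0 q3 q1; lra.
pose gam J := \sum_a \sum_(l <- r a | (2 ^ J < kap l)%N) sqn (c a l).
have gam0 J : 0 <= gam J.
  by apply: sumr_ge0 => a _; apply: sumr_ge0 => l _; exact: sqn_ge0.
pose GJ J x := f (\col_a rt (r a) (c a) (2 ^ J) x) j 0.
have PJ J : Pcl i m K (w J) 1 (gam J) (GJ J) (GJ J.+1).
  apply: HK => // a; rewrite expnS; apply: Pcl_tp => //.
    rewrite mulr1; apply: le_trans A0Z; rewrite ler_wpM2l //.
    by apply: le_trans (cS a); exact: sum_wgt_filter.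
  rewrite expr1n mulr1.
  apply: (@le_trans _ _ (gam J)); last by rewrite ler_peMl // exprn_ege1.
  rewrite /gam (bigD1 a) //= -[leLHS]addr0 lerD //; last first.
    by apply: sumr_ge0 => b _; apply: sumr_ge0 => l _; exact: sqn_ge0.
  rewrite big_mkcond [leRHS]big_mkcond; apply: ler_sum => l _; rewrite -ltnNge.
  by case: (2 ^ J < _)%N; rewrite ?andbF // andbT; case: ifP => // _; exact: sqn_ge0.
pose D J := iter m (de i) (GJ J).
have DJ J := iter_de_Pcl (PJ J).
pose X J := torus_int (fun x => D J x ^+ 2).
have uD J : ucb (D J) by have [[[[u _] _ _ _] _] _] := DJ J.
have X0 J : 0 <= X J.
  by apply: torus_int_ge0 => [|x]; [exact: ucbX2|exact: sqr_ge0].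
have X1 : X 0%N <= K ^+ 2.
  have [[[_ _ h _] _] _] := DJ 0%N.
  rewrite -[leRHS](@torus_int_cst R d); apply: le_torus_int => [||x]; [exact: ucbX2|exact: ucb_cst|].
  have [+ _] := h x; rewrite expn0 expr1n !mulr1 => hx.
  by rewrite -real_normK ?num_real // lerXn2r ?nnegrE.
have XS J : X J.+1 <= 2 * X J + 2 * (K ^+ 2 * gam J * w J ^+ (2 * m)).
  have [[[_ _ _ h] _] _] := DJ J.
  have {h} : torus_int (fun x => (D J x - D J.+1 x) ^+ 2) <= K ^+ 2 * gam J * w J ^+ (2 * m).
    by apply: (le_trans h); rewrite mul1r -exprM mulnC.
  have := torus_int_sqrD (uD J) (ucbN (ucbB (uD J) (uD J.+1))).
  have -> : (fun x => (D J x + - (D J x - D J.+1 x)) ^+ 2) = (fun x => D J.+1 x ^+ 2).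
    by apply/funext => x; congr (_ ^+ 2); ring.
  have -> : (fun x => (- (D J x - D J.+1 x)) ^+ 2) = (fun x => (D J x - D J.+1 x) ^+ 2).
    by apply/funext => x; rewrite sqrrN.
  by rewrite -/(X J) -/(X J.+1); lra.
pose Y J := X J / w J ^+ 2; pose T J := w J ^+ (2 * s) * gam J.
have w0 J : 0 < w J by rewrite ltr0n expn_gt0.
have Y0 J : 0 <= Y J by rewrite divr_ge0 // exprn_ge0.
have T0 J : 0 <= T J by rewrite mulr_ge0 // exprn_ge0.
have YS J : Y J.+1 <= Y J / 2 + K ^+ 2 / 2 * T J.
  rewrite /Y ler_pdivrMr ?exprn_gt0 //; apply: (le_trans (XS J)).
  rewrite /T /m mulnS exprD expnS natrM.
  have wn : w J != 0 by rewrite gt_eqF.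
  rewrite le_eqVlt; apply/orP; left; apply/eqP; field.
  exact: wn.
have TN N : \sum_(J < N) T J <= n%:R * (2 * S).
  rewrite /T /gam.
  apply: (@le_trans _ _ (\sum_(a < n) 2 * S)); last first.
    by rewrite sumr_const card_ord -[_ *+ n]mulr_natl.
  under eq_bigr do rewrite mulr_sumr.
  rewrite exchange_big /=; apply: ler_sum => a _.
  under eq_bigr do rewrite mulr_sumr.
  rewrite (exchange_big_dep xpredT) //=.
  apply: le_trans (ler_wpM2l (ler0n _ 2) (cS a)); rewrite mulr_sumr; apply: ler_sum => l _.
  rewrite -mulr_suml mulrA ler_wpM2r ?sqn_ge0 //; exact: dyadic_lower.
have YN N : \sum_(J < N) Y J <= 2 * K ^+ 2 + K ^+ 2 * (n%:R * (2 * S)).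
  (* Summing the recursion puts half of the sum on the right, where it is absorbed; the bound is
     therefore independent of [N]. *)
  have h1 : \sum_(J < N) Y J <= \sum_(J < N.+1) Y J by rewrite big_ord_recr /= lerDl.
  have h2 : \sum_(J < N.+1) Y J <= Y 0%N + ((\sum_(J < N) Y J) / 2 + K ^+ 2 / 2 * \sum_(J < N) T J).
    rewrite big_ord_recl lerD2l mulr_suml mulr_sumr -big_split; apply: ler_sum => J _.
    exact: YS.
  have h3 : Y 0%N <= K ^+ 2 by rewrite /Y expn0 expr1n divr1.
  have h4 : K ^+ 2 * \sum_(J < N) T J <= K ^+ 2 * (n%:R * (2 * S)).
    by rewrite ler_wpM2l ?sqr_ge0.
  by move: h1 h2 h3 h4; set y := \sum_(J < N) Y J; set t := \sum_(J < N) T J; lra.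
pose gh k := sqn (fcoef (fun x => (G x)%:C) k).
have uG : ucb G.
  have h c0 : ucb (fun x => complex.Re (tp (r c0) (c c0) x)) by have [] := @cucb_tp R d (r c0) (c c0).
  have /fin_all_exists[M HM] a : exists M : R, forall x, `|complex.Re (tp (r a) (c a) x)| <= M.
    by have [[M HM] _] := h a; exists M.
  apply: (@ucb_lip R n d (fun v => f v j 0) L _ (\big[Num.max/0]_a M a)) => // a x.
  by apply: (le_trans (HM a x)); exact: le_bigmax_cond.
have uGJ J : ucb (GJ J) by have [[u _] _ _ _] := Pcl_base (PJ J).
have EJ J : \sum_(k <- r0 | (2 ^ J <= `|k i 0%R|)%N) gh k <=
    2 * (L ^+ 2 * n%:R * gam J) + 2 * (X J / w J ^+ (2 * m)).
  have cG := cucb_real uG; have cGJ := cucb_real (uGJ J).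
  apply: (@le_trans _ _ (\sum_(k <- r0 | (2 ^ J <= `|k i 0%R|)%N)
     (2 * sqn (fcoef (fun x => (G x)%:C - (GJ J x)%:C) k) +
      2 * (sqn (fcoef (fun x => (D J x)%:C) k) / w J ^+ (2 * m))))).
    apply: ler_sum => k kJ; rewrite /gh.
    have -> : fcoef (fun x => (G x)%:C) k =
       fcoef (fun x => (G x)%:C - (GJ J x)%:C) k + fcoef (fun x => (GJ J x)%:C) k.
      by rewrite fcoefB // subrK.
    apply: (le_trans (sqnD2 _ _)); rewrite lerD2l ler_wpM2l //.
    (* The m-th derivative multiplies the squared coefficient by (2 pi k_i)^(2m), which is at least
       2^(2Jm) when |k_i| >= 2^J. *)
    rewrite ler_pdivlMr ?exprn_gt0 //; have [_ ->] := DJ J.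
    rewrite mulrC ler_wpM2r ?sqn_ge0 // !exprM lerXn2r ?nnegrE ?sqr_ge0 //.
    rewrite -(@real_normK _ (2 * pi * _)) ?num_real // lerXn2r ?nnegrE //.
    rewrite normrM norm_intr_absz; apply: (@le_trans _ _ (1 * (`|k i 0%R|%N)%:R)).
      by rewrite mul1r ler_nat.
    rewrite ler_wpM2r // ger0_norm; have := pi_ge2 R; lra.
  rewrite big_split /= -!mulr_sumr lerD // ler_wpM2l //.
    rewrite -big_filter; apply: (le_trans (torus_bessel (filter_uniq _ ur0) (cucbB cG cGJ))).
    pose tl a x := complex.Re (tp [seq l <- r a | (2 ^ J < kap l)%N] (c a) x).
    have utl a : ucb (fun x => tl a x ^+ 2).
      by apply: ucbX2; have [] := @cucb_tp R d [seq l <- r a | (2 ^ J < kap l)%N] (c a).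
    have uS := ucb_sum (index_enum 'I_n) utl.
    apply: (@le_trans _ _ (torus_int (fun x => L ^+ 2 * n%:R * \sum_a tl a x ^+ 2))).
      apply: le_torus_int => [||x]; [exact/ucb_sqn/cucbB|exact: ucbZ|].
      rewrite -rcB sqnC -real_normK ?num_real //.
      apply: (@le_trans _ _ ((L * \sum_a `|tl a x|) ^+ 2)).
        rewrite lerXn2r ?nnegrE ?mulr_ge0 ?sumr_ge0 //.
        apply: (le_trans (fL _ _)); rewrite ler_wpM2l // ler_sum // => a _; rewrite !mxE.
        rewrite /tl /rt; have -> : tp (r a) (c a) x = tp [seq l <- r a | predT l] (c a) x.
          by rewrite filter_predT.
        rewrite (@tp_cond (r a) (fun l => (kap l <= 2 ^ J)%N) predT) // Re_add addrAC subrr add0r /=.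
        by under eq_filter do rewrite -ltnNge.
      rewrite exprMn -mulrA ler_wpM2l ?sqr_ge0 //.
      apply: (le_trans (sqr_sum_card _)); rewrite ler_wpM2l // ler_sum // => a _.
      by rewrite real_normK ?num_real.
    rewrite (torus_intZ _ uS) (torus_int_sum _ utl) ler_wpM2l ?mulr_ge0 ?sqr_ge0 //.
    apply: ler_sum => a _; rewrite -big_filter; apply: torus_int_Re_tp; exact: filter_uniq.
  rewrite -mulr_suml ler_wpM2r ?invr_ge0 ?exprn_ge0 // -big_filter.
  have := torus_bessel (filter_uniq (fun k : 'cV[int]_d => (2 ^ J <= `|k i 0%R|)%N) ur0) (cucb_real (uD J)).
  by rewrite /X; under [X in _ <= torus_int X -> _]eq_fun do rewrite sqnC.
(* Only a cutoff above all frequencies of [r0]: the sums over scales are bounded uniformly in it. *)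
have [N HN] : exists N, forall k, k \in r0 -> (`|k i 0%R| < 2 ^ N)%N.
  exists (\max_(k <- r0) `|k i 0%R|)%N => k kr.
  have h : (`|k i 0%R| <= \max_(k <- r0) `|k i 0%R|)%N.
    by apply: (@leq_bigmax_seq _ _ xpredT (fun k : 'cV[int]_d => `|k i 0%R|%N)).
  by apply: leq_ltn_trans h _; exact: ltn_expl.
apply: (@le_trans _ _ (\sum_(k <- r0) 2 ^+ (2 * s) *
   \sum_(J < N | (2 ^ J <= `|k i 0%R|)%N) w J ^+ (2 * s) * gh k)).
  rewrite big_seq [leRHS]big_seq; apply: ler_sum => k kr; rewrite -mulr_suml mulrA.
  by rewrite ler_wpM2r ?sqn_ge0 // dyadic_upper // HN.
rewrite -mulr_sumr ler_wpM2l ?exprn_ge0 // (exchange_big_dep xpredT) //=.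
apply: (@le_trans _ _ (\sum_(J < N) (2 * (L ^+ 2 * n%:R) * T J + 2 * Y J))).
  apply: ler_sum => J _; rewrite -mulr_sumr.
  apply: (le_trans (ler_wpM2l _ (EJ J))); first by rewrite exprn_ge0.
  rewrite /T /Y /m mulnS exprD; have wn : w J != 0 by rewrite gt_eqF.
  have wn2 : w J ^+ (2 * s) != 0 by rewrite expf_neq0.
  rewrite le_eqVlt; apply/orP; left; apply/eqP; field.
  by rewrite wn wn2.
rewrite big_split /= -!mulr_sumr /B0 lerD // ler_wpM2l //.
- by rewrite !mulr_ge0 ?sqr_ge0.
- exact: TN.
- exact: YN.
Qed.

End Direction.

(** Reduces the full weight to the one-direction estimates: [kap k] is either 1 or the absolute
    value of a coordinate. *)
Lemma wgt_le_sum (k : 'cV[int]_d) :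
  wgt s k <= 1 + \sum_i (`|k i 0%R|%N)%:R ^+ (2 * s) :> R.
Proof.
have S0 (P : pred 'I_d) : 0 <= \sum_(i | P i) (`|k i 0%R|%N)%:R ^+ (2 * s) :> R.
  by apply: sumr_ge0 => i _; rewrite exprn_ge0.
have [k1|k1] := leqP (kap k) 1.
  have -> : wgt s k = 1 :> R by rewrite /wgt (_ : kap k = 1%N) ?expr1n //;
    apply/eqP; rewrite eqn_leq k1 kap_gt0.
  by rewrite lerDl.
case: (pselect (exists i, kap k = `|k i 0%R|%N)) => [[i E]|H].
  rewrite /wgt E (bigD1 i) //=; have := S0 (fun l => l != i).
  set a := \sum_(_ < _ | _) _; set b := _ ^+ _; lra.
have : (kap k <= (kap k).-1)%N.
  apply: kap_leP => [|i]; first by case: (kap k) k1 => [|[]].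
  rewrite -ltnS prednK ?kap_gt0 // ltn_neqAle leq_kap andbT.
  by apply/eqP => E; apply: H; exists i.
by rewrite leqNgt prednK ?kap_gt0 // leqnn.
Qed.

(** The arguments are replaced by polynomials so close that [f] moves by at most [eta]. For these,
    the sup norm bounds the unweighted energy of the composition and [comp_dir_bound] the weighted
    energy in each direction; [Hap_fourier] and [Hap_lim] lead back to the class. *)
Lemma Hap_comp n q (f : 'cV[R]_n -> 'cV[R]_q) L S : smooth f -> 0 <= L ->
  (forall j x y, `|f x j 0 - f y j 0| <= L * \sum_c `|x c 0 - y c 0|) ->
  exists S', forall u : 'I_n -> 'cV[R]_d -> R, (forall a, Hap s S (u a)) ->
  forall j, Hap s S' (fun x => f (\col_a u a x) j 0).
Proof.
(* [S] is given before any function of the class, so its sign is not yet known. *)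
move=> sf L0 fL; pose S1 := Num.max S 0.
have S10 : 0 <= S1 by rewrite le_max lexx orbT.
have Z0 := lattice_ge0 HZ; have ZS0 : 0 <= Z * S1 by rewrite mulr_ge0.
have ZS : Z * S1 <= (1 + Z * S1) ^+ 2 by rewrite expr2; nra.
have /fin_all_exists2[G0 G00 HG0] (j : 'I_q) : exists2 G0 : R, 0 <= G0 & forall x : 'cV[R]_n,
    (forall a, `|x a 0| <= 1 + Z * S1) -> `|f x j 0| <= G0.
  by apply: box_bounded => x; apply: differentiable_continuous;
     exact: (smooth_comp_diff [::] j sf).
have /fin_all_exists2[B B0 HB] (ij : 'I_d * 'I_q) := comp_dir_bound ij.1 sf L0 (fL ij.2) S10.
exists (\sum_j (G0 j ^+ 2 + \sum_i B (i, j))) => u Hu j.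
apply: Hap_lim => e e0.
pose eta := Num.min 1 e; have eta0 : 0 < eta by rewrite lt_min ltr01.
have eta1 : eta ^+ 2 <= e.
  apply: (@le_trans _ _ (eta * 1)); last by rewrite mulr1 ge_min lexx orbT.
  by rewrite expr2 ler_pM2l // ge_min lexx.
have Ln : 0 < L * n%:R + 1 by rewrite ltr_wpDl // mulr_ge0.
have e'0 : 0 < eta / (L * n%:R + 1) by rewrite divr_gt0.
have Hu1 a : Hap s S1 (u a) by apply: Hap_mono (Hu a); rewrite le_max lexx.
have /fin_all_exists[rc Hrc] (a : 'I_n) : exists rc : seq 'cV[int]_d * ('cV[int]_d -> C),
    [/\ uniq rc.1, \sum_(k <- rc.1) wgt s k * sqn (rc.2 k) <= S1 &
      forall x, `|u a x - complex.Re (tp rc.1 rc.2 x)| <= eta / (L * n%:R + 1)].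
  by have [r [c H]] := Hap_near (Hu1 a) e'0; exists (r, c).
pose p a x := complex.Re (tp (rc a).1 (rc a).2 x).
pose G x := f (\col_a p a x) j 0.
have pb a x : `|p a x| <= 1 + Z * S1.
  have [ur cS _] := Hrc a; rewrite -(@ler_pXn2r _ 2) ?nnegrE ?normr_ge0 ?addr_ge0 //.
  rewrite real_normK ?num_real //; apply: le_trans ZS; apply: (le_trans (sqr_Re_tp_le _ _ ur)).
  by rewrite ler_wpM2l.
have up a : ucb (p a) by have [] := @cucb_tp R d (rc a).1 (rc a).2.
have uG : ucb G by apply: (@ucb_lip R n d (fun v => f v j 0) L p _ L0 _ up pb).
have pG : torus_periodic G.
  by move=> x z; congr (f _ _ _); apply/colP => a; rewrite !mxE /p tp_periodic.
exists G; last first.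
  move=> x; apply: le_trans eta1; rewrite -real_normK ?num_real // lerXn2r ?nnegrE ?(ltW eta0) //.
  apply: (le_trans (fL _ _ _)).
  apply: (@le_trans _ _ (L * \sum_(a < n) eta / (L * n%:R + 1))).
    by rewrite ler_wpM2l // ler_sum // => a _; rewrite !mxE; have [_ _] := Hrc a; apply.
  rewrite sumr_const card_ord -[_ / _ *+ n]mulr_natl.
  rewrite [n%:R * _]mulrCA [L * _]mulrCA [L * (n%:R / _)]mulrA.
  by rewrite ler_piMr ?(ltW eta0) // ler_pdivrMr // mul1r lerDl.
apply: Hap_fourier => // r0 ur0.
apply: (@le_trans _ _ (G0 j ^+ 2 + \sum_i B (i, j))); last first.
  rewrite (bigD1 j) //= lerDl; apply: sumr_ge0 => l _.
  by rewrite addr_ge0 ?sqr_ge0 // sumr_ge0.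
apply: (@le_trans _ _ (\sum_(k <- r0) (sqn (fcoef (fun x => (G x)%:C) k) +
   \sum_i (`|k i 0%R|%N)%:R ^+ (2 * s) * sqn (fcoef (fun x => (G x)%:C) k)))).
  apply: ler_sum => k _; rewrite -mulr_suml -[X in X + _]mul1r -mulrDl.
  by rewrite ler_wpM2r ?sqn_ge0 // wgt_le_sum.
rewrite big_split /= lerD //.
  apply: (le_trans (torus_bessel ur0 (cucb_real uG))).
  rewrite -[leRHS](@torus_int_cst R d); apply: le_torus_int => [||x].
  - exact/ucb_sqn/cucb_real.
  - exact: ucb_cst.
  rewrite sqnC -real_normK ?num_real // lerXn2r ?nnegrE //.
  by apply: HG0 => a; rewrite mxE.
rewrite exchange_big /=; apply: ler_sum => i _.
apply: (HB (i, j) (fun a => (rc a).1) (fun a => (rc a).2)) => // a; by case: (Hrc a).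
Qed.

End CompositionSobolev.

(** * The Sobolev space *)

Section HsFacts.
Context {R : realType}.
Local Notation C := R[i].
Local Open Scope complex_scope.

(** Only [x] is confined to the box: in the periodic case both points are translated by the integer
    vector belonging to [x], and [y] may leave the box. *)
Lemma uniform_continuous_box d (f : 'cV[R]_d -> R) (A e : R) : continuous f -> 0 < e ->
  exists2 del, 0 < del & forall x y : 'cV[R]_d, (forall i, `|x i 0| <= A) ->
    (forall i, `|x i 0 - y i 0| <= del) -> `|f x - f y| <= e.
Proof.
move=> cf e0.
pose K := [set v : 'rV[R]_d | forall i, `[- A, A]%classic (v ord0 i)].
have cK : compact K.
  by apply: (@rV_compact R d (fun=> `[- A, A]%classic)) => _; exact: segment_compact.
have /compact_near_coveringP cov := cK.
pose P (del : R) (v : 'rV[R]_d) := forall y : 'cV[R]_d,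
  (forall i, `|v 0 i - y i 0| <= del) -> `|f v^T - f y| <= e.
have /(_ _)/(_ _)[|del /= del0 H] := cov R (0^'+) P _.
- move=> v _.
  have /(@cvgrPdist_le _ R^o)/(_ _ (divr_gt0 e0 (ltr0n _ 2))) := cf v^T.
  move=> /nbhs_ballP[r r0 rH].
  have r2 : 0 < r / 2 by rewrite divr_gt0.
  exists (ball v (r / 2), [set del : R | del < r / 2]); first split => /=.
  + exact: nbhsx_ballx.
  + by apply: nbhs_right_lt.
  move=> [v' del] /= [[_ vv'] dr] y yd.
  have h1 : `|f v^T - f v'^T| <= e / 2.
    apply: rH; split => // a b; rewrite !mxE; have := vv' b a; rewrite /ball /= => h.
    by apply: lt_le_trans h _; lra.
  have h2 : `|f v^T - f y| <= e / 2.
    apply: rH; split => // a b; rewrite !mxE (ord1 b); have := vv' 0 a; rewrite /ball /= => h.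
    rewrite -[v 0 a](subrK (v' 0 a)) -addrA; apply: (le_lt_trans (ler_normD _ _)).
    by have := yd a; move: h dr; lra.
  by move: h1 h2; rewrite !ler_norml => /andP[? ?] /andP[? ?]; apply/andP; split; lra.
- exists (del / 2); first by rewrite divr_gt0.
  move=> x y xA xy; rewrite -[x]trmxK; apply: (H (del / 2)) => /=.
  + by rewrite sub0r normrN gtr0_norm ?divr_gt0 //; lra.
  + by rewrite divr_gt0.
  + by move=> i; rewrite /= mxE in_itv /= -ler_norml.
  + by move=> i; rewrite mxE.
Qed.

Lemma continuous_periodic_ucb d (f : 'cV[R]_d -> R) : continuous f -> torus_periodic f ->
  ucb f.
Proof.
move=> cf pf.
pose fl (x : 'cV[R]_d) : 'cV[int]_d := \col_i - Num.floor (x i 0).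
have xb (x : 'cV[R]_d) i : `|(x + map_mx intr (fl x)) i 0| <= 1.
  have := floor_itv (x i 0); rewrite !mxE rmorphN /= rmorphD /= => /andP[h1 h2].
  by rewrite ler_norml; apply/andP; split; lra.
split.
  have [M M0 HM] := box_bounded 1 cf; exists M => x.
  by rewrite -(pf x (fl x)); apply: HM.
move=> e e0; have [del d0 H] := uniform_continuous_box 1 cf e0.
exists del => // x y xy; rewrite -(pf x (fl x)) -(pf y (fl x)); apply: H => // i.
by rewrite [X in X - _]mxE [X in _ - X]mxE opprD addrACA subrr addr0.
Qed.

Lemma frobE m n (A : 'M[R]_(m, n)) : frob A ^+ 2 = \sum_i \sum_j A i j ^+ 2.
Proof.
rewrite sqr_sqrtr //; apply: sumr_ge0 => i _; apply: sumr_ge0 => j _; exact: sqr_ge0.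
Qed.

Lemma frob_ge0 m n (A : 'M[R]_(m, n)) : 0 <= frob A.
Proof. exact: sqrtr_ge0. Qed.

Lemma cfrobE m (A : 'cV[C]_m) : cfrob A ^+ 2 = \sum_i sqn (A i 0).
Proof.
rewrite sqr_sqrtr.
  by apply: eq_bigr => i _; rewrite big_ord1.
by apply: sumr_ge0 => i _; apply: sumr_ge0 => j _; exact: sqn_ge0.
Qed.

Lemma norm_le_frob m (x : 'cV[R]_m) i : `|x i 0| <= frob x.
Proof.
rewrite -(@ler_pXn2r _ 2) ?nnegrE ?frob_ge0 // real_normK ?num_real // frobE.
rewrite (bigD1 i) //= big_ord1 lerDl; apply: sumr_ge0 => j _.
by apply: sumr_ge0 => l _; exact: sqr_ge0.
Qed.

Lemma frob_le_sum m (x : 'cV[R]_m) : frob x <= \sum_i `|x i 0|.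
Proof.
have S0 : 0 <= \sum_i `|x i 0| by exact: sumr_ge0.
rewrite -(@ler_pXn2r _ 2) ?nnegrE ?frob_ge0 // frobE expr2 mulr_sumr.
apply: ler_sum => i _; rewrite big_ord1 -real_normK ?num_real // expr2 ler_wpM2r //.
by rewrite (bigD1 i) //= lerDl sumr_ge0.
Qed.

Lemma lipschitz_coord m n (f : 'cV[R]_m -> 'cV[R]_n) : globally_lipschitz f ->
  exists2 L, 0 <= L & forall j x y, `|f x j 0 - f y j 0| <= L * \sum_c `|x c 0 - y c 0|.
Proof.
move=> [L HL]; exists `|L| => // j x y.
have := norm_le_frob (f x - f y) j; rewrite mxE [(- f y) j 0]mxE => h.
apply: (le_trans h); apply: (le_trans (HL x y)).
apply: (@le_trans _ _ (`|L| * frob (x - y))); first by rewrite ler_wpM2r ?frob_ge0 ?ler_norm.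
rewrite ler_wpM2l //; apply: (le_trans (frob_le_sum _)); apply: ler_sum => i _.
by rewrite !mxE.
Qed.

Context {d m s : nat}.

Definition hsw (k : 'cV[int]_d) : R := 1 + frob (map_mx intr k : 'cV[R]_d) ^+ (2 * s).

Lemma hsw_ge0 k : 0 <= hsw k.
Proof. by rewrite addr_ge0 // exprn_ge0 // frob_ge0. Qed.

Lemma wgt_le_hsw (k : 'cV[int]_d) : wgt s k <= hsw k.
Proof.
have F0 := frob_ge0 (map_mx intr k : 'cV[R]_d).
have [k1|k1] := leqP (kap k) 1.
  have -> : wgt s k = 1 :> R by rewrite /wgt (_ : kap k = 1%N) ?expr1n //;
    apply/eqP; rewrite eqn_leq k1 kap_gt0.
  by rewrite lerDl exprn_ge0.
apply: (@le_trans _ _ (frob (map_mx intr k : 'cV[R]_d) ^+ (2 * s))); last by rewrite lerDr.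
rewrite lerXn2r ?nnegrE //.
case: (pselect (exists i, kap k = `|k i 0%R|%N)) => [[i E]|H].
  by rewrite E -norm_intr_absz; have := norm_le_frob (map_mx intr k : 'cV[R]_d) i; rewrite mxE.
have : (kap k <= (kap k).-1)%N.
  apply: kap_leP => [|i]; first by case: (kap k) k1 => [|[]].
  rewrite -ltnS prednK ?kap_gt0 // ltn_neqAle leq_kap andbT.
  by apply/eqP => E; apply: H; exists i.
by rewrite leqNgt prednK ?kap_gt0 // leqnn.
Qed.

(** Squared Sobolev norm at most [q], expressed through finite partial sums so as to stay within
    real numbers. *)
Definition hs_bound (f : 'cV[R]_d -> 'cV[R]_m) (q : R) : Prop :=
  forall r : seq 'cV[int]_d, uniq r -> \sum_(k <- r) hsw k * cfrob (fourier f k) ^+ 2 <= q.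

Lemma sobolev_norm_bound f q : (sobolev_norm s f < q%:E)%E -> hs_bound f (q ^+ 2).
Proof.
rewrite /sobolev_norm; set a := fun k => _; set E := esum _ _.
have a0 k : (0 <= a k)%E.
  by rewrite lee_fin mulr_ge0 ?hsw_ge0 // sqr_ge0.
have E0 : (0 <= E)%E by apply: esum_ge0 => k _; exact: a0.
rewrite poweR12_sqrt // => Eq r ur; rewrite -lee_fin -sumEFin.
apply: (@le_trans _ _ E).
  apply: esum_ge; exists [set` r].
    by split; [exact: finite_seq|exact: subsetT].
  by rewrite -fsbig_seq.
case: E E0 Eq => [x| |] //=; rewrite ?lee_fin ?lte_fin => x0 xq.
have q0 : 0 <= q by apply: le_trans (ltW xq); exact: sqrtr_ge0.
by rewrite -(sqr_sqrtr x0) lerXn2r ?nnegrE ?sqrtr_ge0 // ltW.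
Qed.

Lemma sobolev_norm_fin f : (sobolev_norm s f < +oo)%E -> exists q, hs_bound f q.
Proof.
move=> H; have H0 : (0 <= sobolev_norm s f)%E by exact: poweR_ge0.
exists ((fine (sobolev_norm s f) + 1) ^+ 2); apply: sobolev_norm_bound.
have fi : sobolev_norm s f \is a fin_num by rewrite ge0_fin_numE.
by rewrite -[X in (X < _)%E](fineK fi) lte_fin ltrDl.
Qed.

Lemma fourierE (f : 'cV[R]_d -> 'cV[R]_m) k i :
  fourier f k i 0 = fcoef (fun x => (f x i 0)%:C) k.
Proof. by rewrite mxE. Qed.

Lemma Hs_ucb (a : Hs R d m s) i : ucb (fun x => a x i 0).
Proof.
apply: continuous_periodic_ucb.
  move=> x; apply: (@continuous_comp _ _ _ a (fun v : 'cV[R]_m => v i 0)).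
    exact: (@Hs_continuous _ _ _ _ a x).
  exact: coord_continuous.
by move=> x z; rewrite (Hs_periodic a).
Qed.

(** Young's inequality with a parameter: openness of a norm ball needs a factor arbitrarily close to
    1 in front of the first term, which the factor 2 of [sqnB2] cannot provide. *)
Lemma sqnB_eta (eta : R) (z y : C) : 0 < eta ->
  sqn (z - y) <= (1 + eta) * sqn z + (1 + eta^-1) * sqn y.
Proof.
move=> e0; have en : eta != 0 by rewrite gt_eqF.
rewrite /sqn Re_add Im_add Re_opp Im_opp -subr_ge0.
set a := complex.Re z; set b := complex.Im z; set u := complex.Re y; set v := complex.Im y.
have -> : (1 + eta) * (a ^+ 2 + b ^+ 2) + (1 + eta^-1) * (u ^+ 2 + v ^+ 2)
   - ((a - u) ^+ 2 + (b - v) ^+ 2) = eta * ((a + u / eta) ^+ 2 + (b + v / eta) ^+ 2) by field.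
by rewrite mulr_ge0 ?(ltW e0) // addr_ge0 // sqr_ge0.
Qed.

Lemma Hs_bound_open (n : R) :
  open [set b : Hs R d m s | exists2 q, q < n & 0 <= q /\ hs_bound b q].
Proof.
suff H : Hs_open [set b : Hs R d m s | exists2 q, q < n & 0 <= q /\ hs_bound b q] by exact: H.
move=> b [q qn [q0 Hq]].
(* With [eta] the old bound grows to at most (n + q)/2, and the radius [r] adds at most (n - q)/4;
   the total stays below [n]. *)
pose eta := (n - q) / (2 * (q + 1)).
have q1 : 0 < q + 1 by rewrite ltr_wpDl.
have nq : 0 < n - q by rewrite subr_gt0.
have eta0 : 0 < eta by rewrite divr_gt0 // mulr_gt0.
have etai : 0 < 1 + eta^-1 by rewrite addr_gt0 // invr_gt0.
have h1 : (1 + eta) * q <= (n + q) / 2.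
  have : eta * q <= (n - q) / 2.
    have -> : eta * q = (n - q) / 2 * (q / (q + 1)) by rewrite /eta; field; rewrite gt_eqF.
    apply: ler_piMr; first by rewrite divr_ge0 ?(ltW nq).
    by rewrite ler_pdivrMr // mul1r lerDl.
  lra.
pose r := Num.min 1 ((n - q) / (4 * (1 + eta^-1))).
have r0 : 0 < r by rewrite lt_min ltr01 divr_gt0 // mulr_gt0.
have h2 : (1 + eta^-1) * r ^+ 2 <= (n - q) / 4.
  have : r ^+ 2 <= (n - q) / (4 * (1 + eta^-1)).
    apply: (@le_trans _ _ (1 * r)).
      by rewrite expr2 ler_pM2r // ge_min lexx.
    by rewrite mul1r ge_min lexx orbT.
  rewrite -(ler_pM2l etai) => h; apply: (le_trans h).
  have cancel (w z : R) : 0 < w -> w * (z / (4 * w)) = z / 4.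
    by move=> w0; field; rewrite gt_eqF.
  by rewrite cancel.
exists r => // c /sobolev_norm_bound Hc.
exists ((1 + eta) * q + (1 + eta^-1) * r ^+ 2); first by lra.
have eta1 : 0 <= 1 + eta by rewrite addr_ge0 // (ltW eta0).
split.
  by apply: addr_ge0; apply: mulr_ge0 => //; [exact: ltW|exact: sqr_ge0].
move=> r' ur'.
apply: (@le_trans _ _ (\sum_(k <- r') ((1 + eta) * (hsw k * cfrob (fourier b k) ^+ 2) +
   (1 + eta^-1) * (hsw k * cfrob (fourier (fun x => b x - c x) k) ^+ 2)))).
  apply: ler_sum => k _; rewrite [X in _ <= X + _]mulrCA [X in _ <= _ + X]mulrCA -mulrDr.
  rewrite ler_wpM2l ?hsw_ge0 // !cfrobE !mulr_sumr -big_split; apply: ler_sum => i _ /=.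
  have -> : fourier c k i 0 = fourier b k i 0 - fourier (fun x => b x - c x) k i 0.
    rewrite !fourierE; have ub := cucb_real (Hs_ucb b i); have uc := cucb_real (Hs_ucb c i).
    rewrite -fcoefB //; last first.
      by have := cucbB ub uc; under eq_fun do rewrite -rcB;
         under [X in _ -> cucb X]eq_fun do rewrite !mxE.
    congr fcoef; apply/funext => x; rewrite !mxE rcB; ring.
  exact: sqnB_eta.
rewrite big_split /= -!mulr_sumr; apply: lerD; apply: ler_wpM2l; rewrite ?(ltW etai) //; [exact: Hq|exact: Hc].
Qed.

(** The sets [V n] are open, increasing and cover the space, so one of them contains the compact
    set; a bound on Fourier coefficients then becomes membership in the class. *)
Lemma compact_Hs_bounded (Ac : set (Hs R d m s)) : compact Ac ->
  exists S : R, forall a, Ac a -> forall i, Hap s S (fun x => a x i 0).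
Proof.
move=> /compact_near_coveringP cov.
pose V (n : nat) (b : Hs R d m s) := exists2 q, q < n%:R & 0 <= q /\ hs_bound b q.
have Vmono n n' b : (n <= n')%N -> V n b -> V n' b.
  by move=> nn [q qn H]; exists q => //; apply: (lt_le_trans qn); rewrite ler_nat.
have [|n /= _ Hn] := cov nat (\oo) V _.
  move=> a _; have [q Hq] := sobolev_norm_fin (Hs_finite a).
  have q0 : 0 <= q by have := Hq [::] erefl; rewrite big_nil.
  pose n0 := (Num.truncn q).+1.
  have Va : V n0 a by exists q => //; exact: truncnS_gt.
  exists (V n0, [set n | (n0 <= n)%N]); first split => /=.
  - by apply: (open_nbhs_nbhs _); split => //; exact: Hs_bound_open.
  - by exists n0.
  by move=> [b n] /= [Vb nn]; exact: Vmono Vb.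
exists n%:R => a /(Hn n (leqnn n)) [q qn [q0 Hq]] i.
apply: Hap_fourier; first exact: Hs_ucb.
  by move=> x z; rewrite (Hs_periodic a).
move=> r ur; apply: (le_trans _ (ltW qn)); apply: (le_trans _ (Hq r ur)).
apply: ler_sum => k _; apply: ler_pM.
- by rewrite ltW // wgt_gt0.
- exact: sqn_ge0.
- exact: wgt_le_hsw.
rewrite cfrobE (bigD1 i) //= fourierE lerDl; apply: sumr_ge0 => l _; exact: sqn_ge0.
Qed.

End HsFacts.

(** * States of the network *)

Section States.
Context {R : realType} {d s : nat}.
Local Notation C := R[i].
Local Open Scope complex_scope.
Variable Z : R.
Hypothesis s0 : (0 < s)%N.
Hypothesis HZ : forall r : seq 'cV[int]_d, uniq r ->
  \sum_(k <- r) (kap k)%:R ^- (2 * s) <= Z.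

Lemma ex_common_bound n (P : 'I_n -> R -> Prop) :
  (forall i a b, a <= b -> P i a -> P i b) -> (forall i, exists a, P i a) ->
  exists a, forall i, P i a.
Proof.
move=> mono /choice[g Hg]; exists (\sum_i `|g i|) => i; apply: mono (Hg i).
by apply: (le_trans (ler_norm _)); rewrite (bigD1 i) //= lerDl sumr_ge0.
Qed.

Lemma sqn_mulmx_le m n (A : 'M[C]_(n, m)) (v : 'cV[C]_m) i (e : R) :
  (forall j, sqn (v j 0) <= e) ->
  sqn ((A *m v) i 0) <= m%:R * (\sum_j sqn (A i j)) * e.
Proof.
move=> ve; rewrite mxE; apply: (le_trans (sqn_sum_size _ _)).
have -> : size (index_enum 'I_m) = m by rewrite [index_enum _]unlock -enumT size_enum_ord.
rewrite -mulrA ler_wpM2l // mulr_suml; apply: ler_sum => j _.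
by rewrite sqnM ler_wpM2l ?sqn_ge0.
Qed.

Lemma kernel_opE K m n (P : 'cV[int]_d -> 'M[C]_(n, m)) vhat (x : 'cV[R]_d) i :
  kernel_op K P vhat x i 0 = \sum_(k <- modes d K) (P k *m vhat k) i 0 * ek k x.
Proof. by rewrite summxE; apply: eq_bigr => k _; rewrite mxE mulrC. Qed.

Lemma kernel_opB K m n (P : 'cV[int]_d -> 'M[C]_(n, m)) vhat what (x : 'cV[R]_d) i :
  (kernel_op K P vhat x - kernel_op K P what x) i 0 =
  \sum_(k <- modes d K) (P k *m (vhat k - what k)) i 0 * ek k x.
Proof.
rewrite mxE [X in _ + X]mxE !kernel_opE -sumrB; apply: eq_bigr => k _.
by rewrite mulmxBr [X in _ = X * _]mxE [X in _ = (_ + X) * _]mxE mulrBl.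
Qed.

Lemma affine_sub m n (A : 'M[R]_(n, m)) (b : 'cV[R]_n) (p q : 'cV[R]_m) (r r' : 'cV[C]_n) i :
  (A *m p + map_mx (@complex.Re R) r + b) i 0 - (A *m q + map_mx (@complex.Re R) r' + b) i 0 =
  (A *m (p - q)) i 0 + complex.Re ((r - r') i 0).
Proof.
have add3 (x y z : 'cV[R]_n) : (x + y + z) i 0 = x i 0 + y i 0 + z i 0.
  by rewrite mxE [X in X + _]mxE.
rewrite !add3 mulmxBr ![map_mx _ _ i 0]mxE [X in _ = X + _]mxE [X in _ = _ + X + _]mxE.
by rewrite [(r - r') i 0]mxE [(- r') i 0]mxE Re_add Re_opp; ring.
Qed.

Lemma Hap_mulmx m n (A : 'M[R]_(n, m)) S : exists T, forall u : 'cV[R]_d -> 'cV[R]_m,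
  (forall j, Hap s S (fun x => u x j 0)) -> forall i, Hap s T (fun x => (A *m u x) i 0).
Proof.
suff [T HT] : exists T, forall i : 'I_n, forall u : 'cV[R]_d -> 'cV[R]_m,
    (forall j, Hap s S (fun x => u x j 0)) -> Hap s T (fun x => (A *m u x) i 0).
  by exists T => u Hu i; exact: HT.
apply: ex_common_bound => [i a b ab H u Hu|i]; first exact: Hap_mono ab (H u Hu).
have [T HT] := @Hap_sum R d s m ((\sum_j A i j ^+ 2) * S).
exists T => u Hu.
have -> : (fun x : 'cV[R]_d => (A *m u x) i 0) = (fun x => \sum_j A i j * u x j 0).
  by apply/funext => x; rewrite mxE.
apply: (HT (fun j x => A i j * u x j 0)) => j; apply: Hap_mono (HapZ (A i j) (Hu j)).
rewrite ler_wpM2r ?(Hap_ge0 (Hu j)) // (bigD1 j) //= lerDl.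
by apply: sumr_ge0 => l _; exact: sqr_ge0.
Qed.

Lemma Hap_addmx m (b : 'cV[R]_m) S (u : 'cV[R]_d -> 'cV[R]_m) :
  (forall j, Hap s S (fun x => u x j 0)) ->
  forall j, Hap s (2 * S + 2 * \sum_i b i 0 ^+ 2) (fun x => (u x + b) j 0).
Proof.
move=> Hu j; have -> : (fun x => (u x + b) j 0) = (fun x => u x j 0 + b j 0).
  by apply/funext => x; rewrite mxE.
apply: Hap_mono (HapD (Hu j) (Hap_cst s (b j 0))).
rewrite lerD2l ler_wpM2l // (bigD1 j) //= lerDl.
by apply: sumr_ge0 => l _; exact: sqr_ge0.
Qed.

Lemma Hap_act m n (f : 'cV[R]_m -> 'cV[R]_n) S : smooth f -> globally_lipschitz f ->
  exists T, forall u : 'cV[R]_d -> 'cV[R]_m,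
  (forall j, Hap s S (fun x => u x j 0)) -> forall i, Hap s T (fun x => f (u x) i 0).
Proof.
move=> sf /lipschitz_coord[L L0 HL].
have [T HT] := Hap_comp s0 HZ S sf L0 HL; exists T => u Hu i.
have := HT (fun j x => u x j 0) Hu i; congr Hap; apply/funext => x; congr (f _ _ _).
by apply/colP => j; rewrite mxE.
Qed.

Lemma sqn_fourier_le m S (u : 'cV[R]_d -> 'cV[R]_m) k j :
  Hap s S (fun x => u x j 0) -> sqn (fourier u k j 0) <= 2 * Z * S.
Proof.
move=> Hu; rewrite fourierE; apply: sqn_fcoef_le => [|x].
  exact: cucb_real (Hap_ucb Hu).
rewrite sqnC; exact: Hap_sup HZ Hu x.
Qed.

Lemma Hap_kernel m n (P : 'cV[int]_d -> 'M[C]_(n, m)) K S :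
  exists T, forall u : 'cV[R]_d -> 'cV[R]_m,
  (forall j, Hap s S (fun x => u x j 0)) ->
  forall i, Hap s T (fun x => complex.Re (kernel_op K P (fourier u) x i 0)).
Proof.
suff [T HT] : exists T, forall i : 'I_n, forall u : 'cV[R]_d -> 'cV[R]_m,
    (forall j, Hap s S (fun x => u x j 0)) ->
    Hap s T (fun x => complex.Re (kernel_op K P (fourier u) x i 0)).
  by exists T => u Hu i; exact: HT.
apply: ex_common_bound => [i a b ab H u Hu|i]; first exact: Hap_mono ab (H u Hu).
have [T HT] := @Hap_sum_seq R d s _ (modes d K) (fun k =>
  4 * (m%:R * (\sum_j sqn (P k i j)) * (2 * Z * S)) * wgt s k).
exists T => u Hu.
have -> : (fun x => complex.Re (kernel_op K P (fourier u) x i 0)) = (fun x : 'cV[R]_d =>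
    \sum_(k <- modes d K) complex.Re ((P k *m fourier u k) i 0 * ek k x)).
  by apply/funext => x; rewrite kernel_opE Re_sum.
apply: (HT (fun k x => complex.Re ((P k *m fourier u k) i 0 * ek k x))) => k _.
apply: Hap_mono (Hap_Re_ek s k _).
rewrite ler_wpM2r ?(ltW (wgt_gt0 s k)) // ler_wpM2l //.
by apply: sqn_mulmx_le => j; exact: sqn_fourier_le.
Qed.

Context {da du K T : nat} (F : fno R d da du K T).

Lemma state_Hap t S : (t <= T)%N -> exists S', forall a : 'cV[R]_d -> 'cV[R]_da,
  (forall j, Hap s S (fun x => a x j 0)) -> forall j, Hap s S' (fun x => state F a t x j 0).
Proof.
elim: t => [_|t IH tT].
  have [S1 H1] := Hap_mulmx (net_mx (lifting F)) S.
  have [S2 H2] := Hap_act (2 * S1 + 2 * \sum_i net_bias (lifting F) i 0 ^+ 2)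
    (net_act_smooth (lifting F)) (net_act_lipschitz (lifting F)).
  exists S2 => a Ha; apply: (H2 (fun x => net_mx (lifting F) *m a x + net_bias (lifting F))).
  by apply: Hap_addmx; apply: H1.
have [S1 H1] := IH (ltnW tT).
have [S2 H2] := Hap_mulmx (weight F t) S1.
have [S3 H3] := Hap_kernel (multiplier F t) K S1.
have [S4 H4] := Hap_act (2 * (2 * S2 + 2 * S3) + 2 * \sum_i bias F t i 0 ^+ 2)
  (act_smooth tT) (act_lipschitz F tT).
exists S4 => a Ha; have Hv := H1 a Ha.
apply: (H4 (fun x => weight F t *m state F a t x +
  map_mx (@complex.Re R) (kernel_op K (multiplier F t) (fourier (state F a t)) x) + bias F t)).
apply: Hap_addmx => j.
have := HapD (H2 _ Hv j) (H3 _ Hv j); congr Hap.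
by apply/funext => x; rewrite [in RHS]mxE [X in _ = _ + X]mxE.
Qed.

Section Grid.
Variable N : nat.
Hypothesis N0 : (0 < N)%N.
Local Notation e := (N%:R ^- (2 * s) : R).
Local Notation gp n := (gridpoint R (n : grid d N)).

(** Squared error of one discrete coefficient in units of N^(-2s): the [S] term is aliasing of the
    exact state, the [Q] term the error inherited from its grid values. *)
Definition coef_cst (S Q : R) : R := 2 * (2 * alias_cst s Z * S) + 2 * Q.

Lemma sqn_fourier_dft_le m S Q (u : 'cV[R]_d -> 'cV[R]_m) (v : grid d N -> 'cV[R]_m) k j :
  Hap s S (fun x => u x j 0) -> (forall n, (u (gp n) j 0 - v n j 0) ^+ 2 <= Q * e) ->
  k \in modes d N -> sqn ((fourier u k - dft v k) j 0) <= coef_cst S Q * e.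
Proof.
move=> Hu Hv kN; rewrite mxE [X in _ + X]mxE fourierE dftE.
set a := fcoef _ _; set b := dftc _ _.
pose c := dftc (fun n => (u (gp n) j 0)%:C) k.
have -> : a - b = (a - c) + (c - b) by rewrite addrA subrK.
have h1 : sqn (a - c) <= 2 * alias_cst s Z * e * S.
  exact: (fcoef_dftc_Hap HZ (Hap_ucb Hu) Hu N0 kN).
have h2 : sqn (c - b) <= Q * e.
  rewrite -dftcB; apply: sqn_dftc_le => // n; rewrite -rcB sqnC; exact: Hv.
by apply: (le_trans (sqnD2 _ _)); move: h1 h2; rewrite /coef_cst; lra.
Qed.

End Grid.

Definition kernel_cst t (S Q : R) c : R := (size (modes d K))%:R *
  \sum_(k <- modes d K) (width F t)%:R * (\sum_j sqn (multiplier F t k c j)) * coef_cst S Q.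

Definition inner_cst t (S Q : R) c : R :=
  2 * ((width F t)%:R * \sum_j (weight F t c j ^+ 2 * Q)) + 2 * @kernel_cst t S Q c.

(** [Q'] is chosen before N, so a layer changes only the constant and never the rate. The
    pre-activation error splits into the pointwise linear part and the kernel part, the latter
    through the coefficient errors on the finitely many modes of the kernel. *)
Lemma layer_error t S Q : (t < T)%N -> exists Q', forall N
  (u : 'cV[R]_d -> 'cV[R]_(width F t)) (v : grid d N -> 'cV[R]_(width F t)),
  (0 < N)%N -> (K <= N)%N -> (forall j, Hap s S (fun x => u x j 0)) ->
  (forall n j, (u (gridpoint R n) j 0 - v n j 0) ^+ 2 <= Q * N%:R ^- (2 * s)) ->
  forall n i, (layer u (gridpoint R n) i 0 - discrete_layer v n i 0) ^+ 2 <=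
    Q' * N%:R ^- (2 * s).
Proof.
move=> tT; have [L L0 HL] := lipschitz_coord (act_lipschitz F tT).
exists (L ^+ 2 * ((width F t.+1)%:R * \sum_c @inner_cst t S Q c)) => N u v N0 KN Hu Huv n i.
pose y := weight F t *m u (gridpoint R n) +
  map_mx (@complex.Re R) (kernel_op K (multiplier F t) (fourier u) (gridpoint R n)) + bias F t.
pose z := weight F t *m v n +
  map_mx (@complex.Re R) (kernel_op K (multiplier F t) (dft v) (gridpoint R n)) + bias F t.
set e := N%:R ^- (2 * s) in Huv *.
have e0 : 0 <= e by rewrite invr_ge0 exprn_ge0.
have L2 (a b : R) : `|a| <= L * b -> a ^+ 2 <= L ^+ 2 * b ^+ 2.
  move=> ab; rewrite -exprMn -(real_normK (num_real a)) lerXn2r ?nnegrE //.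
  exact: le_trans ab.
apply: (le_trans (L2 _ _ (HL i y z))); rewrite -[leRHS]mulrA ler_wpM2l ?sqr_ge0 //.
apply: (le_trans (sqr_sum_card _)); rewrite -mulrA ler_wpM2l // mulr_suml.
apply: ler_sum => c _; rewrite real_normK ?num_real //.
have -> : y c 0 - z c 0 = _ := affine_sub (weight F t) (bias F t) (u (gridpoint R n)) (v n)
  (kernel_op K (multiplier F t) (fourier u) (gridpoint R n))
  (kernel_op K (multiplier F t) (dft v) (gridpoint R n)) c.
rewrite kernel_opB.
have sq2 (a b : R) : (a + b) ^+ 2 <= 2 * a ^+ 2 + 2 * b ^+ 2.
  by have := sqr_ge0 (a - b); rewrite -subr_ge0 => h; nra.
apply: (le_trans (sq2 _ _)); rewrite [leRHS]mulrDl -!(mulrA 2); apply: lerD; rewrite ler_wpM2l //.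
  rewrite mxE; apply: (le_trans (sqr_sum_card _)); rewrite -mulrA ler_wpM2l // mulr_suml.
  apply: ler_sum => j _; rewrite exprMn -[leRHS]mulrA ler_wpM2l ?sqr_ge0 //.
  by rewrite mxE [X in _ + X]mxE.
apply: (le_trans (Re2_le_sqn _)); apply: (le_trans (sqn_sum_size _ _)).
rewrite -mulrA ler_wpM2l // mulr_suml big_seq [leRHS]big_seq; apply: ler_sum => k kK.
rewrite sqnM sqn_ek mulr1 -[leRHS]mulrA; apply: sqn_mulmx_le => j.
(* [K <= N] puts the modes of the kernel among those for which the aliasing bound holds. *)
by apply: sqn_fourier_dft_le => //; exact: modes_sub kK.
Qed.

Lemma state_error t S : (t <= T)%N -> exists Q, forall (a : 'cV[R]_d -> 'cV[R]_da) N,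
  (forall j, Hap s S (fun x => a x j 0)) -> (0 < N)%N -> (K <= N)%N -> forall n j,
  (state F a t (gridpoint R n) j 0 - discrete_state F N a t n j 0) ^+ 2 <=
    Q * N%:R ^- (2 * s).
Proof.
elim: t => [_|t IH tT].
  (* The lifting acts pointwise, so initially the two states agree exactly on the grid. *)
  by exists 0 => a N _ _ _ n j; rewrite subrr expr0n mul0r.
have [Q HQ] := IH (ltnW tT); have [S1 HS1] := state_Hap S (ltnW tT).
have [Q' HQ'] := layer_error S1 Q tT; exists Q' => a N Ha N0 KN n j.
by apply: (HQ' N (state F a t) (discrete_state F N a t)) => // [|n' j']; [exact: HS1|exact: HQ].
Qed.

(** The error splits into [g1], the interpolation error of the exact state, and [g2], the
    interpolant of the grid error, whose energy is bounded by discrete Bessel. *)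
Lemma interp_error m S Q N (u : 'cV[R]_d -> 'cV[R]_m) (v : grid d N -> 'cV[R]_m) :
  (0 < N)%N -> (forall j, Hap s S (fun x => u x j 0)) ->
  (forall n j, (u (gridpoint R n) j 0 - v n j 0) ^+ 2 <= Q * N%:R ^- (2 * s)) ->
  L2norm (fun x => complex_mx (u x) - trig_interp v x) <=
  Num.sqrt (m%:R * (2 * (4 * (2 ^+ (2 * s) + alias_cst s Z) * S) + 2 * Q)) * N%:R ^- s.
Proof.
move=> N0 Hu Huv; set W := 2 * (4 * _ * S) + 2 * Q.
pose e : R := N%:R ^- (2 * s).
have ee : e = (N%:R ^- s) ^+ 2 by rewrite /e mulnC exprM exprVn.
have -> : N%:R ^- s = Num.sqrt e by rewrite ee sqrtr_sqr ger0_norm // invr_ge0 exprn_ge0.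
rewrite -sqrtrM; last first.
  (* The sign of [Q] can be read off only from an actual coordinate at a grid point; when m = 0 the
     factor m makes the product vanish. *)
  rewrite /W; case: m u v Hu Huv => [|m] u v Hu Huv; first by rewrite mul0r.
  have Q0 : 0 <= Q * e.
    apply: le_trans (Huv [ffun=> Ordinal N0] ord0); exact: sqr_ge0.
  rewrite mulr_ge0 // addr_ge0 ?mulr_ge0 ?addr_ge0 ?exprn_ge0 ?(alias_cst_ge0 HZ) //.
    exact: Hap_ge0 (Hu ord0).
  by move: Q0; rewrite pmulr_lge0 // invr_gt0 exprn_gt0 // ltr0n.
rewrite ler_wsqrtr //.
pose g i x := (u x i 0)%:C - tp (modes d N) (dftc (fun n => (v n i 0)%:C)) x.
have ug i : cucb (g i) by apply: cucbB; [exact: cucb_real (Hap_ucb (Hu i))|exact: cucb_tp].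
have -> : (fun x => cfrob (complex_mx (u x) - trig_interp v x) ^+ 2) =
    (fun x => \sum_i sqn (g i x)).
  apply/funext => x; rewrite cfrobE; apply: eq_bigr => i _; congr sqn.
  rewrite mxE [X in _ + X]mxE mxE summxE; congr (_ - _); apply: eq_bigr => k _.
  by rewrite mxE dftE mulrC.
rewrite torus_int_sum; last by move=> i; apply: ucb_sqn.
apply: (@le_trans _ _ (\sum_(i < m) W * e)); last by rewrite sumr_const card_ord -[leLHS]mulr_natl mulrA.
apply: ler_sum => i _.
pose w n := (u (gridpoint R n) i 0)%:C - (v n i 0)%:C : C.
pose g1 x := (u x i 0)%:C - tp (modes d N) (dftc (fun n : grid d N => (u (gridpoint R n) i 0)%:C)) x.
pose g2 x := tp (modes d N) (dftc w) x.
have ug1 : cucb g1 by apply: cucbB; [exact: cucb_real (Hap_ucb (Hu i))|exact: cucb_tp].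
have ug2 : cucb g2 by exact: cucb_tp.
have gE x : g i x = g1 x + g2 x.
  have -> : g2 x = tp (modes d N) (dftc (fun n : grid d N => (u (gridpoint R n) i 0)%:C)) x -
      tp (modes d N) (dftc (fun n => (v n i 0)%:C)) x.
    by rewrite /g2 /tp -sumrB; apply: eq_bigr => k _; rewrite dftcB mulrBl.
  by rewrite /g /g1 addrA subrK.
apply: (@le_trans _ _ (2 * torus_int (fun x => sqn (g1 x)) + 2 * torus_int (fun x => sqn (g2 x)))).
  have u1 := ucb_sqn ug1; have u2 := ucb_sqn ug2.
  rewrite -(torus_intZ 2 u1) -(torus_intZ 2 u2) -torus_intD; [|exact: ucbZ|exact: ucbZ].
  apply: le_torus_int => [||x]; [exact: ucb_sqn|by apply: ucbD; apply: ucbZ|].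
  by rewrite gE; exact: sqnD2.
rewrite torus_parseval ?modes_uniq //.
have h1 := interp_Hap HZ (Hap_ucb (Hu i)) (Hu i) N0.
have h2 : \sum_(k <- modes d N) sqn (dftc w k) <= Q * e.
  by apply: dftc_sum_le => // n; rewrite /w -rcB sqnC; exact: Huv.
rewrite /W; move: h1 h2; rewrite -/e -/(g1 _).
set X := torus_int _; set Y := \sum_(k <- _) _; lra.
Qed.

End States.

Unset Implicit Arguments.

Theorem theorem3p3 (R : realType) (d da du K T s : nat)
    (F : fno R d da du K T) (B M : R) (A Ac : set (Hs R d da s)) (t : nat)
    (d_gt0 : (0 < d)%N) (K_gt0 : (0 < K)%N) (s_gt : (d < 2 * s)%N)
    (B_ge1 : 1 <= B) (F_act : activations_bounded F s B)
    (M_ge1 : 1 <= M) (F_weights : weights_bounded F M)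
    (Ac_sub : Ac `<=` A) (Ac_compact : compact Ac)
    (t_bounds : (1 <= t <= T)%N) :
  exists C' : R, forall N : nat, (1 < N)%N -> (2 * K < N)%N ->
    (ereal_sup
       [set (L2norm (fun x => complex_mx (state F a t x)
                       - trig_interp (discrete_state F N a t) x))%:E
       | a in Ac]
     <= (C' * N%:R ^- s)%:E)%E.
Proof.
have [_ tT] := andP t_bounds.
have s0 : (0 < s)%N by rewrite lt0n; apply: contraTneq s_gt => ->; rewrite muln0.
have [Z _ HZ] := lattice_sum R s_gt.
have [S HS] := compact_Hs_bounded Ac_compact.
have [S' HS'] := state_Hap s0 HZ F S tT.
have [Q HQ] := state_error s0 HZ F S tT.
exists (Num.sqrt ((width F t)%:R *
  (2 * (4 * (2 ^+ (2 * s) + alias_cst s Z) * S') + 2 * Q))) => N N1 KN.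
have N0 : (0 < N)%N by exact: ltnW.
have KN' : (K <= N)%N by apply: leq_trans (ltnW KN); rewrite leq_pmull.
apply: ub_ereal_sup => _ [a /HS Ha <-]; rewrite lee_fin.
by apply: interp_error => // [j|n j]; [exact: HS'|exact: HQ].
Qed.
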